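(* Let $2<p\le\infty$ and $g\in H(\mathbb{D})$. If $I_g:H^p(\mathbb{D})\to\mathcal{L}^{2,1-\frac{2}{p}}(\mathbb{D})$ is bounded, then $\|I_g\|_e\approx\|g\|_\infty$, where $\|g\|_\infty=\sup_{z\in\mathbb{D}}|g(z)|$.
   Context: $\mathbb{D}$ is the open unit disc, $H(\mathbb{D})$ the analytic functions on $\mathbb{D}$, $dA=\frac{1}{\pi}dx\,dy$. For $0<p<\infty$, $H^p(\mathbb{D})$ is the Hardy space with $\|f\|_{H^p}^p=\sup_{0<r<1}\frac{1}{2\pi}\int_0^{2\pi}|f(re^{i\theta})|^pd\theta$; $H^\infty(\mathbb{D})$ is the space of bounded analytic functions with the sup norm. For $g\in H(\mathbb{D})$, $I_gf(z)=\int_0^z f'(w)g(w)\,dw$. For an arc $I\subset\partial\mathbb{D}$, $|I|=\frac{1}{2\pi}\int_I|d\zeta|$, $f_I=\frac{1}{|I|}\int_I f(\zeta)\frac{|d\zeta|}{2\pi}$, $S(I)=\{z\in\mathbb{D}:1-|I|\le |z|<1,\ z/|z|\in I\}$. For $0<\lambda\le1$, $\mathcal{L}^{2,\lambda}(\mathbb{D})$ is the set of $f\in H^2(\mathbb{D})$ with $\sup_{I}\big(|I|^{-\lambda}\int_I|f(\zeta)-f_I|^2\frac{|d\zeta|}{2\pi}\big)^{1/2}<\infty$, normed by $\|f\|_{\mathcal{L}^{2,\lambda}}=|f(0)|+\sup_{I}\big(|I|^{-\lambda}\int_{S(I)}|f'(z)|^2(1-|z|^2)dA(z)\big)^{1/2}$.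 For a bounded linear operator $T:X\to Y$ between Banach spaces, $\|T\|_e=\inf\{\|T-K\|: K:X\to Y\text{ compact}\}$. $A\approx B$ means $A\lesssim B\lesssim A$ with constants depending only on $p$. *)

(* Defs.v *)
(* mathcomp-analysis over an abstract R : realType,
   complex numbers = R[i] (mathcomp-real-closed), viewed as the normed
   R[i]-module R[i]^o so that [derivable f z 1] is complex differentiability. *)
From HB Require Import structures.
From mathcomp Require Import all_boot all_order all_algebra.
From mathcomp Require Import all_classical all_reals all_analysis.
From mathcomp Require Import complex.
Set Implicit Arguments. Unset Strict Implicit. Unset Printing Implicit Defensive.
Import Order.TTheory GRing.Theory Num.Theory.
Import numFieldNormedType.Exports.
Local Open Scope classical_set_scope.
Local Open Scope ring_scope.
Local Open Scope complex_scope.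

Section Defs.
Variable R : realType.

Local Notation C := ((R[i])^o).
(* functions on the plane; only their values on the disc matter *)
Local Notation fn := (C -> C).

Definition modc (z : R[i]) : R := Normc.normc z.

Definition expi (t : R) : R[i] := (cos t) +i* (sin t).

Definition disc : set C := [set z | modc z < 1].

Definition analytic_on_disc (f : fn) : Prop :=
  forall z : C, disc z -> derivable f z 1.

Definition cderiv (f : fn) : fn := fun z => derive1 f z.

Definition cint (G : R -> R[i]) (A : set R) : R[i] :=
  (Rintegral lebesgue_measure A (fun t => @complex.Re R (G t))) +i*
  (Rintegral lebesgue_measure A (fun t => @complex.Im R (G t))).

Definition supnorm (g : fn) : \bar R :=
  ereal_sup [set (modc (g z))%:E | z in disc].

Definition circ_mean (q : R) (f : fn) (r : R) : \bar R :=
  ((2 * pi)^-1)%:E *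
  (\int[lebesgue_measure]_(t in `[0%R, (2 * pi)%R]) ((modc (f (r%:C * expi t))) `^ q)%:E)%E.

Definition Hp_norm (p : \bar R) (f : fn) : \bar R :=
  match p with
  | EFin q => ereal_sup [set ((circ_mean q f r) `^ (q^-1))%E | r in `]0%R, 1%R[]
  | +oo%E => supnorm f
  | -oo%E => 0%E
  end.

Definition Hp (p : \bar R) (f : fn) : Prop :=
  analytic_on_disc f /\ (Hp_norm p f < +oo)%E.

(* Arcs: I = { e^{it} : a <= t <= a + 2 pi l } with 0 < l <= 1, so |I| = l.
   Carleson box S(I) = { z in D : 1 - |I| <= |z| < 1, z/|z| in I },
   as a subset of R x R (z = x + i y). *)
Definition cbox (a l : R) : set (R * R) :=
  [set xy | exists r t : R, 1 - l <= r < 1 /\ a <= t <= a + 2 * pi * l /\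
                            xy = (r * cos t, r * sin t)].

Definition toC (xy : R * R) : C := xy.1 +i* xy.2.

Definition area_int (A : set (R * R)) (F : R * R -> R) : \bar R :=
  (\int[((@lebesgue_measure R) \x (@lebesgue_measure R))%E]_(xy in A)
     (F xy / pi)%:E)%E.

Definition carleson_part (lam : R) (f : fn) : \bar R :=
  ereal_sup [set E | exists a l : R, 0 < l <= 1 /\
     E = (((l `^ (- lam))%:E *
           area_int (cbox a l)
             (fun xy => modc (cderiv f (toC xy)) ^+ 2 * (1 - modc (toC xy) ^+ 2))%R)
          `^ (2^-1))%E].

Definition L2lam_norm (lam : R) (f : fn) : \bar R :=
  ((modc (f 0))%:E + carleson_part lam f)%E.

Definition bval (f : fn) (t : R) : C :=
  lim ((fun r : R => f (r%:C * expi t)) @ (at_left (1%R : R))).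

Definition boundary_osc (lam : R) (f : fn) : \bar R :=
  ereal_sup [set E | exists a l : R, 0 < l <= 1 /\
     let arc := `[a, a + 2 * pi * l]%classic in
     let fI := ((l * (2 * pi))^-1)%:C * cint (bval f) arc in
     E = (((l `^ (- lam))%:E * ((2 * pi)^-1)%:E *
           \int[lebesgue_measure]_(t in arc) ((modc (bval f t - fI)) ^+ 2)%:E)
          `^ (2^-1))%E].

Definition L2lam (lam : R) (f : fn) : Prop :=
  Hp 2%:E f /\ (boundary_osc lam f < +oo)%E.

Definition lam_of (p : \bar R) : R :=
  match p with EFin q => 1 - 2 / q | _ => 1 end.

(* the integration operator I_g f(z) = int_0^z f'(w) g(w) dw
   (along the segment [0,z]: w = t z, dw = z dt) *)
Definition Ig (g : fn) : fn -> fn :=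
  fun f z => z * cint (fun t => cderiv f (t%:C * z) * g (t%:C * z)) `[0%R, 1%R].

Definition lin_on (X : fn -> Prop) (T : fn -> fn) : Prop :=
  forall (f h : fn) (a : C), X f -> X h ->
    forall z, disc z -> T (fun w => a * f w + h w) z = a * T f z + T h z.

Definition op_norm (X : fn -> Prop) (NX NY : fn -> \bar R) (T : fn -> fn) : \bar R :=
  ereal_sup [set NY (T f) | f in [set f | X f /\ (NX f <= 1)%E]].

Definition bounded_op (X : fn -> Prop) (NX : fn -> \bar R)
    (Y : fn -> Prop) (NY : fn -> \bar R) (T : fn -> fn) : Prop :=
  lin_on X T /\ (forall f, X f -> Y (T f)) /\ (op_norm X NX NY T < +oo)%E.

(* compact operator: linear, X -> Y, and the image of the unit ball of X is
   relatively compact in Y (every sequence in it has a subsequence converging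
   in the Y-norm to an element of Y) *)
Definition compact_op (X : fn -> Prop) (NX : fn -> \bar R)
    (Y : fn -> Prop) (NY : fn -> \bar R) (K : fn -> fn) : Prop :=
  lin_on X K /\ (forall f, X f -> Y (K f)) /\
  forall u : nat -> fn, (forall n, X (u n) /\ (NX (u n) <= 1)%E) ->
    exists (phi : nat -> nat) (h : fn),
      {homo phi : m n / (m < n)%N} /\ Y h /\
      (fun n => NY (fun z => K (u (phi n)) z - h z)) @ \oo --> 0%E.

Definition ess_norm (X : fn -> Prop) (NX : fn -> \bar R)
    (Y : fn -> Prop) (NY : fn -> \bar R) (T : fn -> fn) : \bar R :=
  ereal_inf [set op_norm X NX NY (fun f z => T f z - K f z)
            | K in compact_op X NX Y NY].

End Defs.

(* Main.v *)
Require Import Defs.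
From HB Require Import structures.
From mathcomp Require Import all_boot all_order all_algebra.
From mathcomp Require Import all_classical all_reals all_analysis.
From mathcomp Require Import measurable_realfun complex ring lra.
Import Order.TTheory GRing.Theory Num.Theory.
Import numFieldNormedType.Exports.
Local Open Scope classical_set_scope.
Local Open Scope ring_scope.
(** The upper bound tests [K = 0].  On the Carleson box over an arc [I] of length
    [l] take [k z = 1 / (1 - b z)], where [conj b] is the point of modulus
    [1 - l] above the centre of [I]; there [|k| >= c / l], so it suffices to
    bound the weighted area integral of [|f' k|^2] over the whole disc.  Since
    [f' k = (f k)' - f k'], the Littlewood-Paley inequality for [f k] and
    [|k'| <= |k|^2] reduce this to the circular means of [|f k|^2], which are
    controlled by splitting [|f|] at the level [l ^ (- 1 / p)] and by the
    Poisson kernel [|k|^2].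

    For the lower bound, let [u_n] be normalised kernels at points [a_n]
    tending to the circle along which [|g|] exceeds a given [m < sup |g|] (they
    exist by the maximum modulus principle).  If [K] is compact, [K u_n]
    converges to some [h] along a subsequence, so [K (u_j - u_k)] is small for
    large [j, k], while [u_k' (a_j)] tends to 0 as [k] tends to infinity.
    Evaluating the derivative of [(I_g - K) (u_j - u_k)] at [a_j], which is
    bounded by the target norm through the sub-mean value property on a ball
    inside a Carleson box, gives [m <= C |I_g - K|]. *)

(** With [lam = 1 - 2 / p], the exponent [(1 + lam) / 2 = 1 - 1 / p] normalises the kernel in the
    Hardy space, and [(3 - lam) / 2] governs evaluation of the derivative in the target. They add up
    to 2, the order of the pole of the kernel's derivative, so no power of [1 - |a_n|] survives in
    the lower bound.

    Compactness enters through differences of two test functions, one index fixed and the other far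
    out: only linearity of [K] and pointwise estimates are involved, no weak topology. The factor
    1/4 in the test functions keeps such differences in the unit ball.

    Analyticity is complex differentiability at each point, without continuity of the derivative;
    hence Goursat's theorem comes first, and Cauchy's formula is reached in two passes. Area
    integrals are treated through continuous cut-offs on the plane, for which polar coordinates
    follow from one-variable substitutions and Fubini.

    Both constants are absolute: [1 / 2048] is [1 / 64 * 1 / 32], and [5 * (2 + 2 * pi)] is the
    kernel bound on boxes times a rounded square root of 20. *)

Set Implicit Arguments. Unset Strict Implicit. Unset Printing Implicit Defensive.
Local Open Scope complex_scope.

(** * Integrals over compact intervals *)

Section RealIntegral.
Context {R : realType}.
Notation mu := (@lebesgue_measure R).
Implicit Types (a b c x : R) (f g : R -> R).

Definition RI a b f : R := Rintegral mu `[a, b]%classic f.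

Definition clamp a b x := Num.max a (Num.min b x).

Lemma clamp_id a b x : a <= x <= b -> clamp a b x = x.
Proof. by move=> /andP[ax xb]; rewrite /clamp min_r// max_r. Qed.

Lemma clamp_in a b x : a <= b -> a <= clamp a b x <= b.
Proof. by move=> ab; rewrite /clamp le_max lexx/= ge_max ab/= ge_min lexx. Qed.

Lemma clamp_continuous a b : continuous (clamp a b).
Proof.
move=> x; apply: (@continuous_max _ _ (fun=> a) (Num.min b)).
  exact: cst_continuous.
by apply: (@continuous_min _ _ (fun=> b) id) => //; exact: cst_continuous.
Qed.

(** Continuity on [[a, b]], encoded as continuity on the whole line of the extension of [f] that is
    constant outside the interval. Restrictions, compositions and primitives then stay within
    ordinary continuity of total functions. *)
Definition cts a b f := continuous (f \o clamp a b).

Lemma cts_pt a b f : a <= b -> (forall x, a <= x <= b -> {for x, continuous f}) ->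
  cts a b f.
Proof.
move=> ab cf x; apply: continuous_comp; first exact: clamp_continuous.
by apply: cf; exact: clamp_in.
Qed.

Lemma cts_within a b f : cts a b f -> {within `[a, b], continuous f}.
Proof.
move=> cf; apply: (@subspace_eq_continuous _ _ _ (f \o clamp a b)).
  by move=> x; rewrite inE/= in_itv/= => xab; rewrite clamp_id.
exact: continuous_subspaceT.
Qed.

Lemma ctsS a b c d f : c <= a -> a <= b -> b <= d -> cts c d f -> cts a b f.
Proof.
move=> ca ab bd cf; rewrite /cts (_ : _ \o _ = (f \o clamp c d) \o clamp a b); last first.
  apply/funext => x /=; congr f; rewrite [RHS]clamp_id//.
  by have /andP[h1 h2] := clamp_in x ab; rewrite (le_trans ca h1) (le_trans h2 bd).
move=> x; apply: continuous_comp; first exact: clamp_continuous.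
exact: cf.
Qed.

Lemma cts_eq a b f g : a <= b -> (forall x, a <= x <= b -> f x = g x) ->
  cts a b f -> cts a b g.
Proof.
move=> ab fg; rewrite /cts (_ : f \o _ = g \o clamp a b)//.
by apply/funext => x /=; apply: fg; exact: clamp_in.
Qed.

Lemma ctsD a b f g : cts a b f -> cts a b g -> cts a b (fun x => f x + g x).
Proof. by move=> cf cg x; apply: (continuousD (cf x) (cg x)). Qed.

Lemma ctsB a b f g : cts a b f -> cts a b g -> cts a b (fun x => f x - g x).
Proof. by move=> cf cg x; apply: (continuousB (cf x) (cg x)). Qed.

Lemma ctsM a b f g : cts a b f -> cts a b g -> cts a b (fun x => f x * g x).
Proof. by move=> cf cg x; apply: (continuousM (cf x) (cg x)). Qed.

Lemma cts_integrable a b f : cts a b f -> mu.-integrable `[a, b] (EFin \o f).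
Proof.
move=> cf; apply: continuous_compact_integrable; first exact: segment_compact.
exact: cts_within.
Qed.

Lemma RI_eq a b f g : (forall x, a <= x <= b -> f x = g x) -> RI a b f = RI a b g.
Proof.
by move=> fg; apply: eq_Rintegral => x; rewrite inE/= in_itv/=; exact: fg.
Qed.

Lemma RI_FTC a b (F f : R -> R) : a <= b -> cts a b f ->
  (forall x, a <= x <= b -> is_derive x 1 F (f x)) -> RI a b f = F b - F a.
Proof.
rewrite le_eqVlt => /predU1P[-> _ _|ab cf dF].
  by rewrite /RI set_itv1 Rintegral_set1 subrr.
have cF x : a <= x <= b -> {for x, continuous F}.
  move=> /dF dFx; apply: differentiable_continuous.
  by apply/derivable1_diffP.
rewrite /RI /Rintegral (@continuous_FTC2 _ f F)//.
- exact: cts_within.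
- split.
  + by move=> x; rewrite in_itv/= => /andP[ax xb]; have := dF x; rewrite !ltW//= => /(_ isT) [].
  + by apply: cvg_at_right_filter; apply: cF; rewrite lexx ltW.
  + by apply: cvg_at_left_filter; apply: cF; rewrite lexx ltW.
- move=> x; rewrite in_itv/= => /andP[ax xb].
  by have := dF x; rewrite !ltW//= => /(_ isT) dx; rewrite derive1E derive_val.
Qed.

Lemma RI_le a b f g : cts a b f -> cts a b g ->
  (forall x, a <= x <= b -> f x <= g x) -> RI a b f <= RI a b g.
Proof.
by move=> cf cg fg; apply: le_Rintegral => //; exact: cts_integrable.
Qed.

Lemma RID a b f g : cts a b f -> cts a b g ->
  RI a b (fun x => f x + g x) = RI a b f + RI a b g.
Proof. by move=> cf cg; apply: RintegralD => //; exact: cts_integrable. Qed.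

Lemma RIB a b f g : cts a b f -> cts a b g ->
  RI a b (fun x => f x - g x) = RI a b f - RI a b g.
Proof. by move=> cf cg; apply: RintegralB => //; exact: cts_integrable. Qed.

Lemma RIZ a b f c : cts a b f -> RI a b (fun x => c * f x) = c * RI a b f.
Proof. by move=> cf; apply: RintegralZl => //; exact: cts_integrable. Qed.

Lemma RI_cst a b c : a <= b -> RI a b (fun=> c) = c * (b - a).
Proof.
move=> ab; rewrite /RI Rintegral_cst//= lebesgue_measure_itv/= lte_fin.
by move: ab; rewrite le_eqVlt => /predU1P[->|->]; rewrite ?ltxx ?subrr//.
Qed.

Lemma RI_split a b c f : a <= b -> b <= c -> cts a c f ->
  RI a c f = RI a b f + RI b c f.
Proof.
move=> ab bc cf; rewrite /RI.
have := @Rintegral_itvB R f (BLeft a) (BRight c) b (cts_integrable cf).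
rewrite !bnd_simp => /(_ ab bc).
rewrite Rintegral_itv_obnd_cbnd; last first.
  apply: (@integrableS _ _ _ mu `[a, c]%classic) => //; last exact: cts_integrable.
  by apply: subset_itvScc; rewrite bnd_simp.
by move=> <-; rewrite addrC subrK.
Qed.

Lemma RI_ge0 a b f : (forall x, a <= x <= b -> 0 <= f x) -> 0 <= RI a b f.
Proof. by move=> f0; apply: Rintegral_ge0 => x/=; rewrite in_itv; exact: f0. Qed.

Lemma cts_cst a b c : cts a b (fun=> c).
Proof. by move=> x; exact: cst_continuous. Qed.

Lemma RI_normr a b f c : a <= b -> cts a b f ->
  (forall x, a <= x <= b -> `|f x| <= c) -> `|RI a b f| <= c * (b - a).
Proof.
move=> ab cf fc; rewrite ler_norml -mulNr -!RI_cst//; apply/andP; split;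
  apply: RI_le => //; try exact: cts_cst; move=> x /fc; rewrite ler_norml => /andP[]//.
Qed.

Lemma continuous_primitive f c : continuous f ->
  exists P : R -> R, forall x, c < x -> is_derive x 1 P (f x).
Proof.
move=> cf; exists (fun x => RI c x f) => x cx.
have [] := @continuous_FTC1 R f (BLeft c) x (x + 1).
- by rewrite ltrDl.
- apply: (@cts_integrable c (x + 1) f); apply: cts_pt => [|y _]; [lra|exact: cf].
- by rewrite /= lte_fin.
- exact: cf.
- by move=> dF <-; rewrite derive1E; exact: derivableP.
Qed.

Lemma is_derive_continuous f x d : is_derive x 1 f d -> {for x, continuous f}.
Proof.
by move=> df; apply: differentiable_continuous; apply/derivable1_diffP.
Qed.

(** A single primitive [P] of the clamped [f] evaluates both integrals, and [P \o phi] is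
    differentiated by the chain rule. Stating the result through [P] serves orientation-preserving
    and orientation-reversing substitutions alike. *)
Lemma RI_subst_primitive a b c d (phi dphi f : R -> R) : a <= b -> c <= d ->
  (forall x, a <= x <= b -> is_derive x 1 phi (dphi x)) -> cts a b dphi ->
  (forall x, a <= x <= b -> c <= phi x <= d) -> cts c d f ->
  exists P : R -> R, 
   (forall u v, c <= u -> u <= v -> v <= d -> RI u v f = P v - P u) /\
   RI a b (fun x => f (phi x) * dphi x) = P (phi b) - P (phi a).
Proof.
move=> ab cd dphi_ cdphi phicd cf.
(* The primitive starts at [c - 1], so that it has a two-sided derivative at [c] too. *)
have [P dP] := @continuous_primitive (f \o clamp c d) (c - 1) cf.
have cP x : c <= x -> c - 1 < x by lra.
exists P; split.
  move=> u v cu uv vd; apply: RI_FTC => //.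
    by apply: ctsS cf.
  move=> x /andP[ux xv]; have := dP x (cP x (le_trans cu ux)).
  by rewrite /= clamp_id//; lra.
apply: (@RI_FTC _ _ (P \o phi)) => [//||x xab].
  apply: ctsM => //; rewrite /cts (_ : _ \o _ = (f \o clamp c d) \o (phi \o clamp a b)).
    move=> x; apply: continuous_comp; last exact: cf.
    by apply: cts_pt => // y /dphi_/is_derive_continuous.
  by apply/funext => x /=; rewrite [in RHS]clamp_id// phicd// clamp_in.
have /andP[h1 h2] := phicd x xab.
apply: (@is_derive1_comp _ P phi x).
  have e : clamp c d (phi x) = phi x by rewrite clamp_id// phicd.
  by have := dP (phi x) (cP _ h1); rewrite /= e.
exact: dphi_.
Qed.

Lemma RI_subst a b (phi dphi f : R -> R) : a <= b ->
  (forall x, a <= x <= b -> is_derive x 1 phi (dphi x)) -> cts a b dphi ->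
  (forall x, a <= x <= b -> phi a <= phi x <= phi b) -> cts (phi a) (phi b) f ->
  RI (phi a) (phi b) f = RI a b (fun x => f (phi x) * dphi x).
Proof.
move=> ab dphi_ cdphi phicd cf.
have pab : phi a <= phi b by have /phicd/andP[] : a <= b <= b by rewrite ab lexx.
have [P [-> // ->//]] := RI_subst_primitive ab pab dphi_ cdphi phicd cf.
Qed.

Lemma RI_substN a b (phi dphi f : R -> R) : a <= b ->
  (forall x, a <= x <= b -> is_derive x 1 phi (dphi x)) -> cts a b dphi ->
  (forall x, a <= x <= b -> phi b <= phi x <= phi a) -> cts (phi b) (phi a) f ->
  RI (phi b) (phi a) f = - RI a b (fun x => f (phi x) * dphi x).
Proof.
move=> ab dphi_ cdphi phicd cf.
have pab : phi b <= phi a by have /phicd/andP[] : a <= a <= b by rewrite ab lexx.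
have [P [-> // ->]] := RI_subst_primitive ab pab dphi_ cdphi phicd cf.
by rewrite opprB.
Qed.

Lemma RI_fin a b f : cts a b f ->
  (\int[mu]_(x in `[a, b]) (f x)%:E)%E = (RI a b f)%:E.
Proof.
move=> cf; rewrite /RI /Rintegral fineK//.
by apply: integrable_fin_num => //; exact: cts_integrable.
Qed.

End RealIntegral.

(** * Continuous functions on the plane *)

Section Plane.
Context {R : realType}.
Notation mu := (@lebesgue_measure R).
Implicit Types (a b c d x y : R) (G : R * R -> R).

(** An open set is the union of the countably many open rectangles with rational corners that it
    contains, and rectangles belong to the product sigma-algebra. *)
Lemma open2_measurable (O : set (R * R)) : open O -> measurable O.
Proof.
move=> oO.
pose Q (i : rat * rat * (rat * rat)) : set (R * R) :=
  `]ratr i.1.1 : R, ratr i.1.2[ `*` `]ratr i.2.1 : R, ratr i.2.2[.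
pose D i : set (R * R) := if `[< Q i `<=` O >] then Q i else set0.
suff -> : O = \bigcup_i D i.
  apply: countable_bigcupT_measurable; first exact: countableP.
  move=> i; rewrite /D; case: asboolP => _; last exact: measurable0.
  by apply: measurableX; exact: measurable_itv.
apply/seteqP; split=> [[x y] Oxy|p [i _]]; last first.
  by rewrite /D; case: asboolP => // + Qp; exact.
have /nbhs_ballP[e /= e0 be] := open_nbhs_nbhs (conj oO Oxy).
have [q1 /itvP q1P] := @rat_in_itvoo R (x - e) x ltac:(lra).
have [q2 /itvP q2P] := @rat_in_itvoo R x (x + e) ltac:(lra).
have [q3 /itvP q3P] := @rat_in_itvoo R (y - e) y ltac:(lra).
have [q4 /itvP q4P] := @rat_in_itvoo R y (y + e) ltac:(lra).
exists ((q1, q2), (q3, q4)) => //; rewrite /D; case: asboolP.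
  by move=> _; rewrite /Q /= !in_itv /= q1P q2P q3P q4P.
case => -[u v]; rewrite /Q /= !in_itv /= => -[/andP[h1 h2] /andP[h3 h4]]; apply: be.
split; rewrite /ball /= ltr_distlC; apply/andP; split.
- by apply: lt_trans h1; rewrite q1P.
- by apply: (lt_trans h2); rewrite q2P.
- by apply: lt_trans h3; rewrite q3P.
- by apply: (lt_trans h4); rewrite q4P.
Qed.

Lemma continuous2_measurable G : continuous G -> measurable_fun setT G.
Proof.
move=> /continuousP cG; apply: (measurability _ (RGenOpens.measurableE R)).
move=> _ [_ [a [b ->] <-]]; rewrite setTI; apply: open2_measurable.
exact/cG/interval_open.
Qed.

Lemma pair_continuous (T : topologicalType) (f g : T -> R) (t : T) :
  {for t, continuous f} -> {for t, continuous g} ->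
  {for t, continuous (fun t => (f t, g t))}.
Proof. by move=> cf cg; exact: (cvg_pair cf cg). Qed.

Lemma fst_continuous : continuous (fst : R * R -> R).
Proof. by move=> p; exact: cvg_fst. Qed.

Lemma snd_continuous : continuous (snd : R * R -> R).
Proof. by move=> p; exact: cvg_snd. Qed.

Definition clamp2 a b c d (p : R * R) := (clamp a b p.1, clamp c d p.2).

Lemma clamp2_continuous a b c d : continuous (clamp2 a b c d).
Proof.
move=> p; apply: (@pair_continuous _ (fun q : R * R => clamp a b q.1) (fun q => clamp c d q.2)).
- by apply: continuous_comp; [exact: fst_continuous|exact: clamp_continuous].
- by apply: continuous_comp; [exact: snd_continuous|exact: clamp_continuous].
Qed.

Definition cts2 a b c d G := continuous (G \o clamp2 a b c d).

Lemma cts2_pt a b c d G : a <= b -> c <= d ->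
  (forall x y, a <= x <= b -> c <= y <= d -> {for (x, y), continuous G}) ->
  cts2 a b c d G.
Proof.
move=> ab cd cG p; apply: continuous_comp; first exact: clamp2_continuous.
by apply: cG; exact: clamp_in.
Qed.

Lemma cts2D a b c d f g : cts2 a b c d f -> cts2 a b c d g ->
  cts2 a b c d (fun p => f p + g p).
Proof. by move=> cf cg x; apply: (continuousD (cf x) (cg x)). Qed.

Lemma pair1_continuous y : continuous (fun x : R => (x, y)).
Proof. by move=> x; apply: (@pair_continuous _ id (fun=> y)) => //; exact: cst_continuous. Qed.

Lemma pair2_continuous x : continuous (fun y : R => (x, y)).
Proof. by move=> y; apply: (@pair_continuous _ (fun=> x) id) => //; exact: cst_continuous. Qed.

Lemma cts2_sec2 a b c d G x : cts2 a b c d G -> a <= x <= b ->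
  cts c d (fun y => G (x, y)).
Proof.
move=> cG xab; rewrite /cts (_ : _ \o _ = (G \o clamp2 a b c d) \o pair x).
  by move=> y; apply: continuous_comp; [exact: pair2_continuous|exact: cG].
by apply/funext => y /=; rewrite /clamp2/= [clamp a b x]clamp_id.
Qed.

Lemma cts2_sec1 a b c d G y : cts2 a b c d G -> c <= y <= d ->
  cts a b (fun x => G (x, y)).
Proof.
move=> cG xab; rewrite /cts (_ : _ \o _ = (G \o clamp2 a b c d) \o pair^~ y).
  by move=> x; apply: continuous_comp; [exact: pair1_continuous|exact: cG].
by apply/funext => x /=; rewrite /clamp2/= [clamp c d y]clamp_id.
Qed.

Definition swapp (p : R * R) := (p.2, p.1).

Lemma swap_continuous : continuous swapp.
Proof. by move=> p; apply: (@pair_continuous _ snd fst); [exact: snd_continuous|exact: fst_continuous]. Qed.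

Lemma cts2_swap a b c d G : cts2 a b c d G -> cts2 c d a b (G \o swapp).
Proof.
move=> cG; rewrite /cts2 (_ : _ \o _ = (G \o clamp2 a b c d) \o swapp)//.
by move=> p; apply: continuous_comp; [exact: swap_continuous|exact: cG].
Qed.

(** Compactness of [[c, d]] makes the continuity of [G] at [x] uniform in [y], so the sections over
    nearby abscissas are uniformly close. *)
Lemma RI_param_cts a b c d G : a <= b -> c <= d -> cts2 a b c d G ->
  cts a b (fun x => RI c d (fun y => G (x, y))).
Proof.
move=> ab cd cG x; apply/cvgrPdist_le => /= e e0.
pose H := G \o clamp2 a b c d.
(* Adding 1 to the length keeps the denominator positive when [c = d]. *)
have e1 : 0 < e / (d - c + 1) by apply: divr_gt0 => //; lra.
have /compact_near_coveringP nc := @segment_compact R c d.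
have : \forall x' \near x, `[c, d]%classic `<=`
    (fun y => `|H (x, y) - H (x', y)| <= e / (d - c + 1)).
  apply: (nc _ (nbhs x) (fun x' y => `|H (x, y) - H (x', y)| <= e / (d - c + 1))) => y _.
  have e2 : 0 < e / (d - c + 1) / 2 by apply: divr_gt0.
  have cH : {for (x, y), continuous H} := cG (x, y).
  have /cvgrPdist_le/(_ _ e2) := cH => -[[A B]] /= [hA hB] hAB.
  exists (B, A) => //= -[y' x'] /= [hy hx].
  have h1 := hAB (x', y') (conj hx hy).
  have h2 := hAB (x, y') (conj (nbhs_singleton hA) hy).
  rewrite -(subrKA (H (x, y))) (le_trans (ler_normD _ _))//.
  rewrite distrC; move: h1 h2 => /=; lra.
apply: filterS => x' hx' /=.
have cts' u : cts c d (fun y => G (clamp a b u, y)).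
  by apply: (cts2_sec2 cG); exact: clamp_in.
rewrite -RIB//; apply: le_trans (RI_normr cd (c := e / (d - c + 1)) _ _) _.
- exact: ctsB.
- by move=> y ycd; have := hx' y; rewrite /H /= /clamp2/= [clamp c d y]clamp_id// in_itv; apply.
- by rewrite mulrAC ler_pdivrMr; [rewrite ler_pM2l//; lra|lra].
Qed.

(** Tonelli for the zero extension [H] of the clamped [G]: the clamp gives measurability through
    continuity, and the zero extension turns integrals over the plane into integrals over the
    rectangle. *)
Lemma RI_swap_ge0 a b c d G : a <= b -> c <= d -> cts2 a b c d G ->
  (forall p, 0 <= G p) ->
  RI a b (fun x => RI c d (fun y => G (x, y))) =
  RI c d (fun y => RI a b (fun x => G (x, y))).
Proof.
move=> ab cd cG G0.
pose A := `[a, b]%classic; pose B := `[c, d]%classic.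
pose H : R * R -> \bar R := (EFin \o (G \o clamp2 a b c d)) \_ (A `*` B).
have mH : measurable_fun setT H.
  apply/(measurable_restrictT _ _).1; first by apply: measurableX; exact: measurable_itv.
  by apply: measurable_funTS; apply/measurable_EFinP; exact: continuous2_measurable.
have H0 p : (0 <= H p)%E.
  by rewrite /H patchE; case: ifPn => // _; rewrite lee_fin; exact: G0.
have := fubini_tonelli (m1 := mu) (m2 := mu) H mH H0.
have -> : (\int[mu]_x \int[mu]_y H (x, y) = 
   \int[mu]_(x in A) (RI c d (fun y => G (x, y)))%:E)%E.
  rewrite [RHS]integral_mkcond; apply: eq_integral => x _; rewrite patchE; case: ifPn => xA.
    rewrite -RI_fin; last by apply: (cts2_sec2 cG); move: xA; rewrite inE /A /= in_itv.
    rewrite [RHS]integral_mkcond; apply: eq_integral => y _; rewrite /H !patchE.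
    rewrite in_setX xA/=; case: ifPn => // yB.
    by move: xA yB; rewrite !inE /A /B /= !in_itv/= => ? ?; rewrite /clamp2/= !clamp_id.
  by apply: integral0_eq => y _; rewrite /H patchE in_setX (negbTE xA).
have -> : (\int[mu]_y \int[mu]_x H (x, y) = 
   \int[mu]_(y in B) (RI a b (fun x => G (x, y)))%:E)%E.
  rewrite [RHS]integral_mkcond; apply: eq_integral => y _; rewrite patchE; case: ifPn => yB.
    rewrite -RI_fin; last by apply: (cts2_sec1 cG); move: yB; rewrite inE /B /= in_itv.
    rewrite [RHS]integral_mkcond; apply: eq_integral => x _; rewrite /H !patchE.
    rewrite in_setX yB andbT; case: ifPn => // xA.
    by move: xA yB; rewrite !inE /A /B /= !in_itv/= => ? ?; rewrite /clamp2/= !clamp_id.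
  by apply: integral0_eq => x _; rewrite /H patchE in_setX (negbTE yB) andbF.
by move=> e; rewrite /RI /Rintegral e.
Qed.

(** Reduced to the nonnegative case by [G = (|G| + G) - |G|], whose two terms are continuous and
    nonnegative. *)
Lemma RI_swap a b c d G : a <= b -> c <= d -> cts2 a b c d G ->
  RI a b (fun x => RI c d (fun y => G (x, y))) =
  RI c d (fun y => RI a b (fun x => G (x, y))).
Proof.
move=> ab cd cG.
pose P p := `|G p| + G p; pose N p : R := `|G p|.
have cN : cts2 a b c d N.
  move=> p; apply: (@continuous_comp _ _ _ (G \o clamp2 a b c d) Num.norm).
    exact: cG.
  exact: norm_continuous.
have cP : cts2 a b c d P by exact: cts2D.
have P0 p : 0 <= P p by rewrite /P addrC -lerBlDr sub0r lerNnormlW.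
have N0 p : 0 <= N p by exact: normr_ge0.
have E1 x : a <= x <= b -> RI c d (fun y => G (x, y)) = 
   RI c d (fun y => P (x, y)) - RI c d (fun y => N (x, y)).
  move=> xab; rewrite -RIB; [|exact: cts2_sec2 cP _|exact: cts2_sec2 cN _].
  by apply: RI_eq => y _; rewrite /P addrC addKr.
have E2 y : c <= y <= d -> RI a b (fun x => G (x, y)) = 
   RI a b (fun x => P (x, y)) - RI a b (fun x => N (x, y)).
  move=> xab; rewrite -RIB; [|exact: cts2_sec1 cP _|exact: cts2_sec1 cN _].
  by apply: RI_eq => x _; rewrite /P addrC addKr.
have eP := RI_swap_ge0 ab cd cP P0; have eN := RI_swap_ge0 ab cd cN N0.
have sP := RI_param_cts ab cd cP; have sN := RI_param_cts ab cd cN.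
have sP' := RI_param_cts cd ab (cts2_swap cP).
have sN' := RI_param_cts cd ab (cts2_swap cN).
by rewrite (RI_eq E1) (RI_eq E2) (RIB sP sN) (RIB sP' sN') eP eN.
Qed.

End Plane.

(** * Complex differentiability *)

Section ComplexBasics.
Context {R : realType}.
Notation C := ((R[i])^o).
Implicit Types (z w : R[i]).

Lemma modc_ge0 z : 0 <= modc z.
Proof. by case: z => a b; rewrite /modc /=; exact: sqrtr_ge0. Qed.

Lemma sqr_modc z : modc z ^+ 2 = complex.Re z ^+ 2 + complex.Im z ^+ 2.
Proof.
by case: z => a b; rewrite /modc /= sqr_sqrtr// addr_ge0// sqr_ge0.
Qed.

Lemma modc0 : modc (0 : R[i]) = 0. Proof. exact: Normc.normc0. Qed.
Lemma modc1 : modc (1 : R[i]) = 1. Proof. exact: Normc.normc1. Qed.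
Lemma modcM z w : modc (z * w) = modc z * modc w.
Proof. exact: Normc.normcM. Qed.
Lemma modcV z : modc z^-1 = (modc z)^-1.
Proof. exact: Normc.normcV. Qed.
Lemma modcN z : modc (- z) = modc z.
Proof. exact: normcN. Qed.
Lemma modcD z w : modc (z + w) <= modc z + modc w.
Proof. exact: le_normcD. Qed.
Lemma modcB z w : modc (z - w) <= modc z + modc w.
Proof. by rewrite -(modcN w); exact: modcD. Qed.
Lemma modc_distC z w : modc (z - w) = modc (w - z).
Proof. by rewrite -modcN opprB. Qed.
Lemma modcX z n : modc (z ^+ n) = modc z ^+ n.
Proof. by elim: n => [|n ih]; rewrite ?modc1// !exprS modcM ih. Qed.
Lemma modc_nat n : modc (n%:R : R[i]) = n%:R.
Proof. by rewrite /modc normcMn [Normc.normc 1]modc1. Qed.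
Lemma modc_eq0 z : modc z = 0 -> z = 0.
Proof. exact: Normc.eq0_normc. Qed.
Lemma modc_gt0 z : z != 0 -> 0 < modc z.
Proof.
by move=> z0; rewrite lt0r modc_ge0 andbT; apply: contra z0 => /eqP/modc_eq0 ->.
Qed.
Lemma modc_gt0_neq0 z : 0 < modc z -> z != 0.
Proof. by apply: contraTneq => ->; rewrite modc0 ltxx. Qed.
Lemma modc_real (x : R) : modc x%:C = `|x|.
Proof. by rewrite /modc /= expr0n /= addr0 sqrtr_sqr. Qed.
Lemma modc_conj z : modc (conjc z) = modc z.
Proof. by case: z => a b; rewrite /modc /= sqrrN. Qed.
Lemma modc_Re z : `|complex.Re z| <= modc z.
Proof.
by rewrite -sqrtr_sqr -[leRHS]ger0_norm ?modc_ge0// -sqrtr_sqr sqr_modc ler_wsqrtr// lerDl sqr_ge0.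
Qed.
Lemma modc_Im z : `|complex.Im z| <= modc z.
Proof.
by rewrite -sqrtr_sqr -[leRHS]ger0_norm ?modc_ge0// -sqrtr_sqr sqr_modc ler_wsqrtr// lerDr sqr_ge0.
Qed.
Lemma modc_le z : modc z <= `|complex.Re z| + `|complex.Im z|.
Proof.
rewrite {1}[z]complexE (le_trans (modcD _ _))// modcM !modc_real.
by rewrite (_ : modc 'i = 1) ?mul1r// /modc/= expr0n add0r expr1n sqrtr1.
Qed.
Lemma modc_expi (t : R) : modc (expi t) = 1.
Proof. by rewrite /modc /= cos2Dsin2 sqrtr1. Qed.

Lemma modc_norm (z : C) : `|z| = (modc z)%:C.
Proof. by rewrite normc_def /modc; case: z. Qed.

Lemma ReM z w : complex.Re (z * w) =
  complex.Re z * complex.Re w - complex.Im z * complex.Im w.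
Proof. by case: z w => [? ?] [? ?]. Qed.
Lemma ImM z w : complex.Im (z * w) =
  complex.Re z * complex.Im w + complex.Im z * complex.Re w.
Proof. by case: z w => [? ?] [? ?]. Qed.
Lemma ReD z w : complex.Re (z + w) = complex.Re z + complex.Re w.
Proof. by case: z w => [? ?] [? ?]. Qed.
Lemma ImD z w : complex.Im (z + w) = complex.Im z + complex.Im w.
Proof. by case: z w => [? ?] [? ?]. Qed.
Lemma ReN z : complex.Re (- z) = - complex.Re z.
Proof. by case: z. Qed.
Lemma ImN z : complex.Im (- z) = - complex.Im z.
Proof. by case: z. Qed.

Lemma pos_complexE (e : R[i]) : 0 < e -> exists2 d : R, 0 < d & e = d%:C.
Proof.
case: e => a b; rewrite ltcE /= => /andP[/eqP -> a0].
by exists a.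
Qed.

Section Filter.
Context {T : Type} (F : set_system T) {FF : Filter F}.

(** The norm of [R[i]] takes its values in [R[i]]; this trades it for the real-valued modulus, in
    which all later estimates are made. *)
Lemma cvgC_modc (f : T -> C) (l : C) :
  f @ F --> l <-> forall e : R, 0 < e -> \forall t \near F, modc (l - f t) < e.
Proof.
split.
  move=> /cvgrPdist_lt h e e0; have e0' : 0 < e%:C :> R[i] by rewrite ltcR.
  by have := h _ e0'; apply: filterS => t; rewrite modc_norm ltcR.
move=> h; apply/cvgrPdist_lt => e /pos_complexE[d d0 ->].
by have := h d d0; apply: filterS => t; rewrite modc_norm ltcR.
Qed.

Lemma cvg_Re (f : T -> C) (l : C) : f @ F --> l ->
  (fun t => complex.Re (f t)) @ F --> complex.Re l.
Proof.
move=> /cvgC_modc h; apply/cvgrPdist_lt => e /h; apply: filterS => t.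
by apply: le_lt_trans; rewrite -ReN -ReD; exact: modc_Re.
Qed.

Lemma cvg_Im (f : T -> C) (l : C) : f @ F --> l ->
  (fun t => complex.Im (f t)) @ F --> complex.Im l.
Proof.
move=> /cvgC_modc h; apply/cvgrPdist_lt => e /h; apply: filterS => t.
by apply: le_lt_trans; rewrite -ImN -ImD; exact: modc_Im.
Qed.

Lemma cvg_complex (u v : T -> R) (a b : R) : u @ F --> a -> v @ F --> b ->
  (fun t => (u t +i* v t : C)) @ F --> (a +i* b : C).
Proof.
move=> /cvgrPdist_lt hu /cvgrPdist_lt hv; apply/cvgC_modc => e e0.
have e2 : 0 < e / 2 by rewrite divr_gt0.
near=> t.
apply: le_lt_trans (modc_le _) _ => /=.
have : `|a - u t| < e / 2 by near: t; exact: hu.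
have : `|b - v t| < e / 2 by near: t; exact: hv.
lra.
Unshelve. all: by end_near. Qed.

End Filter.

Section Topo.
Context {T : topologicalType}.

Lemma continuous_Re (f : T -> C) (t : T) : {for t, continuous f} ->
  {for t, continuous (fun t => complex.Re (f t))}.
Proof. exact: cvg_Re. Qed.

Lemma continuous_Im (f : T -> C) (t : T) : {for t, continuous f} ->
  {for t, continuous (fun t => complex.Im (f t))}.
Proof. exact: cvg_Im. Qed.

Lemma continuous_complex (u v : T -> R) (t : T) :
  {for t, continuous u} -> {for t, continuous v} ->
  {for t, continuous (fun t => (u t +i* v t : C))}.
Proof. exact: cvg_complex. Qed.

Lemma continuous_modc (f : T -> C) (t : T) : {for t, continuous f} ->
  {for t, continuous (fun t => modc (f t))}.
Proof.
move=> /cvgC_modc h; apply/cvgrPdist_lt => e /h; apply: filterS => s.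
apply: le_lt_trans; rewrite ler_norml; apply/andP; split.
  have := modcD (f s - f t) (f t); rewrite subrK modc_distC; lra.
by have := modcD (f t - f s) (f s); rewrite subrK; lra.
Qed.

Lemma continuous_realC (u : T -> R) (t : T) :
  {for t, continuous u} -> {for t, continuous (fun t => ((u t)%:C : C))}.
Proof. by move=> cu; apply: continuous_complex => //; exact: cst_continuous. Qed.

Lemma continuous_conj (f : T -> C) (t : T) : {for t, continuous f} ->
  {for t, continuous (fun t => (conjc (f t) : C))}.
Proof.
move=> cf; rewrite (_ : (fun t => _) = fun t => (complex.Re (f t) +i* (- complex.Im (f t)) : C)); last first.
  by apply/funext => s; case: (f s).
apply: continuous_complex; first exact: continuous_Re.
by apply: continuousN; exact: continuous_Im.
Qed.

Lemma continuous_expi (u : T -> R) (t : T) :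
  {for t, continuous u} -> {for t, continuous (fun t => (expi (u t) : C))}.
Proof.
move=> cu; apply: continuous_complex.
- by apply: continuous_comp => //; exact: continuous_cos.
- by apply: continuous_comp => //; exact: continuous_sin.
Qed.

End Topo.

Lemma nbhsC_modc (z : C) (A : set C) :
  nbhs z A <-> exists2 d : R, 0 < d & forall w, modc (w - z) < d -> A w.
Proof.
split.
  move=> /nbhs_ballP[e /= /pos_complexE[d d0 ->]] h; exists d => // w wz.
  by apply: h; rewrite /ball /= modc_norm ltcR modc_distC.
move=> [d d0 h]; apply/nbhs_ballP; exists d%:C => /=; first by rewrite ltcR.
by move=> w; rewrite /ball /= modc_norm ltcR modc_distC; exact: h.
Qed.

(** First-order expansion in place of a difference quotient: [h = 0] is no exception, and remainders
    can be estimated directly under an integral sign. *)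
Definition cdiff (f : C -> C) (z d : C) := forall e : R, 0 < e -> 
  exists2 r : R, 0 < r & forall h : C, modc h < r -> 
    modc (f (z + h) - f z - d * h) <= e * modc h.

Lemma is_deriveC_cdiff (f : C -> C) (z d : C) :
  is_derive z (1 : C) f d <-> cdiff f z d.
Proof.
have key : ((fun h : C => h^-1 *: ((f \o shift z) (h *: (1 : C)) - f z)) @ 0^' --> d)
    <-> cdiff f z d.
  split.
    move=> /cvgC_modc hd e e0; have /nbhsC_modc[r r0 hr] := hd e e0.
    exists r => // h hr0; have [->|h0] := eqVneq h 0.
      by rewrite addr0 subrr mulr0 subr0 modc0 mulr0.
    have := hr h; rewrite subr0 => /(_ hr0 h0) /=.
    rewrite /shift /= [h *: 1]mulr1 (addrC h z) -[h^-1 *: _]/(h^-1 * _) => lte.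
    have -> : f (z + h) - f z - d * h = - ((d - h^-1 * (f (z + h) - f z)) * h).
      by rewrite mulrBl mulrAC mulVf// mul1r opprB.
    by rewrite modcN modcM ler_wpM2r ?modc_ge0// ltW.
  move=> hd; apply/cvgC_modc => e e0; have e2 : 0 < e / 2 by rewrite divr_gt0.
  have [r r0 hr] := hd _ e2; apply/nbhsC_modc; exists r => // h.
  rewrite subr0 => hr0 h0 /=; have := hr h hr0.
  rewrite /shift /= [h *: 1]mulr1 (addrC z h) -[h^-1 *: _]/(h^-1 * _) => lte.
  have -> : d - h^-1 * (f (h + z) - f z) = - ((f (h + z) - f z - d * h) / h).
    by rewrite mulrBl mulfK// opprB mulrC.
  have mh : 0 < modc h by exact: modc_gt0.
  rewrite modcN modcM modcV ltr_pdivrMr// (le_lt_trans lte)// ltr_pM2r//; lra.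
rewrite -key; split.
  by move=> [df <-].
by move=> dfd; split; [apply/cvg_ex; exists d|apply/cvg_lim].
Qed.

Lemma derivableC_cdiff (f : C -> C) (z : C) : derivable f z (1 : C) ->
  cdiff f z (cderiv f z).
Proof.
move=> df; apply/is_deriveC_cdiff; rewrite /cderiv derive1E; exact: derivableP.
Qed.

Lemma cdiff_derivable (f : C -> C) (z d : C) : cdiff f z d ->
  derivable f z (1 : C) /\ cderiv f z = d.
Proof.
move=> /is_deriveC_cdiff df; split; first by case: df.
by rewrite /cderiv derive1E derive_val.
Qed.

Lemma cdiff_continuous (f : C -> C) (z d : C) : cdiff f z d -> {for z, continuous f}.
Proof.
move=> /is_deriveC_cdiff df; apply: differentiable_continuous.
by apply/derivable1_diffP; case: df.
Qed.

Lemma cdiff_unique (f : C -> C) (z d e : C) : cdiff f z d -> cdiff f z e -> d = e.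
Proof. by move=> /cdiff_derivable[_ <-] /cdiff_derivable[_ <-]. Qed.

Lemma cdiff_cst (a z : C) : cdiff (fun=> a) z 0.
Proof. by apply/is_deriveC_cdiff; exact: is_derive_cst. Qed.

Lemma cdiff_id (z : C) : cdiff id z 1.
Proof. by apply/is_deriveC_cdiff; exact: is_derive_id. Qed.

Lemma cdiffD (f g : C -> C) (z d e : C) : cdiff f z d -> cdiff g z e ->
  cdiff (fun w => f w + g w) z (d + e).
Proof.
move=> /is_deriveC_cdiff hf /is_deriveC_cdiff hg; apply/is_deriveC_cdiff.
Qed.

Lemma cdiffM (f g : C -> C) (z d e : C) : cdiff f z d -> cdiff g z e ->
  cdiff (fun w => f w * g w) z (f z * e + g z * d).
Proof.
move=> /is_deriveC_cdiff hf /is_deriveC_cdiff hg; apply/is_deriveC_cdiff.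
Qed.

Lemma cdiffZ (f : C -> C) (a z d : C) : cdiff f z d ->
  cdiff (fun w => a * f w) z (a * d).
Proof.
by move=> hf; have := cdiffM (cdiff_cst a z) hf; rewrite mulr0 addr0.
Qed.

Lemma cdiffV (f : C -> C) (z d : C) : f z != 0 -> cdiff f z d ->
  cdiff (fun w => (f w)^-1) z (- (f z) ^- 2 * d).
Proof.
move=> fz /is_deriveC_cdiff hf; apply/is_deriveC_cdiff.
split; first by apply: derivableV => //; case: hf.
by rewrite (deriveV (x := z) (v := 1)) //; case: hf => // _ ->.
Qed.

Lemma cdiffX (f : C -> C) (n : nat) (z d : C) : cdiff f z d ->
  exists e, cdiff (fun w => f w ^+ n) z e.
Proof.
move=> hf; elim: n => [|n [e he]]; first by exists 0; exact: cdiff_cst.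
exists (f z * e + (f z ^+ n) * d).
rewrite (_ : (fun w => _) = (fun w => f w * f w ^+ n)); last first.
  by apply/funext => w; rewrite exprS.
exact: cdiffM.
Qed.

Lemma cdiff_near (f g : C -> C) (z d : C) (r : R) : 0 < r ->
  (forall h, modc h < r -> f (z + h) = g (z + h)) -> cdiff f z d -> cdiff g z d.
Proof.
move=> r0 fg hf e e0; have [s s0 hs] := hf e e0.
exists (Num.min r s) => [|h]; first by rewrite lt_min r0.
rewrite lt_min => /andP[hr hs']; rewrite -fg// -[in g z](addr0 z) -(fg 0) ?modc0// addr0.
exact: hs.
Qed.

(** Derivative of a curve by components, so that the real fundamental theorem applies to each of
    them; [cder_eps] gives the equivalent complex expansion used for the chain rule. *)
Definition cder (gam : R -> R[i]) (t : R) (d : R[i]) :=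
  is_derive t (1 : R) (fun s => complex.Re (gam s)) (complex.Re d) /\
  is_derive t (1 : R) (fun s => complex.Im (gam s)) (complex.Im d).

Lemma is_derive_eps (F : R -> R) (t d : R) :
  (forall e : R, 0 < e -> exists2 r : R, 0 < r & forall h : R, `|h| < r ->
    `|F (t + h) - F t - d * h| <= e * `|h|) <-> is_derive t (1 : R) F d.
Proof.
have key : ((fun h : R => h^-1 *: ((F \o shift t) (h *: (1 : R)) - F t)) @ 0^' --> d)
    <-> (forall e : R, 0 < e -> exists2 r : R, 0 < r & forall h : R, `|h| < r ->
    `|F (t + h) - F t - d * h| <= e * `|h|).
  split.
    move=> /cvgrPdist_lt hd e e0; have /nbhs_ballP[r /= r0 hr] := hd e e0.
    exists r => // h hr0; have [->|h0] := eqVneq h 0.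
      by rewrite addr0 subrr mulr0 subr0 normr0 mulr0.
    have := hr h; rewrite /ball /= sub0r normrN => /(_ hr0 h0) /=.
    rewrite /shift /= [h *: 1]mulr1 (addrC h t) -[h^-1 *: _]/(h^-1 * _) => lte.
    have -> : F (t + h) - F t - d * h = - ((d - h^-1 * (F (t + h) - F t)) * h).
      by rewrite mulrBl mulrAC mulVf// mul1r opprB.
    by rewrite normrN normrM ler_wpM2r// ltW.
  move=> hd; apply/cvgrPdist_lt => e e0; have e2 : 0 < e / 2 by rewrite divr_gt0.
  have [r r0 hr] := hd _ e2; apply/nbhs_ballP; exists r => // h.
  rewrite /ball /= sub0r normrN => hr0 h0 /=; have := hr h hr0.
  rewrite /shift /= [h *: 1]mulr1 (addrC t h) -[h^-1 *: _]/(h^-1 * _) => lte.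
  have -> : d - h^-1 * (F (h + t) - F t) = - ((F (h + t) - F t - d * h) / h).
    by rewrite mulrBl mulfK// opprB mulrC.
  have mh : 0 < `|h| by rewrite normr_gt0.
  rewrite normrN normrM normfV ltr_pdivrMr// (le_lt_trans lte)// ltr_pM2r//; lra.
rewrite -key; split; last by move=> [df <-].
by move=> dfd; split; [apply/cvg_ex; exists d|apply/cvg_lim].
Qed.

Lemma cder_eps (gam : R -> R[i]) (t : R) (d : R[i]) : cder gam t d <->
  (forall e : R, 0 < e -> exists2 r : R, 0 < r & forall h : R, `|h| < r ->
    modc (gam (t + h) - gam t - d * h%:C) <= e * `|h|).
Proof.
split.
  move=> [/is_derive_eps hr /is_derive_eps hi] e e0.
  have e2 : 0 < e / 2 by rewrite divr_gt0.
  have [r r0 {}hr] := hr _ e2; have [s s0 {}hi] := hi _ e2.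
  exists (Num.min r s) => [|h]; first by rewrite lt_min r0.
  rewrite lt_min => /andP[/hr h1 /hi h2].
  rewrite (le_trans (modc_le _))// !(ReD, ReN, ImD, ImN, ReM, ImM)/= !mulr0 subr0 add0r.
  by rewrite [e]splitr mulrDl lerD.
move=> h; split; apply/is_derive_eps => e /h[r r0 hr]; exists r => // k /hr;
  apply: le_trans.
  have := modc_Re (gam (t + k) - gam t - d * k%:C).
  by rewrite !(ReD, ReN, ReM)/= mulr0 subr0.
have := modc_Im (gam (t + k) - gam t - d * k%:C).
by rewrite !(ImD, ImN, ImM)/= mulr0 add0r.
Qed.

Lemma cder_chain (f : C -> C) (gam : R -> R[i]) (t : R) (D d : R[i]) :
  cdiff f (gam t) D -> cder gam t d -> cder (fun s => f (gam s)) t (D * d).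
Proof.
move=> hf /cder_eps hg; apply/cder_eps => e e0.
(* The added 1 keeps the denominators positive. The increment of [gam] is eventually at most
   [M * |h|], and each of the two remainders receives half of [e]. *)
pose M := modc d + 1; have M0 : 0 < M by rewrite /M; have := modc_ge0 d; lra.
pose N := modc D + 1; have N0 : 0 < N by rewrite /N; have := modc_ge0 D; lra.
have [r r0 hr] := hf (e / 2 / M) ltac:(by rewrite !divr_gt0).
have [s s0 hs] := hg 1 ltr01.
have [u u0 hu] := hg (e / 2 / N) ltac:(by rewrite !divr_gt0).
exists (Num.min (Num.min s u) (r / M)) => [|h]; first by rewrite !lt_min s0 u0 divr_gt0.
rewrite !lt_min => /andP[/andP[/hs h1 /hu h2]]; rewrite ltr_pdivlMr// => h3.
set k := gam (t + h) - gam t in h1 h2 *.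
have hk : modc k <= M * `|h|.
  have := modcD (k - d * h%:C) (d * h%:C); rewrite subrK modcM modc_real => h4.
  by rewrite (le_trans h4)// /M mulrDl mul1r addrC lerD2l -[leRHS]mul1r.
have hMr : M * `|h| < r by rewrite mulrC.
have {}hr := hr k (le_lt_trans hk hMr).
have -> : gam (t + h) = gam t + k by rewrite /k subrKC.
have -> : f (gam t + k) - f (gam t) - D * d * h%:C = 
  (f (gam t + k) - f (gam t) - D * k) + D * (k - d * h%:C) by ring.
rewrite (le_trans (modcD _ _))// [e]splitr mulrDl lerD//.
  rewrite (le_trans hr)// mulrAC ler_pdivrMr// -[leRHS]mulrA.
  by rewrite ler_pM2l ?divr_gt0// mulrC.
rewrite modcM (le_trans (ler_wpM2l (modc_ge0 D) h2))//.
rewrite mulrA ler_wpM2r// mulrA ler_pdivrMr// mulrC ler_wpM2l//; [lra|rewrite /N; lra].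
Qed.

Lemma cder_real (u : R -> R) (t d : R) : is_derive t (1 : R) u d ->
  cder (fun s => (u s)%:C) t d%:C.
Proof. by move=> du; split => //=; exact: is_derive_cst. Qed.

Lemma cder_cst (a : R[i]) t : cder (fun=> a) t 0.
Proof. by split => /=; exact: is_derive_cst. Qed.

Lemma cderD (f g : R -> R[i]) t d e : cder f t d -> cder g t e ->
  cder (fun s => f s + g s) t (d + e).
Proof.
move=> [f1 f2] [g1 g2]; split.
  rewrite ReD (_ : (fun s => _) = fun s => complex.Re (f s) + complex.Re (g s)).
    exact: is_deriveD.
  by apply/funext => s; rewrite ReD.
rewrite ImD (_ : (fun s => _) = fun s => complex.Im (f s) + complex.Im (g s)).
  exact: is_deriveD.
by apply/funext => s; rewrite ImD.
Qed.

Lemma cderM (f g : R -> R[i]) t d e : cder f t d -> cder g t e ->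
  cder (fun s => f s * g s) t (f t * e + d * g t).
Proof.
move=> [f1 f2] [g1 g2]; split.
  rewrite (_ : (fun s => _) = fun s => complex.Re (f s) * complex.Re (g s)
     - complex.Im (f s) * complex.Im (g s)); last first.
    by apply/funext => s; rewrite ReM.
  apply: is_derive_eq; rewrite !(ReD, ReM) /GRing.scale/=; ring.
rewrite (_ : (fun s => _) = fun s => complex.Re (f s) * complex.Im (g s)
     + complex.Im (f s) * complex.Re (g s)); last first.
  by apply/funext => s; rewrite ImM.
apply: is_derive_eq; rewrite !(ImD, ImM) /GRing.scale/=; ring.
Qed.

Lemma cderZ (f : R -> R[i]) (a : R[i]) t d : cder f t d ->
  cder (fun s => a * f s) t (a * d).
Proof. by move=> hf; have := cderM (cder_cst a t) hf; rewrite mul0r addr0. Qed.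

Lemma cder_conj (f : R -> R[i]) t d : cder f t d -> cder (fun s => conjc (f s)) t (conjc d).
Proof.
move=> [f1 f2]; split.
  rewrite (_ : (fun s => _) = fun s => complex.Re (f s)).
    by case: d f1 f2.
  by apply/funext => s; case: (f s).
rewrite (_ : (fun s => _) = fun s => - complex.Im (f s)).
  by case: d f1 f2 => ? ? ? ?; exact: is_deriveN.
by apply/funext => s; case: (f s).
Qed.

Lemma cder_expi (t : R) : cder (@expi R) t ('i * expi t).
Proof.
by split; rewrite !(ReM, ImM)/= mul0r mul1r ?mul0r ?sub0r ?add0r; apply: is_derive_eq.
Qed.

Lemma cder_id t : cder (fun s => s%:C) t 1.
Proof. by apply: (cder_real (d := 1)); exact: is_derive_id. Qed.

End ComplexBasics.

Section AffineChange.
Context {R : realType}.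
Implicit Types (a b c d : R) (g phi : R -> R).

Lemma cts_comp a b c d g phi : a <= b -> continuous phi ->
  (forall t, a <= t <= b -> c <= phi t <= d) -> cts c d g -> cts a b (g \o phi).
Proof.
move=> ab cphi pcd cg; rewrite /cts (_ : _ \o _ = (g \o clamp c d) \o (phi \o clamp a b)).
  move=> t; apply: continuous_comp; last exact: cg.
  by apply: continuous_comp; [exact: clamp_continuous|exact: cphi].
by apply/funext => t /=; rewrite [in RHS]clamp_id//; apply: pcd; exact: clamp_in.
Qed.

Lemma RI_affine a b g : a <= b -> cts a b g ->
  RI a b g = (b - a) * RI 0 1 (fun t => g (a + t * (b - a))).
Proof.
move=> ab cg; have := @RI_subst _ 0 1 (fun t => a + t * (b - a)) (fun=> b - a) g ler01.
have e : a + 1 * (b - a) = b by ring.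
have pcd t : 0 <= t <= 1 -> a <= a + t * (b - a) <= b.
  move=> /andP[t0 t1]; rewrite lerDl mulr_ge0 ?subr_ge0//=.
  by rewrite -[leRHS](subrKC a) lerD2l -[leRHS]mul1r ler_wpM2r ?subr_ge0.
have cphi : continuous (fun t : R => a + t * (b - a)).
  by move=> t; apply: cvgD; [exact: cvg_cst|apply: cvgM; [exact: cvg_id|exact: cvg_cst]].
rewrite mul0r addr0 e => sub; etransitivity; first apply: sub => //.
- move=> t _; apply: is_derive_eq; rewrite /GRing.scale/=; ring.
- exact: cts_cst.
- rewrite -RIZ; last exact: (cts_comp ler01 cphi pcd cg).
  by apply: RI_eq => t _; rewrite mulrC.
Qed.

End AffineChange.

(** * Cauchy's theorem *)

Section ComplexIntegral.
Context {R : realType}.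
Notation C := ((R[i])^o).
Implicit Types (a b c d : R) (f g : R -> R[i]).

Definition CI a b f : R[i] :=
  RI a b (fun t => complex.Re (f t)) +i* RI a b (fun t => complex.Im (f t)).

Definition ccts a b f :=
  cts a b (fun t => complex.Re (f t)) /\ cts a b (fun t => complex.Im (f t)).

Definition ccts2 a b c d (G : R * R -> R[i]) :=
  cts2 a b c d (fun t => complex.Re (G t)) /\ cts2 a b c d (fun t => complex.Im (G t)).

Lemma ccts_pt a b (f : R -> C) : a <= b ->
  (forall x, a <= x <= b -> {for x, continuous f}) -> ccts a b f.
Proof.
move=> ab cf; split; apply: cts_pt => // x xab.
  by apply: continuous_Re; exact: cf.
by apply: continuous_Im; exact: cf.
Qed.

Lemma ccts2_pt a b c d (G : R * R -> C) : a <= b -> c <= d ->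
  (forall x y, a <= x <= b -> c <= y <= d -> {for (x, y), continuous G}) ->
  ccts2 a b c d G.
Proof.
move=> ab cd cG; split; apply: cts2_pt => // x y xab ycd.
  by apply: continuous_Re; exact: cG.
by apply: continuous_Im; exact: cG.
Qed.

Lemma complex_ext (z w : R[i]) : complex.Re z = complex.Re w ->
  complex.Im z = complex.Im w -> z = w.
Proof. by case: z w => [? ?] [? ?] /= -> ->. Qed.

Lemma CI_eq a b f g : (forall x, a <= x <= b -> f x = g x) -> CI a b f = CI a b g.
Proof. by move=> fg; congr Complex; apply: RI_eq => x /fg ->. Qed.

Lemma CI_FTC a b (F f : R -> R[i]) : a <= b -> ccts a b f ->
  (forall x, a <= x <= b -> cder F x (f x)) -> CI a b f = F b - F a.
Proof.
move=> ab [cr ci] dF; apply: complex_ext; rewrite /= (ReD, ImD) (ReN, ImN).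
  by apply: (@RI_FTC _ _ _ (fun t => complex.Re (F t))) => // x /dF[].
by apply: (@RI_FTC _ _ _ (fun t => complex.Im (F t))) => // x /dF[].
Qed.

Lemma cctsD a b f g : ccts a b f -> ccts a b g -> ccts a b (fun x => f x + g x).
Proof.
move=> [f1 f2] [g1 g2]; split.
  rewrite (_ : (fun t => _) = fun t => complex.Re (f t) + complex.Re (g t)).
    exact: ctsD.
  by apply/funext => t; rewrite ReD.
rewrite (_ : (fun t => _) = fun t => complex.Im (f t) + complex.Im (g t)).
  exact: ctsD.
by apply/funext => t; rewrite ImD.
Qed.

Lemma cctsM a b f g : ccts a b f -> ccts a b g -> ccts a b (fun x => f x * g x).
Proof.
move=> [f1 f2] [g1 g2]; split.
  rewrite (_ : (fun t => _) = fun t => complex.Re (f t) * complex.Re (g t) - complex.Im (f t) * complex.Im (g t)).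
    by apply: ctsB; exact: ctsM.
  by apply/funext => t; rewrite ReM.
rewrite (_ : (fun t => _) = fun t => complex.Re (f t) * complex.Im (g t) + complex.Im (f t) * complex.Re (g t)).
  by apply: ctsD; exact: ctsM.
by apply/funext => t; rewrite ImM.
Qed.

Lemma ccts_cst a b (l : R[i]) : ccts a b (fun=> l).
Proof. by split; exact: cts_cst. Qed.

Lemma CID a b f g : ccts a b f -> ccts a b g ->
  CI a b (fun x => f x + g x) = CI a b f + CI a b g.
Proof.
move=> [f1 f2] [g1 g2]; apply: complex_ext; rewrite /= -RID//.
  by apply: RI_eq => x _; rewrite ReD.
by apply: RI_eq => x _; rewrite ImD.
Qed.

Lemma CIZ a b f (l : R[i]) : ccts a b f ->
  CI a b (fun x => l * f x) = l * CI a b f.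
Proof.
move=> [f1 f2]; apply: complex_ext; rewrite /= ?(ReM, ImM) /= -!RIZ//.
  rewrite -RIB; [|by apply: ctsM => //; exact: cts_cst..].
  by apply: RI_eq => x _; rewrite ReM.
rewrite -RID; [|by apply: ctsM => //; exact: cts_cst..].
by apply: RI_eq => x _; rewrite ImM.
Qed.

Lemma CIB a b f g : ccts a b f -> ccts a b g ->
  CI a b (fun x => f x - g x) = CI a b f - CI a b g.
Proof.
move=> cf cg; rewrite -mulN1r -CIZ// -CID//; last by apply: cctsM => //; exact: ccts_cst.
by apply: CI_eq => x _; rewrite mulN1r.
Qed.

Lemma CI_cst a b (l : R[i]) : a <= b -> CI a b (fun=> l) = l * (b - a)%:C.
Proof.
by move=> ab; apply: complex_ext; rewrite /= ?ReM ?ImM /= RI_cst// mulr0 ?subr0 ?add0r// .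
Qed.

(** The factor 2 comes from estimating the real and imaginary parts separately; it propagates to the
    constants of the later estimates. *)
Lemma CI_bound a b f M : a <= b -> ccts a b f ->
  (forall x, a <= x <= b -> modc (f x) <= M) -> modc (CI a b f) <= 2 * M * (b - a).
Proof.
move=> ab [f1 f2] fM; rewrite (le_trans (modc_le _))//= -mulrA mulr_natl mulr2n lerD//.
  by apply: RI_normr => // x /fM; apply: le_trans; exact: modc_Re.
by apply: RI_normr => // x /fM; apply: le_trans; exact: modc_Im.
Qed.

Lemma CI_swap a b c d (G : R * R -> R[i]) : a <= b -> c <= d -> ccts2 a b c d G ->
  CI a b (fun x => CI c d (fun y => G (x, y))) =
  CI c d (fun y => CI a b (fun x => G (x, y))).
Proof.
move=> ab cd [G1 G2]; rewrite /CI; apply: (f_equal2 (@Complex R)).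
  exact: (RI_swap ab cd G1).
exact: (RI_swap ab cd G2).
Qed.

(** By the fundamental theorem in [x] and Fubini, the increment is the integral over [x] of the
    means of [G], which vanish. This plays the role of contour deformation in both halves of
    Cauchy's formula. *)
Lemma homotopy_mean a b c d (A G : R * R -> R[i]) : a <= b -> c <= d ->
  ccts2 a b c d G ->
  (forall x y, a <= x <= b -> c <= y <= d -> cder (fun s => A (s, y)) x (G (x, y))) ->
  (forall x, a <= x <= b -> CI c d (fun y => G (x, y)) = 0) ->
  ccts c d (fun y => A (a, y)) -> ccts c d (fun y => A (b, y)) ->
  CI c d (fun y => A (b, y)) = CI c d (fun y => A (a, y)).
Proof.
move=> ab cd [G1 G2] dA G0 ca cb; apply/eqP; rewrite -subr_eq0 -CIB//; apply/eqP.
transitivity (CI c d (fun y => CI a b (fun x => G (x, y)))).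
  apply: CI_eq => y ycd; rewrite (@CI_FTC a b (fun x => A (x, y)))//.
    by split; [exact: cts2_sec1 G1 _|exact: cts2_sec1 G2 _].
  by move=> x xab; exact: dA.
rewrite -CI_swap// (CI_eq G0) CI_cst// mul0r//.
Qed.

End ComplexIntegral.

(** * Segment and triangle integrals, and bisection of triangles *)

Section Goursat.
Context {R : realType}.
Notation C := ((R[i])^o).
Implicit Types (f g F : C -> C) (a b c z w : R[i]).

Definition seg_int f a b : R[i] :=
  (b - a) * CI 0 1 (fun t => f (a + t%:C * (b - a))).

Lemma convex_modc (z0 a b : R[i]) (r t : R) : 0 <= t <= 1 ->
  modc (a - z0) <= r -> modc (b - z0) <= r -> modc (a + t%:C * (b - a) - z0) <= r.
Proof.
move=> /andP[t0 t1] ar br.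
have -> : a + t%:C * (b - a) - z0 = (1 - t)%:C * (a - z0) + t%:C * (b - z0).
  by rewrite rmorphB rmorph1; ring.
rewrite (le_trans (modcD _ _))// !modcM !modc_real !ger0_norm ?subr_ge0//.
have -> : r = (1 - t) * r + t * r by ring.
by apply: lerD; apply: ler_wpM2l => //; lra.
Qed.

Definition disc_cont f := forall z, modc z < 1 -> {for (z : C), continuous f}.

Lemma seg_continuous (a b : C) (t : R) :
  {for t, continuous (fun t : R => (a + t%:C * (b - a) : C))}.
Proof.
apply: cvgD; first exact: cvg_cst.
apply: cvgM; last exact: cvg_cst.
by apply: continuous_realC.
Qed.

Lemma modc_lt_convex a b t : modc a < 1 -> modc b < 1 -> 0 <= t <= 1 ->
  modc (a + t%:C * (b - a)) < 1.
Proof.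
move=> a1 b1 t01; rewrite -[_ + _]subr0.
apply: (@le_lt_trans _ _ (Num.max (modc a) (modc b))); last by rewrite gt_max a1.
by apply: convex_modc; rewrite // subr0 le_max lexx ?orbT.
Qed.

Lemma seg_ccts f a b : disc_cont f -> modc a < 1 -> modc b < 1 ->
  ccts 0 1 (fun t => f (a + t%:C * (b - a))).
Proof.
move=> cf a1 b1; apply: ccts_pt => // t t01.
apply: (@continuous_comp _ _ _ (fun t : R => (a + t%:C * (b - a) : C)) f).
  exact: seg_continuous.
by apply: cf; exact: modc_lt_convex.
Qed.

Lemma seg_intB f g a b : disc_cont f -> disc_cont g -> modc a < 1 -> modc b < 1 ->
  seg_int (fun z => f z - g z) a b = seg_int f a b - seg_int g a b.
Proof.
by move=> cf cg a1 b1; rewrite /seg_int CIB ?mulrBr//; exact: seg_ccts.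
Qed.

Lemma seg_int_bound f a b M : disc_cont f -> modc a < 1 -> modc b < 1 ->
  (forall t : R, 0 <= t <= 1 -> modc (f (a + t%:C * (b - a))) <= M) ->
  modc (seg_int f a b) <= 2 * M * modc (b - a).
Proof.
move=> cf a1 b1 fM; rewrite modcM mulrC ler_wpM2r ?modc_ge0//.
by have := CI_bound ler01 (seg_ccts cf a1 b1) fM; rewrite subr0 mulr1.
Qed.

Lemma seg_int_rev f a b : disc_cont f -> modc a < 1 -> modc b < 1 ->
  seg_int f b a = - seg_int f a b.
Proof.
move=> cf a1 b1; rewrite /seg_int -mulNr opprB; congr (_ * _).
have [c1 c2] := seg_ccts cf a1 b1.
have sub (g : R -> R) : cts 0 1 g -> RI 0 1 g = RI 0 1 (fun t : R => g (1 - t)).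
  move=> cg; have := @RI_substN _ 0 1 (fun t => 1 - t) (fun=> -1) g ler01.
  rewrite subrr subr0 => sub; etransitivity; first apply: sub => //.
  - by move=> x _; apply: is_derive_eq; ring.
  - exact: cts_cst.
  - by move=> x; lra.
  - rewrite -[LHS]mulN1r -RIZ.
      by apply: RI_eq => x _; ring.
    apply: ctsM; last exact: cts_cst.
    apply: (@cts_comp _ 0 1 0 1) => //.
      by move=> t; apply: cvgB; [exact: cvg_cst|exact: cvg_id].
    by move=> t; lra.
congr Complex; [rewrite [RHS](sub _ c1)|rewrite [RHS](sub _ c2)]; apply: RI_eq => t _;
  by congr (_ (f _)); rewrite rmorphB rmorph1; ring.
Qed.

Lemma seg_int_mid f a b : disc_cont f -> modc a < 1 -> modc b < 1 ->
  seg_int f a b = seg_int f a ((a + b) / 2) + seg_int f ((a + b) / 2) b.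
Proof.
move=> cf a1 b1; rewrite /seg_int.
have two : (2 : R[i]) != 0 by rewrite pnatr_eq0.
have -> : (a + b) / 2 - a = (b - a) * 2^-1 by field.
have -> : b - (a + b) / 2 = (b - a) * 2^-1 by field.
rewrite -!mulrA -mulrDr; congr (_ * _).
have hC : (2^-1 : R)%:C = 2^-1 :> R[i] by rewrite fmorphV rmorph_nat.
have [c1 c2] := seg_ccts cf a1 b1.
have h0 : (0 : R) <= 2^-1 by rewrite invr_ge0.
have h1 : (2^-1 : R) <= 1 by rewrite invf_le1 ?ler1n.
have sub (g : R -> R) : cts 0 1 g -> RI 0 1 g = 2^-1 * RI 0 1 (fun t : R => g (t * 2^-1)) +
     2^-1 * RI 0 1 (fun t : R => g (2^-1 + t * 2^-1)).
  move=> cg; rewrite (RI_split h0 h1 cg) [X in X + _]RI_affine//; last exact: ctsS cg.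
  rewrite [X in _ + X]RI_affine//; last exact: ctsS cg.
  have -> : 1 - 2^-1 = 2^-1 :> R by field.
  by rewrite subr0; congr (_ * _ + _); apply: RI_eq => t _; rewrite add0r.
apply: complex_ext; rewrite -!hC ?ReD ?ImD ?ReM ?ImM /= !mul0r ?subr0 ?addr0.
  rewrite (sub _ c1); congr (_ * _ + _ * _); apply: RI_eq => t _;
    congr (complex.Re (f _)); rewrite ?rmorphD rmorphM /= hC; by field.
rewrite (sub _ c2); congr (_ * _ + _ * _); apply: RI_eq => t _;
  congr (complex.Im (f _)); rewrite ?rmorphD rmorphM /= hC; by field.
Qed.

Definition tri_int f a b c := seg_int f a b + seg_int f b c + seg_int f c a.

(** The three edges joining midpoints are each traversed twice, in opposite directions, and cancel
    by [seg_int_rev]. *)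
Lemma tri_int_sub f a b c : disc_cont f -> modc a < 1 -> modc b < 1 -> modc c < 1 ->
  tri_int f a b c = tri_int f a ((a + b) / 2) ((c + a) / 2) +
    tri_int f ((a + b) / 2) b ((b + c) / 2) +
    tri_int f ((c + a) / 2) ((b + c) / 2) c +
    tri_int f ((a + b) / 2) ((b + c) / 2) ((c + a) / 2).
Proof.
move=> cf a1 b1 c1.
have mid z w : modc z < 1 -> modc w < 1 -> modc ((z + w) / 2) < 1.
  by move=> z1 w1; rewrite modcM modcV modc_nat; have := modcD z w; lra.
rewrite /tri_int (seg_int_mid cf a1 b1) (seg_int_mid cf b1 c1) (seg_int_mid cf c1 a1).
have ab1 := mid _ _ a1 b1; have bc1 := mid _ _ b1 c1; have ca1 := mid _ _ c1 a1.
rewrite (seg_int_rev cf ca1 ab1) (seg_int_rev cf ab1 bc1) (seg_int_rev cf bc1 ca1).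
ring.
Qed.

Lemma seg_int_FTC f F a b : disc_cont f -> (forall z, modc z < 1 -> cdiff F z (f z)) ->
  modc a < 1 -> modc b < 1 -> seg_int f a b = F b - F a.
Proof.
move=> cf dF a1 b1; rewrite /seg_int -CIZ; last exact: seg_ccts.
rewrite (@CI_FTC _ 0 1 (fun t : R => F (a + t%:C * (b - a))))//.
- by rewrite rmorph1 rmorph0 mul1r mul0r addr0 subrKC.
- by apply: cctsM; [exact: ccts_cst|exact: seg_ccts].
- move=> t t01; rewrite mulrC; apply: cder_chain; first by apply: dF; exact: modc_lt_convex.
  have := cderD (cder_cst a t) (cderM (cder_id t) (cder_cst (b - a) t)).
  by rewrite add0r mulr0 add0r mul1r.
Qed.

Lemma tri_int_bound f a b c M d : disc_cont f -> modc a < 1 -> modc b < 1 ->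
  modc c < 1 -> modc (b - a) <= d -> modc (c - b) <= d -> modc (a - c) <= d ->
  0 <= M ->
  (forall z w (t : R), [\/ z = a, z = b | z = c] -> [\/ w = a, w = b | w = c] ->
     0 <= t <= 1 -> modc (f (z + t%:C * (w - z))) <= M) ->
  modc (tri_int f a b c) <= 6 * M * d.
Proof.
move=> cf a1 b1 c1 ab bc ca M0 fM.
have one z w : [\/ z = a, z = b | z = c] -> [\/ w = a, w = b | w = c] ->
    modc z < 1 -> modc w < 1 -> modc (w - z) <= d -> modc (seg_int f z w) <= 2 * M * d.
  move=> hz hw z1 w1 wz.
  have hM t : 0 <= t <= 1 -> modc (f (z + t%:C * (w - z))) <= M by exact: fM.
  by rewrite (le_trans (seg_int_bound cf z1 w1 hM))// ler_wpM2l// mulr_ge0.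
have := one a b (Or31 _ _ erefl) (Or32 _ _ erefl) a1 b1 ab.
have := one b c (Or32 _ _ erefl) (Or33 _ _ erefl) b1 c1 bc.
have := one c a (Or33 _ _ erefl) (Or31 _ _ erefl) c1 a1 ca.
have := modcD (seg_int f a b + seg_int f b c) (seg_int f c a).
have := modcD (seg_int f a b) (seg_int f b c).
rewrite /tri_int; lra.
Qed.

Definition small_tri (r d : R) (x : R[i] * R[i] * R[i]) :=
  [/\ modc x.1.1 <= r, modc x.1.2 <= r & modc x.2 <= r] /\
  [/\ modc (x.1.2 - x.1.1) <= d, modc (x.2 - x.1.2) <= d & modc (x.1.1 - x.2) <= d].

Definition tri3 f (x : R[i] * R[i] * R[i]) := tri_int f x.1.1 x.1.2 x.2.

(** The bound on the displacement of the first vertex is what later gives the bisection a limit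
    point. *)
Lemma tri_bisect f r d x : disc_cont f -> r < 1 -> small_tri r d x ->
  exists y, [/\ small_tri r (d / 2) y, modc (y.1.1 - x.1.1) <= d &
     modc (tri3 f x) <= 4 * modc (tri3 f y)].
Proof.
move: x => [[a b] c] cf r1 [[/= ar br cr] [ab bc ca]].
have lt1 z : modc z <= r -> modc z < 1 by move=> h; exact: le_lt_trans r1.
have mid z w : modc z <= r -> modc w <= r -> modc ((z + w) / 2) <= r.
  by move=> zr wr; rewrite modcM modcV modc_nat; have := modcD z w; lra.
have half z w : modc z <= d -> w = z / 2 -> modc w <= d / 2.
  by move=> zd ->; rewrite modcM modcV modc_nat; lra.
have d0 : 0 <= d by rewrite (le_trans (modc_ge0 _) ab).
have dist z w : modc z <= d / 2 -> w = z -> modc w <= d by move=> zd ->; lra.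
have mab := mid _ _ ar br; have mbc := mid _ _ br cr; have mca := mid _ _ cr ar.
have := tri_int_sub cf (lt1 _ ar) (lt1 _ br) (lt1 _ cr).
set m1 := (a + b) / 2 in mab *; set m2 := (b + c) / 2 in mbc *.
set m3 := (c + a) / 2 in mca *; rewrite /tri3 /= => ->.
pose T1 := tri_int f a m1 m3; pose T2 := tri_int f m1 b m2.
pose T3 := tri_int f m3 m2 c; pose T4 := tri_int f m1 m2 m3.
have hsum : modc (T1 + T2 + T3 + T4) <= modc T1 + modc T2 + modc T3 + modc T4.
  have := modcD (T1 + T2 + T3) T4; have := modcD (T1 + T2) T3.
  have := modcD T1 T2; lra.
have e1 : modc (m1 - a) <= d / 2 by apply: (half (b - a)) => //; rewrite /m1; field.
have e2 : modc (b - m1) <= d / 2 by apply: (half (b - a)) => //; rewrite /m1; field.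
have e3 : modc (m2 - b) <= d / 2 by apply: (half (c - b)) => //; rewrite /m2; field.
have e4 : modc (c - m2) <= d / 2 by apply: (half (c - b)) => //; rewrite /m2; field.
have e5 : modc (m3 - c) <= d / 2 by apply: (half (a - c)) => //; rewrite /m3; field.
have e6 : modc (a - m3) <= d / 2 by apply: (half (a - c)) => //; rewrite /m3; field.
have e7 : modc (m3 - m1) <= d / 2.
  by apply: (half (c - b)) => //; rewrite /m3 /m1; field.
have e8 : modc (m2 - m1) <= d / 2.
  by rewrite modc_distC; apply: (half (a - c)) => //; rewrite /m2 /m1; field.
have e9 : modc (m2 - m3) <= d / 2.
  by apply: (half (b - a)) => //; rewrite /m2 /m3; field.
(* One of the four pieces carries at least a quarter of the integral: if the first three do not, the
   triangle inequality [hsum] leaves the last. *)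
have [h1|h1] := leP (modc (T1 + T2 + T3 + T4)) (4 * modc T1).
  exists (a, m1, m3); split => //=; by rewrite subrr modc0.
have [h2|h2] := leP (modc (T1 + T2 + T3 + T4)) (4 * modc T2).
  exists (m1, b, m2); split => //=; last by lra.
  by split; split => //=; rewrite modc_distC.
have [h3|h3] := leP (modc (T1 + T2 + T3 + T4)) (4 * modc T3).
  exists (m3, m2, c); split => //=; by rewrite modc_distC; lra.
exists (m1, m2, m3); split => //=; [|lra|rewrite -/T1 -/T2 -/T3 -/T4; lra].
by split; split => //=; rewrite modc_distC.
Qed.

End Goursat.

(** * Goursat's theorem and primitives in the disc *)

Section GoursatTheorem.
Context {R : realType}.
Notation C := ((R[i])^o).
Implicit Types (f g F : C -> C) (a b c z w : R[i]).

(** The intervals of centre [u n] and radius [e n = 2 * d / 2 ^+ n] are nested, because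
    [e n - e n.+1] dominates the step; the limit is the supremum of their left ends. *)
Lemma geometric_limit (u : nat -> R) (d : R) : 0 <= d ->
  (forall n, `|u n.+1 - u n| <= d / 2 ^+ n) ->
  exists l, forall n, `|u n - l| <= 2 * d / 2 ^+ n.
Proof.
move=> d0 hu; pose e n := 2 * d / 2 ^+ n.
have eS n : e n = 2 * e n.+1.
  by rewrite /e exprS invfM; field; rewrite expf_neq0.
have hu' n : `|u n.+1 - u n| <= e n.+1.
  by rewrite (le_trans (hu n))// /e exprS invfM mulrA [2 * d]mulrC mulfK// pnatr_eq0.
have mono n m : u n - e n <= u (n + m)%N - e (n + m)%N /\
    u (n + m)%N + e (n + m)%N <= u n + e n.
  elim: m => [|m [h1 h2]]; first by rewrite addn0.
  rewrite addnS; move: (hu' (n + m)%N) (eS (n + m)%N); rewrite ler_norml => /andP[h3 h4] h5.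
  split; lra.
have e0 n : 0 <= e n by rewrite /e mulr_ge0 ?invr_ge0 ?mulr_ge0 ?exprn_ge0.
have cross n m : u n - e n <= u m + e m.
  have [h1 _] := mono n m; have [_ h2] := mono m n; rewrite addnC in h2.
  have := e0 (n + m)%N; lra.
pose S := range (fun n => u n - e n).
have hS : has_sup S by split; [exists (u 0%N - e 0%N), 0%N|exists (u 0%N + e 0%N) => _ [n _ <-]].
exists (sup S) => n.
have h1 : u n - e n <= sup S by apply: ub_le_sup; [exact: hS.2|exists n].
have h2 : sup S <= u n + e n by apply: ge_sup; [exact: hS.1|move=> _ [m _ <-]].
by rewrite ler_distlC; apply/andP; split; rewrite /e in h1 h2; lra.
Qed.

Definition holo f := forall z, modc z < 1 -> exists d, cdiff f z d.

Lemma holo_cont f : holo f -> disc_cont f.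
Proof. by move=> hf z /hf[d]; exact: cdiff_continuous. Qed.

Lemma half_pow_small (D e : R) : 0 < e -> exists n : nat, D / 2 ^+ n < e.
Proof.
move=> e0; have [n hn] : exists n : nat, D / e < 2 ^+ n.
  exists (Num.bound `|D / e|); apply: (@lt_le_trans _ _ (Num.bound `|D / e|)%:R).
    by rewrite (le_lt_trans (ler_norm _))// archi_boundP.
  rewrite -natrX ler_nat ltnW// ltn_expl//.
exists n; rewrite ltr_pdivrMr ?exprn_gt0//.
by move: hn; rewrite ltr_pdivrMr// mulrC.
Qed.

Lemma tri_int_affine (al be : C) a b c : modc a < 1 -> modc b < 1 -> modc c < 1 ->
  tri_int (fun z => al + be * z) a b c = 0.
Proof.
move=> a1 b1 c1.
have df z : cdiff (fun z => al * z + be / 2 * (z * z)) z (al + be * z).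
  have h := cdiffD (cdiffZ al (cdiff_id z)) (cdiffZ (be / 2) (cdiffM (cdiff_id z) (cdiff_id z))).
  have e : al * 1 + be / 2 * (z * 1 + z * 1) = al + be * z by field.
  by rewrite -e.
have cf : disc_cont (fun z => al + be * z).
  move=> z _; apply: (@cdiff_continuous _ _ _ (0 + be * 1)).
  by apply: cdiffD; [exact: cdiff_cst|apply: cdiffZ; exact: cdiff_id].
rewrite /tri_int !(seg_int_FTC cf (fun z _ => df z))//; ring.
Qed.

(** Bisection produces triangles of size [dn = d / 2 ^+ n] near a point [z0] that carry at least
    [4 ^- n] of the integral. Differentiability at [z0] replaces [f] by an affine function, whose
    triangle integrals vanish, up to an error of order [dn]; the integral of the error has order
    [dn ^+ 2], which the factor [4 ^+ n] exactly compensates. *)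
Lemma goursat f a b c : holo f -> modc a < 1 -> modc b < 1 -> modc c < 1 ->
  tri_int f a b c = 0.
Proof.
move=> hf a1 b1 c1; have cf := holo_cont hf.
pose r := Num.max (modc a) (Num.max (modc b) (modc c)).
have r1 : r < 1 by rewrite !gt_max a1 b1.
pose d := Num.max (modc (b - a)) (Num.max (modc (c - b)) (modc (a - c))).
have d0 : 0 <= d by rewrite /d le_max modc_ge0.
have x0P : small_tri r d (a, b, c).
  by split; split; rewrite /= /r /d !le_max lexx ?orbT.
(* Bisection becomes a total function of the size and the triangle, so that the sequence [x] can be
   defined by plain recursion. *)
have [nxt nxtP] : exists nxt : R -> R[i] * R[i] * R[i] -> R[i] * R[i] * R[i],
   forall e x, small_tri r e x ->
   [/\ small_tri r (e / 2) (nxt e x), modc ((nxt e x).1.1 - x.1.1) <= e &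
     modc (tri3 f x) <= 4 * modc (tri3 f (nxt e x))].
  have /choice[h hP] : forall ex : R * (R[i] * R[i] * R[i]), exists y,
      small_tri r ex.1 ex.2 ->
   [/\ small_tri r (ex.1 / 2) y, modc (y.1.1 - ex.2.1.1) <= ex.1 &
     modc (tri3 f ex.2) <= 4 * modc (tri3 f y)].
    move=> [e x]; have [hx|nx] := pselect (small_tri r e x).
      by have [y hy] := tri_bisect cf r1 hx; exists y.
    by exists x.
  by exists (fun e x => h (e, x)) => e x hx; exact: (hP (e, x) hx).
pose fix x n := if n is m.+1 then nxt (d / 2 ^+ m) (x m) else (a, b, c).
have xP n : small_tri r (d / 2 ^+ n) (x n).
  elim: n => [|n ih]; first by rewrite expr0 divr1.
  by have [] := nxtP _ _ ih; rewrite /= exprSr invfM mulrA.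
have xd n : modc ((x n.+1).1.1 - (x n).1.1) <= d / 2 ^+ n by have [] := nxtP _ _ (xP n).
have xT n : modc (tri3 f (a, b, c)) <= 4 ^+ n * modc (tri3 f (x n)).
  elim: n => [|n ih]; first by rewrite expr0 mul1r.
  rewrite (le_trans ih)// exprSr -mulrA ler_wpM2l// ?exprn_ge0//.
  by have [] := nxtP _ _ (xP n).
have [lr hlr] : exists l, forall n, `|complex.Re (x n).1.1 - l| <= 2 * d / 2 ^+ n.
  by apply: geometric_limit => // n; rewrite -ReN -ReD (le_trans (modc_Re _)).
have [li hli] : exists l, forall n, `|complex.Im (x n).1.1 - l| <= 2 * d / 2 ^+ n.
  by apply: geometric_limit => // n; rewrite -ImN -ImD (le_trans (modc_Im _)).
pose z0 : R[i] := lr +i* li.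
have xz0 n : modc ((x n).1.1 - z0) <= 4 * d / 2 ^+ n.
  rewrite (le_trans (modc_le _))// ReD ReN ImD ImN /=.
  have := hlr n; have := hli n; rewrite !mulrDl -!mulrA; lra.
have z01 : modc z0 < 1.
  have [n hn] := @half_pow_small (4 * d) (1 - r) ltac:(lra).
  have := modcD (z0 - (x n).1.1) ((x n).1.1); rewrite subrK modc_distC.
  have [[h1 _ _] _] := xP n; have := xz0 n; lra.
have [D hD] := hf _ z01.
apply: modc_eq0; apply/eqP; rewrite eq_le modc_ge0 andbT; apply/ler_addgt0Pl => e e0.
rewrite addr0.
(* Here 30 is the 6 of [tri_int_bound] times the 5 of the distance bound [5 * dn] to [z0]; the added
   1 covers [d = 0]. *)
have ed : 0 < e / (30 * (d ^+ 2 + 1)).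
  by rewrite divr_gt0// mulr_gt0// ltr_wpDl// sqr_ge0.
have [s s0 hs] := hD _ ed.
have [n hn] := half_pow_small (5 * d) s0.
have := xT n; rewrite {1}/tri3 /= => /le_trans; apply.
have [[xr1 xr2 xr3] [xs1 xs2 xs3]] := xP n.
move: (x n) (xz0 n) xr1 xr2 xr3 xs1 xs2 xs3 => [[a' b'] c'] /= az ar br cr ab bc ca.
pose dn := d / 2 ^+ n; rewrite -/dn in ab bc ca.
have dn0 : 0 <= dn by rewrite divr_ge0// exprn_ge0.
have {}az : modc (a' - z0) <= 4 * dn by rewrite (le_trans az)// -mulrA.
have bz : modc (b' - z0) <= 5 * dn.
  have := modcD (b' - a') (a' - z0); rewrite subrKA; lra.
have cz : modc (c' - z0) <= 5 * dn.
  have := modcD (c' - a') (a' - z0); rewrite subrKA modc_distC; lra.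
have {}az : modc (a' - z0) <= 5 * dn by lra.
have lt1 z : modc z <= r -> modc z < 1 by move=> h; exact: le_lt_trans r1.
(* The affine part of [f] at [z0], written so that [tri_int_affine] applies; [k] is the
   remainder. *)
pose g z := f z0 - D * z0 + D * z.
pose k z := f z - g z.
have cg : disc_cont g.
  move=> z _; apply: (@cdiff_continuous _ _ _ (0 + D * 1)).
  by apply: cdiffD; [exact: cdiff_cst|apply: cdiffZ; exact: cdiff_id].
have ck : disc_cont k by move=> z z1; exact: (cvgB (cf z z1) (cg z z1)).
rewrite -[tri3 f _]/(tri_int f a' b' c').
have -> : tri_int f a' b' c' = tri_int k a' b' c'.
  have := tri_int_affine (f z0 - D * z0) D (lt1 _ ar) (lt1 _ br) (lt1 _ cr).
  rewrite /tri_int !(seg_intB cf cg) ?lt1// -/g => g0.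
  by rewrite -[LHS]subr0 -g0; ring.
have M0 : 0 <= e / (30 * (d ^+ 2 + 1)) * (5 * dn) by apply: mulr_ge0; [exact: ltW|exact: mulr_ge0].
have := tri_int_bound ck (lt1 _ ar) (lt1 _ br) (lt1 _ cr) ab bc ca M0.
have hk z w (t : R) : [\/ z = a', z = b' | z = c'] -> [\/ w = a', w = b' | w = c'] ->
     0 <= t <= 1 -> modc (k (z + t%:C * (w - z))) <= e / (30 * (d ^+ 2 + 1)) * (5 * dn).
  move=> hz hw t01.
  have z5 : modc (z - z0) <= 5 * dn by case: hz => ->.
  have w5 : modc (w - z0) <= 5 * dn by case: hw => ->.
  have := convex_modc t01 z5 w5; set v := z + _; move=> v5.
  have -> : k v = f (z0 + (v - z0)) - f z0 - D * (v - z0).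
    by rewrite subrKC /k /g; ring.
  apply: le_trans (hs _ _) _.
    by apply: le_lt_trans v5 _; rewrite /dn mulrA.
  by rewrite ler_wpM2l// ltW.
move=> /(_ hk) hT.
have h4 : 0 <= 4 ^+ n :> R by rewrite exprn_ge0.
apply: le_trans (ler_wpM2l h4 hT) _.
have d2 : 0 < 30 * (d ^+ 2 + 1) by rewrite mulr_gt0// ltr_wpDl// sqr_ge0.
have -> : 4 ^+ n * (6 * (e / (30 * (d ^+ 2 + 1)) * (5 * dn)) * dn) =
   e * (30 * d ^+ 2) / (30 * (d ^+ 2 + 1)).
  have e4 : 4 ^+ n = 2 ^+ n * 2 ^+ n :> R by rewrite -exprMn -natrM.
  have n2 : 2 ^+ n != 0 :> R by rewrite expf_neq0.
  rewrite /dn e4; field; rewrite n2 /=; lra.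
rewrite ler_pdivrMr// ler_wpM2l ?ltW//; lra.
Qed.

(** Goursat's theorem on the triangle [0, z, z + h] turns the increment of the segment integral into
    the integral over [[z, z + h]], and continuity makes [f - f z] small there. *)
Lemma holo_primitive f : holo f -> forall z, modc z < 1 ->
  cdiff (fun z => seg_int f 0 z) z (f z).
Proof.
move=> hf z z1 e e0; have cf := holo_cont hf.
have m0 : modc (0 : R[i]) < 1 by rewrite modc0.
have e2 : 0 < e / 2 by rewrite divr_gt0.
have /cvgC_modc/(_ _ e2)/nbhsC_modc[s s0 hs] := cf z z1.
exists (Num.min s (1 - modc z)) => [|h]; first by rewrite lt_min s0 subr_gt0.
rewrite lt_min => /andP[h1 h2].
have zh1 : modc (z + h) < 1 by rewrite (le_lt_trans (modcD _ _))// -ltrBrDl.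
have := goursat hf m0 z1 zh1; rewrite /tri_int (seg_int_rev cf m0 zh1).
move=> /eqP; rewrite subr_eq0 => /eqP <-.
have cz : disc_cont (fun=> f z) by move=> w _; exact: cst_continuous.
have -> : seg_int f 0 z + seg_int f z (z + h) - seg_int f 0 z - f z * h =
  seg_int (fun w => f w - f z) z (z + h).
  have e1 : seg_int (fun=> f z) z (z + h) = f z * h.
    by rewrite /seg_int CI_cst ?ler01// subr0 rmorph1; ring.
  by rewrite (seg_intB cf cz z1 zh1) e1; ring.
have cfz : disc_cont (fun w => f w - f z).
  by move=> w w1; exact: (cvgB (cf w w1) (cz w w1)).
apply: le_trans (seg_int_bound (M := e / 2) cfz z1 zh1 _) _ => [t /andP[t0 t1]|].
  rewrite modc_distC ltW// hs//.
  have -> : z + t%:C * (z + h - z) - z = t%:C * h by ring.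
  rewrite modcM modc_real ger0_norm// (le_lt_trans _ h1)//.
  by rewrite -[leRHS]mul1r ler_wpM2r// modc_ge0.
have -> : z + h - z = h by ring.
by have -> : 2 * (e / 2) = e by field.
Qed.

End GoursatTheorem.

(** * Cauchy's formula *)

Section CC.
Context {R : realType} {T : topologicalType}.
Notation C := ((R[i])^o).
Implicit Types (f g : T -> C) (t : T).

Lemma ccD f g t : {for t, continuous f} -> {for t, continuous g} ->
  {for t, continuous (fun s => f s + g s : C)}.
Proof. exact: cvgD. Qed.

Lemma ccN f t : {for t, continuous f} -> {for t, continuous (fun s => - f s : C)}.
Proof. exact: cvgN. Qed.

Lemma ccM f g t : {for t, continuous f} -> {for t, continuous g} ->
  {for t, continuous (fun s => f s * g s : C)}.
Proof. exact: cvgM. Qed.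

Lemma ccV f t : f t != 0 -> {for t, continuous f} ->
  {for t, continuous (fun s => (f s)^-1 : C)}.
Proof. by move=> ft; exact: cvgV. Qed.

Lemma ccX f n t : {for t, continuous f} -> {for t, continuous (fun s => f s ^+ n : C)}.
Proof.
move=> cf; elim: n => [|n ih]; first exact: cst_continuous.
rewrite (_ : (fun s => _) = fun s => f s * f s ^+ n); first exact: ccM.
by apply/funext => s; rewrite exprS.
Qed.

Lemma cc_cst (a : C) t : {for t, continuous (fun=> a)}.
Proof. exact: cst_continuous. Qed.

Lemma cc_comp (F : C -> C) f t : {for f t, continuous F} -> {for t, continuous f} ->
  {for t, continuous (fun s => F (f s))}.
Proof. by move=> cF cf; exact: (continuous_comp cf cF). Qed.

End CC.

(** Named forms of pointwise continuity, one for each codomain, so that the shape of the function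
    alone decides which rule applies. *)
Definition contC {R : realType} {T : topologicalType} (f : T -> (R[i])^o) (t : T) : Prop :=
  {for t, continuous f}.
Definition contR {R : realType} {T : topologicalType} (f : T -> R) (t : T) : Prop :=
  {for t, continuous f}.

Section ContRules.
Context {R : realType} {T : topologicalType}.
Implicit Types (f g : T -> (R[i])^o) (u v : T -> R) (t : T).

Lemma contC_cst (a : R[i]) t : contC (fun=> a) t. Proof. exact: cc_cst. Qed.
Lemma contC_D f g t : contC f t -> contC g t -> contC (fun s => f s + g s) t.
Proof. exact: ccD. Qed.
Lemma contC_N f t : contC f t -> contC (fun s => - f s) t.
Proof. exact: ccN. Qed.
Lemma contC_M f g t : contC f t -> contC g t -> contC (fun s => f s * g s) t.
Proof. exact: ccM. Qed.
Lemma contC_conj f t : contC f t -> contC (fun s => conjc (f s)) t.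
Proof. exact: continuous_conj. Qed.
Lemma contC_expi u t : contR u t -> contC (fun s => expi (u s)) t.
Proof. exact: continuous_expi. Qed.
Lemma contC_real u t : contR u t -> contC (fun s => (u s)%:C) t.
Proof. exact: continuous_realC. Qed.
Lemma contR_cst (a : R) t : contR (fun=> a) t. Proof. exact: cst_continuous. Qed.
Lemma contR_D u v t : contR u t -> contR v t -> contR (fun s => u s + v s) t.
Proof. exact: cvgD. Qed.
Lemma contR_N u t : contR u t -> contR (fun s => - u s) t.
Proof. exact: cvgN. Qed.
Lemma contR_M u v t : contR u t -> contR v t -> contR (fun s => u s * v s) t.
Proof. exact: cvgM. Qed.
Lemma contR_X u n t : contR u t -> contR (fun s => u s ^+ n) t.
Proof.
move=> cf; elim: n => [|n ih]; first exact: contR_cst.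
rewrite (_ : (fun s => _) = fun s => u s * u s ^+ n); first exact: contR_M.
by apply/funext => s; rewrite exprS.
Qed.
Lemma contR_Re f t : contC f t -> contR (fun s => complex.Re (f s)) t.
Proof. exact: continuous_Re. Qed.
Lemma contR_Im f t : contC f t -> contR (fun s => complex.Im (f s)) t.
Proof. exact: continuous_Im. Qed.
Lemma contR_modc f t : contC f t -> contR (fun s => modc (f s)) t.
Proof. exact: continuous_modc. Qed.
End ContRules.

Lemma contR_id {R : realType} (t : R) : contR (fun s : R => s) t.
Proof. exact: cvg_id. Qed.
Lemma contC_expi_id {R : realType} (t : R) : contC (@expi R) t.
Proof. by apply: (@contC_expi _ _ id); exact: contR_id. Qed.
Lemma contR_opp {R : realType} (t : R) : contR (-%R : R -> R) t.
Proof. by apply: (@contR_N _ _ id); exact: contR_id. Qed.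
Lemma contR_addl {R : realType} (a t : R) : contR (+%R a : R -> R) t.
Proof. by apply: (@contR_D _ _ (fun=> a) id); [exact: contR_cst|exact: contR_id]. Qed.
Lemma contR_mull {R : realType} (a t : R) : contR ( *%R a : R -> R) t.
Proof. by apply: (@contR_M _ _ (fun=> a) id); [exact: contR_cst|exact: contR_id]. Qed.
Lemma contR_fst {R : realType} (t : R * R) : contR (fun s : R * R => s.1) t.
Proof. exact: fst_continuous. Qed.
Lemma contR_snd {R : realType} (t : R * R) : contR (fun s : R * R => s.2) t.
Proof. exact: snd_continuous. Qed.

(** Descends through the arithmetic structure of the function and leaves as goals the parts it does
    not recognise, typically compositions with an analytic function. *)
Ltac conttac := lazymatch goal with
  | |- contC (@expi _) _ => exact: contC_expi_id
  | |- contC (fun s => GRing.add _ _) _ => apply: contC_D; conttac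
  | |- contC (fun s => GRing.opp _) _ => apply: contC_N; conttac
  | |- contC (fun s => GRing.mul _ _) _ => apply: contC_M; conttac
  | |- contC (fun s => conjc _) _ => apply: contC_conj; conttac
  | |- contC (fun s => expi _) _ => first [exact: contC_cst | apply: contC_expi; conttac]
  | |- contC (fun s => real_complex_def _ _) _ =>
      first [exact: contC_cst | apply: contC_real; conttac]
  | |- contC (fun s => ?a) _ => try exact: contC_cst
  | |- contR (@GRing.opp _) _ => exact: contR_opp
  | |- contR (@GRing.add _ _) _ => exact: contR_addl
  | |- contR (@GRing.mul _ _) _ => exact: contR_mull
  | |- contR fst _ => exact: contR_fst
  | |- contR snd _ => exact: contR_snd
  | |- contR (fun s => fst s) _ => exact: contR_fst
  | |- contR (fun s => snd s) _ => exact: contR_snd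
  | |- contR (fun s => s) _ => exact: contR_id
  | |- contR (fun s => GRing.add _ _) _ => apply: contR_D; conttac
  | |- contR (fun s => GRing.opp _) _ => apply: contR_N; conttac
  | |- contR (fun s => GRing.mul _ _) _ => apply: contR_M; conttac
  | |- contR (fun s => GRing.exp _ _) _ => apply: contR_X; conttac
  | |- contR (fun s => complex.Re _) _ => apply: contR_Re; conttac
  | |- contR (fun s => complex.Im _) _ => apply: contR_Im; conttac
  | |- contR (fun s => modc _) _ => apply: contR_modc; conttac
  | |- contR (fun s => ?a) _ => try exact: contR_cst
  | |- _ => idtac
  end.

Lemma contCE {R : realType} {T : topologicalType} (f : T -> (R[i])^o) t :
  contC f t -> {for t, continuous f}.
Proof. by []. Qed.
Lemma contRE {R : realType} {T : topologicalType} (f : T -> R) t :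
  contR f t -> {for t, continuous f}.
Proof. by []. Qed.

Ltac cctac := (apply: contCE || apply: contRE); conttac.

Section Cauchy.
Context {R : realType}.
Notation C := ((R[i])^o).
Implicit Types (f g F : C -> C) (a b c z w : R[i]) (r t : R).

Definition circ r t : R[i] := r%:C * expi t.

Lemma modc_circ r t : 0 <= r -> modc (circ r t) = r.
Proof. by move=> r0; rewrite modcM modc_real modc_expi mulr1 ger0_norm. Qed.

Lemma circ2pi r : circ r (2 * pi) = circ r 0.
Proof. by rewrite /circ /expi mulr_natl cos2pi sin2pi cos0 sin0. Qed.

Lemma cder_circ r t : cder (circ r) t ('i * circ r t).
Proof.
have := cderZ (r%:C) (cder_expi t).
by rewrite mulrCA.
Qed.

Lemma circ_neq0 r t : 0 < r -> circ r t != 0.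
Proof. by move=> r0; apply: modc_gt0_neq0; rewrite modc_circ// ltW. Qed.

Lemma circ_sub_neq0 r t z : modc z < r -> circ r t - z != 0.
Proof.
move=> zr; have r0 := le_lt_trans (modc_ge0 z) zr.
apply: contraTneq zr => /eqP; rewrite subr_eq0 => /eqP <-.
by rewrite modc_circ ?ltxx// ltW.
Qed.

Lemma ii_neq0 : ('i : R[i]) != 0.
Proof. by rewrite eq_complex /= oner_eq0 andbF. Qed.

Lemma pi2_ge0 : 0 <= 2 * pi :> R.
Proof. by rewrite mulr_ge0// pi_ge0. Qed.

Lemma pi2_gt0 : 0 < 2 * pi :> R.
Proof. by rewrite mulr_gt0// pi_gt0. Qed.

Lemma circ_continuous r t : {for t, continuous (fun t => circ r t : C)}.
Proof. by rewrite /circ; cctac. Qed.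

Lemma CI_circ r : CI 0 (2 * pi) (circ r) = 0.
Proof.
have -> : CI 0 (2 * pi) (circ r) = CI 0 (2 * pi) (fun t => 'i^-1 * ('i * circ r t)).
  by apply: CI_eq => t _; rewrite mulKf// ii_neq0.
have cc : ccts 0 (2 * pi) (fun t => 'i * circ r t).
  apply: ccts_pt; first exact: pi2_ge0.
  by move=> t _; apply: ccM; [exact: cc_cst|exact: circ_continuous].
rewrite CIZ// (CI_FTC pi2_ge0 cc (fun t _ => cder_circ r t)).
by rewrite circ2pi subrr mulr0.
Qed.

Section Formula.
Variables (F f : C -> C) (a z : R[i]) (r : R).
Hypotheses (r0 : 0 < r) (ar : modc a + r < 1) (zr : modc (z - a) < r).
Hypotheses (dF : forall z, modc z < 1 -> cdiff F z (f z)) (cf : disc_cont f).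

Let w t := a + circ r t.
(** Homotopy along segments from the constant [z] at [x = 0] to the circle [w] at [x = 1]. *)
Let p (x : R * R) : C := z + x.1%:C * (w x.2 - z).

Let wz t : w t - z = circ r t - (z - a).
Proof. by rewrite /w; ring. Qed.

Let wz0 t : w t - z != 0.
Proof. by rewrite wz circ_sub_neq0. Qed.

Let w1 t : modc (w t) < 1.
Proof. by apply: le_lt_trans ar; rewrite (le_trans (modcD _ _))// modc_circ// ltW. Qed.

Let z1 : modc z < 1.
Proof.
apply: lt_trans ar; rewrite -[z](subrKC a) (le_lt_trans (modcD _ _))//.
by rewrite ltrD2l.
Qed.

Let p1 x y : 0 <= x <= 1 -> modc (p (x, y)) < 1.
Proof. by move=> x01; exact: modc_lt_convex. Qed.

Let cp x : {for x, continuous p}.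
Proof. rewrite /p /w /circ; cctac. Qed.

Let cG x y : 0 <= x <= 1 ->
  {for (x, y), continuous (fun q : R * R => f (p q) * circ r q.2 : C)}.
Proof.
move=> x01; apply: ccM; last by rewrite /circ; cctac.
by apply: cc_comp; [apply: cf; exact: p1|exact: cp].
Qed.

Let dFp_t x y : 0 <= x <= 1 ->
  cder (fun t => F (p (x, t))) y (f (p (x, y)) * (x%:C * ('i * circ r y))).
Proof.
move=> x01; apply: cder_chain; first by apply: dF; exact: p1.
rewrite /p /= /w; have h := cderD (cder_cst z y) (cderZ x%:C (cderD (cderD (cder_cst a y) (cder_circ r y)) (cder_cst (- z) y))).
by rewrite !add0r addr0 in h.
Qed.

(** Up to the factor [x * 'i], the integrand is the [y]-derivative of [F (p (x, y))], which is
    periodic in [y]. At [x = 0] that factor vanishes, but there the integrand is a multiple of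
    [circ r]. *)
Let CI_G x : 0 <= x <= 1 -> CI 0 (2 * pi) (fun y => f (p (x, y)) * circ r y) = 0.
Proof.
move=> x01; have cGx : ccts 0 (2 * pi) (fun y => f (p (x, y)) * (x%:C * ('i * circ r y))).
  apply: ccts_pt; first exact: pi2_ge0.
  move=> y _; apply: ccM.
    apply: (@cc_comp _ _ f (fun y => p (x, y))); first by apply: cf; exact: p1.
    rewrite /p /w /circ /=; cctac.
  rewrite /circ; cctac.
have [x0|x0] := eqVneq x 0.
  rewrite (CI_eq (g := fun y => f z * circ r y)); last first.
    by move=> y _; rewrite x0 /p /= rmorph0 mul0r addr0.
  rewrite CIZ ?CI_circ ?mulr0//; apply: ccts_pt; first exact: pi2_ge0.
  by move=> y _; exact: circ_continuous.
rewrite (CI_eq (g := fun y => (x%:C * 'i)^-1 * (f (p (x, y)) * (x%:C * ('i * circ r y))))); last first.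
  move=> y _; field; rewrite ii_neq0 /=.
  by apply: contra x0 => /eqP[->].
rewrite CIZ// (CI_FTC pi2_ge0 cGx (F := fun y => F (p (x, y)))); last by move=> y _; exact: dFp_t.
by rewrite /p /= /w circ2pi subrr mulr0.
Qed.

(** Differentiating [F (p (x, t))] in [x] produces a factor [w t - z] that cancels the pole of the
    kernel, so that the derivative of the integrand has zero mean by [CI_G]. *)
Let cauchy_aux : CI 0 (2 * pi) (fun t => F (w t) * (circ r t / (w t - z))) =
  F z * CI 0 (2 * pi) (fun t => circ r t / (w t - z)).
Proof.
have ck : ccts 0 (2 * pi) (fun t => circ r t / (w t - z)).
  apply: ccts_pt; first exact: pi2_ge0.
  by move=> t _; apply: ccM; [exact: circ_continuous|apply: ccV => //; rewrite /w /circ; cctac].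
have dFc v : modc v < 1 -> {for (v : C), continuous F}.
  by move=> /dF; exact: cdiff_continuous.
rewrite -CIZ//.
have -> : CI 0 (2 * pi) (fun t => F z * (circ r t / (w t - z))) =
   CI 0 (2 * pi) (fun t => F (p (0, t)) * (circ r t / (w t - z))).
  by apply: CI_eq => t _; rewrite /p /= rmorph0 mul0r addr0.
have -> : CI 0 (2 * pi) (fun t => F (w t) * (circ r t / (w t - z))) =
   CI 0 (2 * pi) (fun t => F (p (1, t)) * (circ r t / (w t - z))).
  by apply: CI_eq => t _; rewrite /p /= rmorph1 mul1r subrKC.
have cA x : 0 <= x <= 1 ->
    ccts 0 (2 * pi) (fun y => F (p (x, y)) * (circ r y / (w y - z))).
  move=> x01; apply: cctsM => //; apply: ccts_pt; first exact: pi2_ge0.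
  move=> y _; apply: (@cc_comp _ _ F (fun y => p (x, y))); first by apply: dFc; exact: p1.
  rewrite /p /w /circ /=; cctac.
apply: (@homotopy_mean _ 0 1 0 (2 * pi) (fun q : R * R => F (p q) * (circ r q.2 / (w q.2 - z)))
   (fun q => f (p q) * circ r q.2)) => //=.
- exact: pi2_ge0.
- by apply: ccts2_pt => [//||x y x01 _]; [exact: pi2_ge0|exact: cG].
- move=> x y x01 _.
  have e : f (p (x, y)) * circ r y = f (p (x, y)) * (w y - z) * (circ r y / (w y - z)).
    by field; exact: wz0.
  rewrite e; have := cderM (f := fun s => F (p (s, y))) _ (cder_cst (circ r y / (w y - z)) x).
  move=> /(_ (f (p (x, y)) * (w y - z))); rewrite mulr0 add0r; apply.
  apply: cder_chain; first by apply: dF; exact: p1.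
  have := cderD (cder_cst z x) (cderM (cder_id x) (cder_cst (w y - z) x)).
  by rewrite mulr0 mul1r !add0r.
- by apply: cA; rewrite lexx ler01.
- by apply: cA; rewrite lexx ler01.
Qed.

(** Moves the pole from the centre of the circle ([x = 0], where the quotient [circ r t / q] is 1)
    to [z] ([x = 1]). *)
Let q (x : R * R) : C := circ r x.2 - x.1%:C * (z - a).

Let q0 x y : 0 <= x <= 1 -> q (x, y) != 0.
Proof.
move=> /andP[x0 x1]; rewrite /q /= circ_sub_neq0// modcM modc_real ger0_norm//.
by rewrite (le_lt_trans _ zr)// -[leRHS]mul1r ler_wpM2r// modc_ge0.
Qed.

(** The [x]-derivative [G] of the integrand is ['i * (z - a)] times the [y]-derivative of the
    periodic function [1 / q], so the homotopy preserves the integral, which is that of 1 at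
    [x = 0]. *)
Let cauchy_kernel : CI 0 (2 * pi) (fun t => circ r t / (w t - z)) = (2 * pi)%:C.
Proof.
have -> : CI 0 (2 * pi) (fun t => circ r t / (w t - z)) =
   CI 0 (2 * pi) (fun t => circ r t / q (1, t)).
  by apply: CI_eq => t _; rewrite wz /q /= rmorph1 mul1r.
have -> : (2 * pi)%:C = CI 0 (2 * pi) (fun t => circ r t / q (0, t)).
  rewrite (CI_eq (g := fun=> 1)) ?CI_cst ?mul1r ?subr0// ?pi2_ge0//.
  by move=> t _; rewrite /q /= rmorph0 mul0r subr0 divff// circ_neq0.
have cq x y : 0 <= x <= 1 -> {for (x, y), continuous q}.
  by move=> _; rewrite /q /circ; cctac.
have cA x : 0 <= x <= 1 -> ccts 0 (2 * pi) (fun y => circ r y / q (x, y)).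
  move=> x01; apply: ccts_pt; first exact: pi2_ge0.
  move=> y _; apply: ccM; first exact: circ_continuous.
  apply: (@ccV _ _ (fun y => q (x, y))); first exact: q0.
  rewrite /q /circ /=; cctac.
pose G (x : R * R) := 'i * (z - a) * (- (q x) ^- 2 * ('i * circ r x.2)).
have cG' x y : 0 <= x <= 1 -> {for (x, y), continuous (G : R * R -> C)}.
  move=> x01; apply: ccM; first exact: cc_cst.
  apply: ccM; last by rewrite /circ; cctac.
  apply: ccN; apply: ccV; first by rewrite expf_neq0// q0.
  by apply: ccX; exact: cq.
apply: (@homotopy_mean _ 0 1 0 (2 * pi) (fun x : R * R => circ r x.2 / q x) G) => //=.
- exact: pi2_ge0.
- by apply: ccts2_pt => [//||x y x01 _]; [exact: pi2_ge0|exact: cG'].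
- move=> x y x01 _.
  have -> : G (x, y) = circ r y * (- q (x, y) ^- 2 * (- (1 * (z - a)))).
    by rewrite /G /=; have ii : 'i * 'i = -1 :> R[i]; [rewrite -expr2 sqr_i|ring: ii].
  apply: cderZ; apply: (@cder_chain _ (fun z => z^-1) (fun s => q (s, y))).
    by have := @cdiffV _ id (q (x, y)) 1 (q0 y x01) (cdiff_id (q (x, y))); rewrite mulr1.
  rewrite /q /=; have := cderD (cder_cst (circ r y) x) (cderZ (-1) (cderM (cder_id x) (cder_cst (z - a) x))).
  rewrite mulr0 !add0r mulN1r.
  by congr (cder _ _ _); apply/funext => s; rewrite mulN1r.
- move=> x x01; have cx : ccts 0 (2 * pi) (fun y => - (q (x, y)) ^- 2 * ('i * circ r y)).
    apply: ccts_pt; first exact: pi2_ge0.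
    move=> y _; apply: ccM; last by rewrite /circ; cctac.
    apply: ccN; apply: (@ccV _ _ (fun y => q (x, y) ^+ 2)); first by rewrite expf_neq0// q0.
    by apply: (@ccX _ _ (fun y => q (x, y))); rewrite /q /circ /=; cctac.
  rewrite /G /= CIZ// (CI_FTC pi2_ge0 cx (F := fun y => (q (x, y))^-1)).
    by rewrite /q /= circ2pi subrr mulr0.
  move=> y _; apply: (@cder_chain _ (fun z => z^-1) (fun s => q (x, s))).
    by have := @cdiffV _ id (q (x, y)) 1 (q0 y x01) (cdiff_id (q (x, y))); rewrite mulr1.
  rewrite /q /=; have := cderD (cder_circ r y) (cder_cst (- (x%:C * (z - a))) y).
  by rewrite addr0.
- by apply: cA; rewrite lexx ler01.
- by apply: cA; rewrite lexx ler01.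
Qed.

(** First pass, for a function whose derivative is known to be continuous. The primitive of an
    analytic function is of this kind, and this is enough for [holo_deriv], which in turn gives the
    general [cauchy_formula]. *)
Lemma cauchy_formula_C1 :
  CI 0 (2 * pi) (fun t => F (a + circ r t) * (circ r t / (a + circ r t - z))) =
  F z * (2 * pi)%:C.
Proof. by rewrite cauchy_aux cauchy_kernel. Qed.

End Formula.

End Cauchy.

(** * Differentiation of Cauchy integrals; derivatives of analytic functions are analytic *)

Section Smooth.
Context {R : realType}.
Notation C := ((R[i])^o).
Implicit Types (f g F : C -> C) (a b c z w : R[i]) (r t : R).

Lemma cts_bounded (a b : R) (f : R -> R) : a <= b -> cts a b f ->
  exists M, forall x, a <= x <= b -> `|f x| <= M.
Proof.
move=> ab cf; have cn : {within `[a, b], continuous (fun x => `|f x|)}.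
  apply: cts_within => x; apply: (@continuous_comp _ _ _ (f \o clamp a b) Num.norm).
    exact: cf.
  exact: norm_continuous.
have [c _ hc] := EVT_max ab cn; exists `|f c| => x xab; apply: hc.
by rewrite in_itv.
Qed.

Lemma ccts_bounded (a b : R) (f : R -> R[i]) : a <= b -> ccts a b f ->
  exists2 M, 0 <= M & forall x, a <= x <= b -> modc (f x) <= M.
Proof.
move=> ab [c1 c2]; have [M1 h1] := cts_bounded ab c1; have [M2 h2] := cts_bounded ab c2.
exists (M1 + M2).
  have aab : a <= a <= b by rewrite lexx.
  by rewrite addr_ge0// (le_trans _ (h1 _ aab), le_trans _ (h2 _ aab)).
by move=> x xab; rewrite (le_trans (modc_le _))// lerD ?h1 ?h2.
Qed.

(** A second-order remainder that is uniform in [w] at distance [e] from 0, as differentiation under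
    the integral sign requires. The constant is explicit so that it depends on [n] only. *)
Lemma inv_pow_estimate n (w h : R[i]) (e : R) : 0 < e -> e <= modc w -> e <= modc (w - h) ->
  exists2 K : R, K = \sum_(i < n.+1) i%:R &
  modc ((w - h)^-1 ^+ n - w^-1 ^+ n - n%:R * h * w^-1 ^+ n.+1) <= K * modc h ^+ 2 / e ^+ n.+2.
Proof.
move=> e0 ew ewh; eexists; first reflexivity.
have w0 : w != 0 by apply: modc_gt0_neq0; exact: lt_le_trans ew.
have wh0 : w - h != 0 by apply: modc_gt0_neq0; exact: lt_le_trans ewh.
set x := (w - h)^-1; set y := w^-1.
have ye : modc y <= e^-1 by rewrite modcV lef_pV2 ?posrE ?(lt_le_trans e0).
have xe : modc x <= e^-1 by rewrite modcV lef_pV2 ?posrE ?(lt_le_trans e0).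
have e0' : 0 <= e^-1 by rewrite invr_ge0 ltW.
have E1 : x - y = h * x * y by rewrite /x /y; field; rewrite w0 wh0.
rewrite -exprVn.
elim: n => [|n ih].
  rewrite !expr0 subrr mul0r mul0r subr0 modc0 big_ord1 /= mul0r mul0r//.
(* Recursion for the remainder, from [x - y = h * x * y]: the new term is quadratic in [h] and
   contributes [n.+1] to the sum [K]. *)
have -> : x ^+ n.+1 - y ^+ n.+1 - n.+1%:R * h * y ^+ n.+2 =
  x * (x ^+ n - y ^+ n - n%:R * h * y ^+ n.+1) + n.+1%:R * h ^+ 2 * (x * y ^+ n.+2).
  have Q : x - y - h * x * y = 0 by rewrite E1 subrr.
  rewrite -[RHS]addr0 -[X in _ = _ + X](mul0r (y ^+ n + n.+1%:R * h * y ^+ n.+1)) -Q.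
  by rewrite -!natr1 !exprS; ring.
rewrite big_ord_recr /= mulrDl mulrDl (le_trans (modcD _ _))// lerD//.
  rewrite modcM [e^-1 ^+ _]exprS mulrCA.
  exact: ler_pM (modc_ge0 _) (modc_ge0 _) xe ih.
rewrite modcM (modcM x) (modcM n.+1%:R) !modcX modc_nat [e^-1 ^+ _]exprS.
rewrite ler_wpM2l ?mulr_ge0 ?exprn_ge0 ?modc_ge0// ler_pM ?modc_ge0 ?exprn_ge0 ?modc_ge0//.
by rewrite lerXn2r// nnegrE modc_ge0.
Qed.

Lemma cctsB (a b : R) (f g : R -> R[i]) : ccts a b f -> ccts a b g ->
  ccts a b (fun x => f x - g x).
Proof.
move=> cf cg; rewrite (_ : (fun x => _) = fun x => f x + (-1) * g x).
  by apply: cctsD => //; apply: cctsM => //; exact: ccts_cst.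
by apply/funext => x; rewrite mulN1r.
Qed.

(** Cauchy transform of order [n]. With [n = 1] and [phi t = F (circ r t) * circ r t / (2 * pi)] it
    is Cauchy's formula for [F] on a circle about 0, the factor [circ r t] coming from the
    differential. *)
Definition cauchy_tr (phi : R -> R[i]) r n z : R[i] :=
  CI 0 (2 * pi) (fun t => phi t * (circ r t - z)^-1 ^+ n).

Lemma cauchy_tr_diff (phi : R -> R[i]) r n z : 0 < r -> ccts 0 (2 * pi) phi ->
  modc z < r -> cdiff (cauchy_tr phi r n) z (n%:R * cauchy_tr phi r n.+1 z).
Proof.
move=> r0 cphi zr e e0.
have [M M0 hM] := ccts_bounded (@pi2_ge0 R) cphi.
(* Half the distance from [z] to the circle: for [|h| < eta] both [z] and [z + h] stay at distance
   at least [eta] from it. *)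
pose eta := (r - modc z) / 2; have eta0 : 0 < eta by rewrite divr_gt0// subr_gt0.
pose K : R := \sum_(i < n.+1) i%:R.
have K0 : 0 <= K by apply: sumr_ge0.
pose D := 2 * (M * (K / eta ^+ n.+2)) * (2 * pi).
have D0 : 0 <= D.
  apply: mulr_ge0; last exact: pi2_ge0.
  apply: mulr_ge0 => //; apply: mulr_ge0 => //; apply: divr_ge0 => //.
  by rewrite exprn_ge0 // ltW.
exists (Num.min eta (e / (D + 1))).
  by rewrite lt_min eta0 divr_gt0// ltr_wpDl.
move=> h; rewrite lt_min => /andP[h1 h2].
have ck m v : modc v < r -> ccts 0 (2 * pi) (fun t => phi t * (circ r t - v)^-1 ^+ m).
  move=> vr; apply: cctsM => //; apply: ccts_pt; first exact: pi2_ge0.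
  move=> t _; apply: ccX; apply: ccV; first exact: circ_sub_neq0.
  by rewrite /circ; cctac.
have zhr : modc (z + h) < r.
  by have := modcD z h; move: h1; rewrite /eta; lra.
have z1 := ck n _ zhr; have z2 := ck n _ zr; have z3 := ck n.+1 _ zr.
have z4 : ccts 0 (2 * pi) (fun t => n%:R * h * (phi t * (circ r t - z)^-1 ^+ n.+1)).
  by apply: cctsM => //; exact: ccts_cst.
rewrite /cauchy_tr mulrAC -(CIZ _ z3) -(CIB z1 z2) -(CIB (cctsB z1 z2) z4).
apply: le_trans (CI_bound (M := M * (K * modc h ^+ 2 / eta ^+ n.+2)) (@pi2_ge0 R)
  (cctsB (cctsB z1 z2) z4) _) _.
  move=> t tp.
  have -> : phi t * (circ r t - (z + h))^-1 ^+ n - phi t * (circ r t - z)^-1 ^+ n -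
     n%:R * h * (phi t * (circ r t - z)^-1 ^+ n.+1) =
     phi t * ((circ r t - z - h)^-1 ^+ n - (circ r t - z)^-1 ^+ n -
      n%:R * h * (circ r t - z)^-1 ^+ n.+1).
    by rewrite opprD addrA; ring.
  rewrite modcM ler_pM ?modc_ge0 ?hM//.
  have hz : eta <= modc (circ r t - z).
    have := modcD (circ r t - z) z; rewrite subrK (modc_circ t (ltW r0)) /eta; lra.
  have hzh : eta <= modc (circ r t - z - h).
    have := modcD (circ r t - z - h) (z + h).
    rewrite -[circ r t - z - h]addrA -opprD subrK (modc_circ t (ltW r0)).
    have := modcD z h; move: h1; rewrite /eta; lra.
  by have [_ ->] := inv_pow_estimate n eta0 hz hzh.
rewrite subr0; have -> : 2 * (M * (K * modc h ^+ 2 / eta ^+ n.+2)) * (2 * pi) = 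
   D * modc h * modc h by rewrite /D; ring.
rewrite ler_wpM2r ?modc_ge0//.
move: h2; rewrite ltr_pdivlMr ?ltr_wpDl// => h2.
have := modc_ge0 h; lra.
Qed.

Lemma cderiv_cdiff f z d : cdiff f z d -> cderiv f z = d.
Proof. by move=> /cdiff_derivable[]. Qed.

Lemma holo_cdiff f z : holo f -> modc z < 1 -> cdiff f z (cderiv f z).
Proof. by move=> hf /hf[d hd]; rewrite (cderiv_cdiff hd). Qed.

(** The primitive [F] of [f] has the continuous derivative [f], so Cauchy's formula represents it
    near [z] as a Cauchy transform. Differentiating this transform three times gives [f], then
    [cderiv f], then the derivative sought. *)
Lemma holo_deriv f : holo f -> holo (cderiv f).
Proof.
move=> hf z z1; have cf := holo_cont hf.
pose F z := seg_int f 0 z; have dF := holo_primitive hf.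
pose r := (1 + modc z) / 2.
have zr : modc z < r by rewrite /r; lra.
have r1 : r < 1 by rewrite /r; lra.
have r0 : 0 < r by exact: le_lt_trans (modc_ge0 z) zr.
pose phi t := (2 * pi)^-1%:C * (F (circ r t) * circ r t).
have m1 t : modc (circ r t) < 1 by rewrite modc_circ // ltW.
have cphi : ccts 0 (2 * pi) phi.
  apply: ccts_pt; first exact: pi2_ge0.
  move=> t _; apply: ccM; first exact: cc_cst.
  apply: ccM; last exact: circ_continuous.
  apply: cc_comp; last exact: circ_continuous.
  by apply: cdiff_continuous (dF _ _).
have pi2 : (2 * pi)%:C != 0 :> R[i].
  by apply/eqP => -[] /eqP; rewrite gt_eqF// pi2_gt0.
have piV : (2 * pi)^-1%:C = ((2 * pi)%:C)^-1 :> R[i] by rewrite fmorphV.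
have FE v : modc v < r -> F v = cauchy_tr phi r 1 v.
  move=> vr; have := @cauchy_formula_C1 _ F f 0 v r r0.
  rewrite modc0 add0r subr0 => /(_ r1 vr dF cf) h.
  apply: (mulIf pi2); rewrite -h /cauchy_tr [RHS]mulrC -CIZ.
    apply: CI_eq => t _; rewrite add0r /phi piV expr1.
    move: pi2 (circ_sub_neq0 t vr); set P := (2 * pi)%:C => P0 Q0; clearbody P.
    by field; rewrite Q0 P0.
  apply: cctsM => //; apply: ccts_pt; first exact: pi2_ge0.
  move=> t _; apply: ccX; apply: ccV; first exact: circ_sub_neq0.
  by rewrite /circ; cctac.
have near (g k : C -> C) v : (forall v, modc v < r -> g v = k v) -> modc v < r ->
   forall h, modc h < r - modc v -> g (v + h) = k (v + h).
  by move=> gk vr h hr; apply: gk; have := modcD v h; lra.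
have fE v : modc v < r -> f v = cauchy_tr phi r 2 v.
  move=> vr; have v1 := lt_trans vr r1.
  apply: (cdiff_unique (dF v v1)).
  have := cauchy_tr_diff 1 r0 cphi vr; rewrite mul1r.
  apply: cdiff_near (r - modc v) _ _; first by rewrite subr_gt0.
  by apply: near => // u ur; exact: esym (FE u ur).
have f'E v : modc v < r -> cderiv f v = 2%:R * cauchy_tr phi r 3 v.
  move=> vr; apply: cderiv_cdiff.
  have := cauchy_tr_diff 2 r0 cphi vr.
  apply: cdiff_near (r - modc v) _ _; first by rewrite subr_gt0.
  by apply: near => // u ur; exact: esym (fE u ur).
exists (2%:R * (3%:R * cauchy_tr phi r 4 z)).
have := cdiffZ 2%:R (cauchy_tr_diff 3 r0 cphi zr).
apply: cdiff_near (r - modc z) _ _; first by rewrite subr_gt0.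
by apply: (near (fun w => 2%:R * cauchy_tr phi r 3 w)) => // u ur; exact: esym (f'E u ur).
Qed.

Lemma holo_analytic f : holo f <-> analytic_on_disc f.
Proof.
split => [hf z /hf[d /cdiff_derivable[]]//|hf z z1].
by exists (cderiv f z); apply: derivableC_cdiff; exact: hf.
Qed.

Lemma cauchy_formula f a z r : holo f -> 0 < r -> modc a + r < 1 -> modc (z - a) < r ->
  CI 0 (2 * pi) (fun t => f (a + circ r t) * (circ r t / (a + circ r t - z))) =
  f z * (2 * pi)%:C.
Proof.
move=> hf r0 ar zr; apply: (cauchy_formula_C1 r0 ar zr (f := cderiv f)).
  by move=> v v1; exact: holo_cdiff.
by apply: holo_cont; exact: holo_deriv.
Qed.

Lemma mean_value f a r : holo f -> 0 < r -> modc a + r < 1 ->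
  CI 0 (2 * pi) (fun t => f (a + circ r t)) = f a * (2 * pi)%:C.
Proof.
move=> hf r0 ar; rewrite -(cauchy_formula hf r0 ar (z := a)) ?subrr ?modc0//.
apply: CI_eq => t _; rewrite [a + _ - a]addrC addKr divff ?mulr1//; exact: circ_neq0.
Qed.

Lemma holoX f n : holo f -> holo (fun z => f z ^+ n).
Proof. by move=> hf z /hf[d hd]; exact: cdiffX hd. Qed.

Lemma holoM f g : holo f -> holo g -> holo (fun z => f z * g z).
Proof.
by move=> hf hg z z1; have [d hd] := hf z z1; have [e he] := hg z z1; exists (f z * e + g z * d); exact: (cdiffM hd he).
Qed.

(** [Ig g f] is the segment integral from 0 of the analytic function [f' * g], hence a primitive of
    it. *)
Lemma Ig_deriv f g z : holo f -> holo g -> modc z < 1 ->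
  cderiv (Ig g f) z = cderiv f z * g z.
Proof.
move=> hf hg z1; have hk := holoM (holo_deriv hf) hg.
apply: cderiv_cdiff.
rewrite (_ : Ig g f = (fun z => seg_int (fun w => cderiv f w * g w) 0 z)).
  exact: (holo_primitive hk).
apply/funext => v; rewrite /Ig /seg_int subr0; congr (_ * _).
by apply: CI_eq => t _; rewrite add0r.
Qed.

End Smooth.

(** * Maximum modulus, Poisson kernel, Littlewood-Paley *)

Section HoloEstimates.
Context {R : realType}.
Notation C := ((R[i])^o).
Implicit Types (f g G : C -> C) (a b c z w : R[i]) (r t : R).

Lemma bernoulli (q : R) n : 1 <= q -> 1 + n%:R * (q - 1) <= q ^+ n.
Proof.
move=> q1; elim: n => [|n ih]; first by rewrite mul0r addr0 expr0.
have h0 : 0 <= n%:R * (q - 1) by rewrite mulr_ge0// subr_ge0.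
rewrite exprS -natr1; apply: le_trans (ler_wpM2l _ ih); last lra.
nra.
Qed.

(** Cauchy's formula for [g ^+ n] on a circle inside the annulus gives [|g z| ^+ n <= K * m ^+ n]
    with [K] independent of [n]. If [|g z| > m > 0], the powers of [|g z| / m] would be bounded,
    against Bernoulli's inequality. *)
Lemma maximum_modulus g (m rho : R) : holo g -> 0 <= m -> rho < 1 ->
  (forall z, rho < modc z -> modc z < 1 -> modc (g z) <= m) ->
  forall z, modc z < 1 -> modc (g z) <= m.
Proof.
move=> hg m0 rho1 hm z z1; rewrite leNgt; apply/negP => gm.
pose r := (1 + Num.max rho (modc z)) / 2.
have mx1 : Num.max rho (modc z) < 1 by rewrite gt_max rho1.
have zm : modc z <= Num.max rho (modc z) by rewrite le_max lexx orbT.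
have rm : rho <= Num.max rho (modc z) by rewrite le_max lexx.
have zr : modc z < r by rewrite /r; lra.
have rr : rho < r by rewrite /r; lra.
have r1 : r < 1 by rewrite /r; lra.
have r0 : 0 < r by exact: le_lt_trans (modc_ge0 z) zr.
have mc t : modc (circ r t) = r by rewrite modc_circ// ltW.
pose K := 2 * (r / (r - modc z)).
have key n : modc (g z) ^+ n <= K * m ^+ n.
  have := @cauchy_formula _ _ 0 z r (holoX n hg) r0.
  rewrite modc0 add0r subr0 => /(_ r1 zr) h.
  have p0 := @pi2_gt0 R.
  have -> : modc (g z) ^+ n = modc (g z ^+ n * (2 * pi)%:C) / (2 * pi).
    by rewrite modcM modcX modc_real (ger0_norm (ltW p0)) mulfK// gt_eqF.
  rewrite -h ler_pdivrMr//.
  apply: le_trans (CI_bound (M := m ^+ n * (r / (r - modc z))) (ltW p0) _ _) _.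
  - apply: ccts_pt; first exact: ltW.
    move=> t _; apply: contCE.
    apply: contC_M.
      apply: (@ccX _ _ (fun t => g (0 + circ r t))); apply: (@cc_comp _ _ g (fun t => 0 + circ r t)).
        by apply: holo_cont => //; rewrite add0r mc.
      by rewrite /circ; cctac.
    apply: contC_M; first exact: circ_continuous.
    by apply: ccV; [rewrite add0r circ_sub_neq0|rewrite /circ; cctac].
  - move=> t _; rewrite add0r modcM (modcM (circ r t)) modcX modcV mc.
    have cz : 0 < modc (circ r t - z) by apply: modc_gt0; exact: circ_sub_neq0.
    apply: ler_pM; first by rewrite exprn_ge0// modc_ge0.
    + by rewrite divr_ge0// ltW.
    + by rewrite lerXn2r ?nnegrE ?modc_ge0//; apply: hm; rewrite mc.
    + rewrite ler_pM2l// lef_pV2 ?posrE ?subr_gt0//.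
      by have := modcD (circ r t - z) z; rewrite subrK mc; lra.
  - by rewrite subr0 le_eqVlt; apply/orP; left; apply/eqP; rewrite /K; ring.
have K0 : 0 <= K by rewrite mulr_ge0// divr_ge0 ?ltW// subr_gt0.
have [m00|m00] := eqVneq m 0.
  have := key 1%N; rewrite expr1 expr1 m00 mulr0; rewrite m00 in gm; lra.
have mp : 0 < m by rewrite lt0r m00.
pose q := modc (g z) / m.
have q1 : 1 < q by rewrite ltr_pdivlMr// mul1r.
have qK n : q ^+ n <= K by rewrite expr_div_n ler_pdivrMr ?exprn_gt0.
have hb := @archi_boundP R (K / (q - 1)) ltac:(by rewrite divr_ge0// subr_ge0 ltW).
have := le_trans (bernoulli (Num.bound (K / (q - 1))) (ltW q1)) (qK _).
rewrite ltr_pdivrMr ?subr_gt0// in hb; lra.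
Qed.

Lemma contC_holo (T : topologicalType) G (f : T -> C) (t : T) : holo G -> modc (f t) < 1 ->
  contC f t -> contC (fun s => G (f s)) t.
Proof. by move=> hG ft cf; exact: (cc_comp (holo_cont hG ft) cf). Qed.

(** The mean value property of [f ^+ 2]. The factor is [pi] instead of [2 * pi] because the modulus
    of the integral is bounded by the sum of its real and imaginary parts. *)
Lemma submean f a r : holo f -> 0 < r -> modc a + r < 1 ->
  pi * modc (f a) ^+ 2 <= RI 0 (2 * pi) (fun t => modc (f (a + circ r t)) ^+ 2).
Proof.
move=> hf r0 ar; have := mean_value (holoX 2 hf) r0 ar.
set I := CI _ _ _ => h.
have p0 := @pi2_gt0 R.
have m1 t : modc (a + circ r t) < 1.
  by apply: le_lt_trans ar; rewrite (le_trans (modcD _ _))// modc_circ// ltW.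
have cc : forall t : R, contC (fun t => f (a + circ r t)) t.
  by move=> t; apply: contC_holo => //; rewrite /circ; conttac.
have c0 : cts 0 (2 * pi) (fun t => modc (f (a + circ r t)) ^+ 2).
  apply: cts_pt => [|t _]; first exact: ltW.
  by apply: contRE; apply: contR_X; apply: contR_modc.
have [c1 c2] : ccts 0 (2 * pi) (fun t => f (a + circ r t) ^+ 2).
  by apply: ccts_pt => [|t _]; [exact: ltW|apply: ccX; exact: cc].
have b (u : R -> R) : cts 0 (2 * pi) u -> (forall t, `|u t| <= modc (f (a + circ r t)) ^+ 2) ->
    `|RI 0 (2 * pi) u| <= RI 0 (2 * pi) (fun t => modc (f (a + circ r t)) ^+ 2).
  move=> cu hu; rewrite ler_norml; apply/andP; split; last first.
    by apply: RI_le => // t _; exact: le_trans (ler_norm _) (hu t).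
  rewrite -mulN1r -RIZ//; apply: RI_le => //; first by apply: ctsM => //; exact: cts_cst.
  by move=> t _; rewrite mulN1r; have := hu t; rewrite ler_norml => /andP[].
have h1 : modc I <= 2 * RI 0 (2 * pi) (fun t => modc (f (a + circ r t)) ^+ 2).
  rewrite (le_trans (modc_le _))// mulr_natl mulr2n lerD//; apply: b => // t.
    by rewrite -modcX modc_Re.
  by rewrite -modcX modc_Im.
move: h1; rewrite h modcM modcX modc_real (ger0_norm (ltW p0)); lra.
Qed.

Lemma modc_mul_lt1 b z : modc b < 1 -> modc z < 1 -> modc b * modc z < 1.
Proof.
move=> b1 z1; rewrite (le_lt_trans _ z1)// -[leRHS]mul1r.
by rewrite ler_wpM2r ?modc_ge0// ltW.
Qed.

Lemma kernel_neq0 b z : modc b < 1 -> modc z < 1 -> 1 - b * z != 0.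
Proof.
move=> b1 z1; apply: modc_gt0_neq0.
have := modcD (1 - b * z) (b * z); rewrite subrK modc1 modcM.
by have := modc_mul_lt1 b1 z1; lra.
Qed.

Definition ckernel b z : R[i] := (1 - b * z)^-1.

Lemma cdiff_kernel b z : modc b < 1 -> modc z < 1 ->
  cdiff (ckernel b) z (b * ckernel b z ^+ 2).
Proof.
move=> b1 z1; have k0 := kernel_neq0 b1 z1.
have := cdiffV (f := fun z => 1 - b * z) (d := 0 + (- b) * 1) k0.
have -> : (- (1 - b * z) ^- 2 * (0 + - b * 1)) = b * ckernel b z ^+ 2.
  by rewrite /ckernel exprVn; ring.
apply; have := cdiffD (cdiff_cst 1 z) (cdiffZ (- b) (cdiff_id z)).
by rewrite (_ : (fun w => 1 + - b * w) = (fun w => 1 - b * w))//; apply/funext => w; rewrite mulNr.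
Qed.

Lemma kernel_holo b : modc b < 1 -> holo (ckernel b).
Proof. by move=> b1 z z1; eexists; exact: cdiff_kernel. Qed.

Lemma modc_kernel_ge b z : modc b < 1 -> modc z < 1 -> 
  modc (ckernel b z) <= (1 - modc b * modc z)^-1.
Proof.
move=> b1 z1; have h1 := modc_gt0 (kernel_neq0 b1 z1).
have h2 : 0 < 1 - modc b * modc z by rewrite subr_gt0 modc_mul_lt1.
rewrite modcV lef_pV2 ?posrE//.
have := modcD (1 - b * z) (b * z); rewrite subrK modc1 modcM; lra.
Qed.

(** The real part of [H = (1 + b z) / (1 - b z)] is [(1 - |b z|^2) * |k|^2] with [k] the kernel, and
    the mean of [H] on the circle is [H 0 = 1]. *)
Lemma poisson_kernel b r : modc b < 1 -> 0 < r -> r < 1 ->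
  (1 - (modc b * r) ^+ 2) * RI 0 (2 * pi) (fun t => modc (ckernel b (circ r t)) ^+ 2) = 2 * pi.
Proof.
move=> b1 r0 r1; pose H z := (1 + b * z) * ckernel b z.
have hH : holo H.
  move=> z z1; eexists; apply: cdiffM; last exact: cdiff_kernel.
  by apply: cdiffD; [exact: cdiff_cst|apply: cdiffZ; exact: cdiff_id].
have := @mean_value _ H 0 r hH r0; rewrite modc0 add0r => /(_ r1).
have -> : H 0 = 1 by rewrite /H /ckernel mulr0 addr0 subr0 invr1 mul1r.
rewrite mul1r => /(congr1 (@complex.Re R)) /= h.
rewrite -RIZ.
  rewrite -[RHS]h; apply: RI_eq => t _; rewrite add0r /H /ckernel.
  have z1 : modc (circ r t) < 1 by rewrite modc_circ// ltW.
  have := kernel_neq0 b1 z1; rewrite modcV exprVn.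
  have -> : modc b * r = modc (b * circ r t) by rewrite modcM (modc_circ _ (ltW r0)).
  move: (b * circ r t) => [x y] n0; have := modc_gt0 n0.
  rewrite !sqr_modc => h0.
  have s0 : (1 - x) ^+ 2 + (- y) ^+ 2 != 0.
    have -> : (1 - x) ^+ 2 + (- y) ^+ 2 = modc (1 - (x +i* y)) ^+ 2.
      by rewrite sqr_modc /= sub0r.
    by rewrite expf_neq0// gt_eqF.
  rewrite /= !sub0r !add0r.
  by field.
apply: cts_pt => [|t _]; first exact: pi2_ge0.
apply: contRE; apply: contR_X; apply: contR_modc.
have z1 : modc (circ r t) < 1 by rewrite modc_circ// ltW.
exact: (contC_holo (kernel_holo b1) z1 (@circ_continuous R r t)).
Qed.

Lemma contC_circ r t : contC (fun t => circ r t) t.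
Proof. exact: circ_continuous. Qed.

Lemma Re_CI (a b : R) (f : R -> R[i]) :
  complex.Re (CI a b f) = RI a b (fun t => complex.Re (f t)).
Proof. by []. Qed.

Opaque contC contR cts cts2 ccts RI CI.

Lemma cder_ray r t : cder (fun s => circ s t) r (expi t).
Proof.
have := cderM (cder_id r) (cder_cst (expi t) r).
by rewrite mulr0 add0r mul1r.
Qed.

Lemma expi_circ1 t : expi t = circ 1 t.
Proof. by rewrite /circ mul1r. Qed.

Lemma mul_conj z : z * conjc z = (modc z ^+ 2)%:C.
Proof.
by case: z => x y; rewrite sqr_modc; apply: complex_ext; rewrite ?ReM ?ImM /=; ring.
Qed.

(* The weight [rho^2 - r^2] turns the polar Laplacian identity
   [(r m')' = 4 r N] for the circular means [m] of [|G|^2] and [N] of [|G'|^2]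
   into an inequality by two integrations by parts in [r]; here they are
   packed into the single primitive [W]. *)
Lemma littlewood_paley G (rho : R) : holo G -> 0 < rho -> rho < 1 ->
  2 * RI 0 rho (fun r => RI 0 (2 * pi)
     (fun t => r * (rho ^+ 2 - r ^+ 2) * modc (cderiv G (circ r t)) ^+ 2)) <=
  rho ^+ 2 * RI 0 (2 * pi) (fun t => modc (G (circ rho t)) ^+ 2).
Proof.
move=> hG r0 r1; have p0 := @pi2_ge0 R.
have [G' [hG' dG ->]] : exists G', [/\ holo G', forall z, modc z < 1 -> cdiff G z (G' z)
    & cderiv G = G'].
  by exists (cderiv G); split => //; [exact: holo_deriv|move=> z; exact: holo_cdiff].
have [G'' [hG'' dG']] : exists G'', holo G'' /\ forall z, modc z < 1 -> cdiff G' z (G'' z).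
  by exists (cderiv G'); split; [exact: holo_deriv|move=> z; exact: holo_cdiff].
have m1 r t : 0 <= r <= rho -> modc (circ r t) < 1.
  by move=> /andP[h1 h2]; rewrite modc_circ// (le_lt_trans h2).
(* The radial derivative [V] of [W] consists of the weighted term [N] in [|G'|^2], a multiple of
   [E], which has zero angular mean, and the nonnegative [U], to be dropped. *)
pose B r t : R[i] := circ r t * G' (circ r t) * conjc (G (circ r t)).
pose W r t : R := complex.Re ((2 * (rho ^+ 2 - r ^+ 2))%:C * B r t +
  (2 * r ^+ 2)%:C * (G (circ r t) * conjc (G (circ r t)))).
pose E r t : R := complex.Re (expi t * (G' (circ r t) + circ r t * G'' (circ r t)) * conjc (G (circ r t)))
   - r * modc (G' (circ r t)) ^+ 2.
pose N r t : R := 4 * (r * (rho ^+ 2 - r ^+ 2) * modc (G' (circ r t)) ^+ 2).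
pose U r t : R := 4 * r * modc (G (circ r t)) ^+ 2.
pose V r t : R := N r t + 2 * (rho ^+ 2 - r ^+ 2) * E r t + U r t.
have dW r t : 0 <= r <= rho -> is_derive r (1 : R) (W ^~ t) (V r t).
  move=> hr; have z1 := m1 r t hr.
  have g0 := cder_chain (gam := circ^~ t) (dG _ z1) (cder_ray r t).
  have g1 := cder_chain (gam := circ^~ t) (dG' _ z1) (cder_ray r t).
  have g2 := cderM (cderM (cder_ray r t) g1) (cder_conj g0).
  have p1 : is_derive r (1 : R) (fun r => 2 * (rho ^+ 2 - r ^+ 2)) (- 4 * r).
    by apply: is_derive_eq; rewrite /GRing.scale /=; ring.
  have p2 : is_derive r (1 : R) (fun r => 2 * r ^+ 2) (4 * r).
    by apply: is_derive_eq; rewrite /GRing.scale /=; ring.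
  have [h _] := cderD (cderM (cder_real p1) g2) (cderM (cder_real p2) (cderM g0 (cder_conj g0))).
  move: h; congr (is_derive _ _ _ _).
  rewrite /V /N /E /U !sqr_modc /circ.
  have : complex.Re (expi t) ^+ 2 + complex.Im (expi t) ^+ 2 = 1 :> R by rewrite -sqr_modc modc_expi expr1n.
  move: (expi t) (G _) (G' _) (G'' _) => [e1 e2] [x y] [x' y'] [x'' y''] /= e12.
  apply/eqP; rewrite -subr_eq0; apply/eqP.
  transitivity (2 * (rho ^+ 2 - r ^+ 2) * r * (x' ^+ 2 + y' ^+ 2) * (e1 ^+ 2 + e2 ^+ 2 - 1)).
    by ring.
  by rewrite e12 subrr mulr0.
have cz r t : contC (fun q : R * R => circ q.1 q.2) (r, t) by rewrite /circ; conttac.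
have cH (H : C -> C) r t : holo H -> 0 <= r <= rho ->
    contC (fun q : R * R => H (circ q.1 q.2)) (r, t).
  by move=> hH hr; apply: contC_holo => //; exact: (m1 r t hr).
have cE r t : 0 <= r <= rho -> contR (fun q : R * R => E q.1 q.2) (r, t).
  move=> hr; have [h0 h1 h2] := And3 (cH _ r t hG hr) (cH _ r t hG' hr) (cH _ r t hG'' hr).
  by rewrite /E; conttac; [exact: h1|exact: cz|exact: h2|exact: h0|exact: h1].
have cN r t : 0 <= r <= rho -> contR (fun q : R * R => N q.1 q.2) (r, t).
  by move=> hr; have h1 := cH _ r t hG' hr; rewrite /N; conttac; exact: h1.
have cU r t : 0 <= r <= rho -> contR (fun q : R * R => U q.1 q.2) (r, t).
  by move=> hr; have h1 := cH _ r t hG hr; rewrite /U; conttac; exact: h1.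
have cV r t : 0 <= r <= rho -> contR (fun q : R * R => V q.1 q.2) (r, t).
  move=> hr; rewrite /V; conttac; [exact: cN|exact: cE|exact: cU].
have to2 (F : R -> R -> R) : (forall r t, 0 <= r <= rho -> contR (fun q : R * R => F q.1 q.2) (r, t)) ->
    cts2 0 rho 0 (2 * pi) (fun q => F q.1 q.2).
  by move=> h; apply: cts2_pt => [||r t hr _]; [exact: ltW|exact: p0|exact: h].
have to1 (F : R -> R -> R) : (forall r t, 0 <= r <= rho -> contR (fun q : R * R => F q.1 q.2) (r, t)) ->
    forall r, 0 <= r <= rho -> cts 0 (2 * pi) (F r).
  by move=> /to2 h r hr; exact: (cts2_sec2 h hr).
(* For [r != 0], [r * E r] is the angular derivative of the periodic function [Im (B r)]. At
   [r = 0], [E] is the real part of a constant times [expi t]. *)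
have E0 r : 0 <= r <= rho -> RI 0 (2 * pi) (E r) = 0.
  move=> hr; have [rr|rn] := eqVneq r 0.
    rewrite (RI_eq (g := fun t => complex.Re (G' 0 * conjc (G 0) * circ 1 t))); last first.
      move=> t _; rewrite /E rr (_ : circ 0 t = 0) ?mul0r ?addr0 ?subr0; last first.
        by rewrite /circ rmorph0 mul0r.
      by congr complex.Re; rewrite expi_circ1; ring.
    have c1 : ccts 0 (2 * pi) (fun t => circ 1 t).
      by apply: ccts_pt => [|t _]; [exact: p0|exact: circ_continuous].
    by rewrite -Re_CI CIZ// CI_circ mulr0.
  have h : RI 0 (2 * pi) (fun t => r * E r t) = complex.Im (B r (2 * pi)) - complex.Im (B r 0).
    have ftc := @RI_FTC R 0 (2 * pi) (fun t => complex.Im (B r t)) (fun t => r * E r t) p0.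
    apply ftc.
      by apply: ctsM; [exact: cts_cst|exact: (to1 E)].
    move=> t _; have z1 := m1 r t hr.
    have g0 := cder_chain (dG _ z1) (cder_circ r t).
    have g1 := cder_chain (dG' _ z1) (cder_circ r t).
    have [_] := cderM (cderM (cder_circ r t) g1) (cder_conj g0).
    congr (is_derive _ _ _ _); rewrite /E !sqr_modc /circ.
    have : complex.Re (expi t) ^+ 2 + complex.Im (expi t) ^+ 2 = 1 :> R.
      by rewrite -sqr_modc modc_expi expr1n.
    move: (expi t) (G _) (G' _) (G'' _) => [e1 e2] [x y] [x' y'] [x'' y''] /= e12.
    apply/eqP; rewrite -subr_eq0; apply/eqP.
    transitivity (r ^+ 2 * (x' ^+ 2 + y' ^+ 2) * (1 - (e1 ^+ 2 + e2 ^+ 2))).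
      by ring.
    by rewrite e12 subrr mulr0.
  move: h; rewrite /B circ2pi subrr RIZ; last exact: (to1 E).
  by move=> /eqP; rewrite mulf_eq0 (negbTE rn) => /eqP.
have rr0 : 0 <= rho <= rho by rewrite lexx ltW.
(* At [r = rho] the weight kills [B] and only the [|G|^2] term of [W] remains; at [r = 0] all of [W]
   vanishes. *)
have FT t : 0 <= t <= 2 * pi ->
    RI 0 rho (V ^~ t) = 2 * rho ^+ 2 * modc (G (circ rho t)) ^+ 2.
  move=> ht; have ftc := @RI_FTC R 0 rho (W ^~ t) (V ^~ t) (ltW r0)
    (cts2_sec1 (to2 _ cV) ht) (fun r hr => dW r t hr).
  rewrite ftc /W /B !mul_conj subrr mulr0 [circ 0 t]/circ !rmorph0 !mul0r.
  by rewrite expr0n /= !mulr0 !mul0r !subr0 !addr0 ?add0r ?subr0.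
have sw := RI_swap (ltW r0) p0 (to2 _ cV).
have c2 : cts 0 (2 * pi) (fun t => modc (G (circ rho t)) ^+ 2).
  apply: cts_pt => [|t _]; first exact: p0.
  apply: contRE; apply: contR_X; apply: contR_modc.
  exact: (contC_holo hG (m1 rho t rr0) (@contC_circ rho t)).
have e1 : RI 0 rho (fun r => RI 0 (2 * pi) (V r)) =
    2 * rho ^+ 2 * RI 0 (2 * pi) (fun t => modc (G (circ rho t)) ^+ 2).
  by rewrite -(RIZ _ c2); etransitivity; [exact: sw|apply: RI_eq => t ht; exact: FT].
have e2 : RI 0 rho (fun r => RI 0 (2 * pi) (N r)) <= RI 0 rho (fun r => RI 0 (2 * pi) (V r)).
  apply: RI_le; [exact: (RI_param_cts (ltW r0) p0 (to2 _ cN))|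
    exact: (RI_param_cts (ltW r0) p0 (to2 _ cV))|].
  move=> r hr; have [h1 h2 h3] := And3 (to1 _ cN r hr) (to1 _ cU r hr) (to1 _ cE r hr).
  have h4 : cts 0 (2 * pi) (fun t => 2 * (rho ^+ 2 - r ^+ 2) * E r t).
    exact: (ctsM (@cts_cst R 0 (2 * pi) (2 * (rho ^+ 2 - r ^+ 2))) h3).
  rewrite /V (RID (ctsD h1 h4) h2) (RID h1 h4) (RIZ _ h3) (E0 r hr) mulr0 addr0 lerDl.
  apply: RI_ge0 => t _.
  apply: mulr_ge0; last exact: sqr_ge0.
  by apply: mulr_ge0; [exact: ler0n|case/andP: hr].
have e3 : RI 0 rho (fun r => RI 0 (2 * pi) (N r)) = 4 * RI 0 rho (fun r => RI 0 (2 * pi)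
     (fun t => r * (rho ^+ 2 - r ^+ 2) * modc (G' (circ r t)) ^+ 2)).
  pose M r t := r * (rho ^+ 2 - r ^+ 2) * modc (G' (circ r t)) ^+ 2.
  have cM r t : 0 <= r <= rho -> contR (fun q : R * R => M q.1 q.2) (r, t).
    by move=> hr; have h1 := cH _ r t hG' hr; rewrite /M; conttac; exact: h1.
  rewrite -RIZ; last exact: (RI_param_cts (ltW r0) p0 (to2 _ cM)).
  by apply: RI_eq => r hr; rewrite -(RIZ _ (to1 _ cM r hr)).
move: e2; rewrite e1 e3 -mulrA; clear; move: (RI 0 rho _) (rho ^+ 2 * RI _ _ _) => X Y; lra.
Qed.

End HoloEstimates.

(** * Polar coordinates *)

Section Polar.
Context {R : realType}.
Notation mu := (@lebesgue_measure R).
Implicit Types (F : R * R -> R) (x y r t rho : R).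

Lemma contR_comp2 (T : topologicalType) F (u v : T -> R) (s : T) : continuous F ->
  contR u s -> contR v s -> contR (fun s => F (u s, v s)) s.
Proof.
move=> cF cu cv; apply: (@continuous_comp _ _ _ (fun s => (u s, v s)) F); last exact: cF.
by apply: pair_continuous.
Qed.

Lemma contR_cos (T : topologicalType) (u : T -> R) (s : T) :
  contR u s -> contR (fun s => cos (u s)) s.
Proof. by move=> cu; apply: (continuous_comp cu); exact: continuous_cos. Qed.

Lemma contR_sin (T : topologicalType) (u : T -> R) (s : T) :
  contR u s -> contR (fun s => sin (u s)) s.
Proof. by move=> cu; apply: (continuous_comp cu); exact: continuous_sin. Qed.

Lemma contR_tan (T : topologicalType) (u : T -> R) (s : T) : cos (u s) != 0 ->
  contR u s -> contR (fun s => tan (u s)) s.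
Proof. by move=> cs cu; apply: (continuous_comp cu); exact: continuous_tan. Qed.

Lemma contR_V (T : topologicalType) (u : T -> R) (s : T) : u s != 0 ->
  contR u s -> contR (fun s => (u s)^-1) s.
Proof. by move=> us; exact: cvgV. Qed.

Lemma contR_cts (a b : R) (f : R -> R) : a <= b -> (forall x, a <= x <= b -> contR f x) ->
  cts a b f.
Proof. exact: cts_pt. Qed.

Lemma contR_cts2 (a b c d : R) F : a <= b -> c <= d ->
  (forall x y, a <= x <= b -> c <= y <= d -> contR F (x, y)) -> cts2 a b c d F.
Proof. exact: cts2_pt. Qed.

Section Quadrant.
Variables (F : R * R -> R) (rho : R).
Hypotheses (rho0 : 0 < rho) (cF : continuous F) (F0 : forall p, 0 <= F p).
Hypothesis (Fz : forall x y, rho ^+ 2 <= x ^+ 2 + y ^+ 2 -> F (x, y) = 0).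

Let g x := RI 0 rho (fun y => F (x, y)).
Let G t := RI 0 rho (fun r => r * F (r * cos t, r * sin t)).

Let cg : cts 0 rho g.
Proof.
apply: RI_param_cts; [exact: ltW|exact: ltW|].
by apply: contR_cts2 => [||x y _ _]; [exact: ltW|exact: ltW|exact: cF].
Qed.

Let cG (b : R) : 0 <= b -> cts 0 b G.
Proof.
move=> b0; apply: (@RI_param_cts _ 0 b 0 rho
   (fun q : R * R => q.2 * F (q.2 * cos q.1, q.2 * sin q.1))) => //; first exact: ltW.
apply: contR_cts2; [exact: b0|exact: ltW|move=> x y _ _].
apply: contR_M; first exact: contR_snd.
apply: contR_comp2 => //; apply: contR_M; try exact: contR_snd.
  by apply: contR_cos; exact: contR_fst.
by apply: contR_sin; exact: contR_fst.
Qed.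

Let cFx x a b : a <= b -> cts a b (fun y => F (x, y)).
Proof.
move=> ab; apply: contR_cts => // y _.
by apply: contR_comp2; [exact: cF|exact: contR_cst|exact: contR_id].
Qed.

Let g0 x : 0 <= g x.
Proof. by apply: RI_ge0 => y _. Qed.

Let G0 t : 0 <= G t.
Proof. by apply: RI_ge0 => r /andP[r0 _]; rewrite mulr_ge0. Qed.

Section Angle.
Variable th : R.
Hypotheses (th0 : 0 <= th) (thp : th < pi / 2).

Let h x := RI 0 (x * tan th) (fun y => F (x, y)).

Let cos_gt0 t : 0 <= t <= th -> 0 < cos t.
Proof.
move=> /andP[t0 tth]; apply: cos_gt0_pihalf; rewrite (le_lt_trans tth thp) andbT.
by rewrite (lt_le_trans _ t0)// oppr_lt0 divr_gt0// pi_gt0.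
Qed.

Let tan_mono t : 0 <= t <= th -> 0 <= tan t <= tan th.
Proof.
move=> /andP[t0 tth].
have pp : 0 < pi / 2 :> R by rewrite divr_gt0// pi_gt0.
have i0 : - (pi / 2) < 0 :> R by rewrite oppr_lt0.
have mono u v : 0 <= u -> u <= v -> v <= th -> tan u <= tan v.
  move=> u0; rewrite le_eqVlt => /predU1P[->//|uv] vth; apply: ltW.
  have inI z : 0 <= z -> z <= th -> z \in `](- (pi / 2)), (pi / 2)[.
    by move=> z0 zth; rewrite in_itv/= (lt_le_trans i0 z0) (le_lt_trans zth thp).
  by rewrite ltr_tan//; apply: inI => //; [exact: le_trans (ltW uv) vth|exact: le_trans u0 (ltW uv)].
by rewrite -[X in X <= tan t <= _]tan0 !mono.
Qed.

Let tan_ge0 : 0 <= tan th.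
Proof. by have /andP[] : 0 <= tan th <= tan th; [apply: tan_mono; rewrite th0 lexx|]. Qed.

Let hE x : 0 <= x -> h x = RI 0 th (fun t => F (x, x * tan t) * (x * (cos t) ^- 2)).
Proof.
move=> x0; rewrite /h.
have := @RI_subst _ 0 th (fun t => x * tan t) (fun t => x * (cos t) ^- 2) (fun y => F (x, y)) th0.
rewrite tan0 mulr0; apply.
- move=> t /cos_gt0 ct.
  have dt := is_derive_tan (lt0r_neq0 ct).
  by apply: is_derive_eq.
- apply: contR_cts => // t /cos_gt0 ct; apply: contR_M; first exact: contR_cst.
  apply: contR_V; first by rewrite expf_neq0// gt_eqF.
  by apply: contR_X; apply: contR_cos; exact: contR_id.
- by move=> t /tan_mono/andP[h1 h2]; rewrite mulr_ge0//= ler_wpM2l.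
- by apply: cFx; rewrite mulr_ge0.
Qed.

Let ck : cts2 0 rho 0 th (fun q => F (q.1, q.1 * tan q.2) * (q.1 * (cos q.2) ^- 2)).
Proof.
apply: contR_cts2; [exact: ltW|exact: th0|move=> x t _ /cos_gt0 ct].
have c0 : cos t != 0 by rewrite gt_eqF.
have f1 : contR (fun s : R * R => s.1) (x, t) by exact: contR_fst.
have f2 : contR (fun s : R * R => s.2) (x, t) by exact: contR_snd.
apply: contR_M; first by apply: contR_comp2 => //; apply: contR_M => //; exact: contR_tan.
apply: contR_M => //; apply: contR_V; first by rewrite /= expf_neq0.
by apply: contR_X; exact: contR_cos.
Qed.

Let ch : cts 0 rho h.
Proof.
apply: (@cts_eq _ 0 rho (fun x => RI 0 th (fun t => F (x, x * tan t) * (x * (cos t) ^- 2)))).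
- exact: ltW.
- by move=> x /andP[x0 _]; rewrite hE.
- exact: (RI_param_cts (ltW rho0) th0 ck).
Qed.

(** The substitution [y = x * tan t] for fixed [x], Fubini, then [x = r * cos t] for fixed [t]: two
    one-variable changes produce the Jacobian [r]. The function [h] integrates over the part of a
    column below the ray of angle [th], which stays under [pi / 2] to keep [tan] finite. *)
Let sector_polar : RI 0 rho h = RI 0 th G.
Proof.
transitivity (RI 0 rho (fun x => RI 0 th (fun t => F (x, x * tan t) * (x * (cos t) ^- 2)))).
  by apply: RI_eq => x /andP[x0 _]; exact: hE.
rewrite (RI_swap (ltW rho0) th0 ck); apply: RI_eq => t ht; have ct := cos_gt0 ht.
have c0 : cos t != 0 by rewrite gt_eqF.
have rc : rho <= rho / cos t.
  by rewrite ler_pdivlMr// -[leRHS]mulr1 ler_wpM2l ?cos_le1 ?(ltW rho0).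
have r0c : 0 <= rho / cos t by rewrite (le_trans _ rc)// ltW.
have cc a b : a <= b -> cts a b (fun r => r * F (r * cos t, r * sin t)).
  move=> ab; apply: contR_cts => // r _; have cid := @contR_id R r.
  by apply: contR_M => //; apply: contR_comp2 => //; apply: contR_M => //; exact: contR_cst.
(* The range [x <= rho] becomes [r <= rho / cos t]; beyond [r = rho] the function [F] vanishes. *)
transitivity (RI 0 (rho / cos t) (fun r => r * F (r * cos t, r * sin t))).
  have := @RI_subst _ 0 (rho / cos t) (fun r => r * cos t) (fun=> cos t)
    (fun x => F (x, x * tan t) * (x * (cos t) ^- 2)) r0c.
  rewrite mul0r divfK// => sub; etransitivity; first apply: sub => //.
  - by move=> r _; apply: is_derive_eq; rewrite /GRing.scale /= mulr0 add0r mulr1.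
  - exact: cts_cst.
  - by move=> r /andP[r0 r1]; rewrite (mulr_ge0 r0 (ltW ct)) /= -ler_pdivlMr.
  - have := @cts2_sec1 _ 0 rho 0 th _ t ck; apply; exact: ht.
  - apply: RI_eq => r _; rewrite /tan; have -> : r * cos t * (sin t / cos t) = r * sin t by field.
    by rewrite mulrAC [RHS]mulrC; field.
rewrite (RI_split (ltW rho0) rc (cc _ _ r0c)) -[RHS]addr0; congr (_ + _).
rewrite -[RHS](mul0r (rho / cos t - rho)) -RI_cst//; apply: RI_eq => r /andP[r1 _].
rewrite Fz ?mulr0// !exprMn -mulrDr cos2Dsin2 mulr1.
by rewrite lerXn2r ?nnegrE ?(ltW rho0)// (le_trans (ltW rho0) r1).
Qed.

Let h_le x : 0 <= x -> h x <= g x /\ (rho <= x * tan th -> h x = g x).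
Proof.
move=> x0; rewrite /h /g.
have xt : 0 <= x * tan th by rewrite mulr_ge0.
have pos a b : a <= b -> 0 <= RI a b (fun y => F (x, y)) by move=> _; exact: RI_ge0.
have eq1 : rho <= x * tan th -> RI 0 (x * tan th) (fun y => F (x, y)) = RI 0 rho (fun y => F (x, y)).
  move=> rx; rewrite (RI_split (ltW rho0) rx (cFx xt)) -[RHS]addr0; congr (_ + _).
  rewrite -[RHS](mul0r (x * tan th - rho)) -RI_cst//; apply: RI_eq => y /andP[y1 _].
  rewrite Fz// (le_trans (y := y ^+ 2))// ?lerDr ?sqr_ge0//.
  by rewrite lerXn2r ?nnegrE ?(ltW rho0)// (le_trans (ltW rho0) y1).
split => //; have [rx|/ltW rx] := leP rho (x * tan th); first by rewrite eq1.
rewrite (RI_split xt rx (cFx (ltW rho0))) lerDl; exact: pos.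
Qed.

Lemma sector_lower : RI 0 th G <= RI 0 rho g.
Proof.
rewrite -sector_polar; apply: RI_le; [exact: ch|exact: cg|].
by move=> x /andP[x0 _]; exact: (h_le x0).1.
Qed.

(** A column over [x >= rho / tan th] meets the ray only above the support of [F], so nothing of it
    is lost; the remaining columns form a strip of width [rho / tan th]. *)
Lemma sector_upper M : 1 <= tan th -> (forall x, 0 <= x <= rho -> g x <= M) ->
  RI 0 rho g <= RI 0 th G + M * (rho / tan th).
Proof.
move=> th1 gM; pose s := rho / tan th.
have t0 : 0 < tan th by exact: lt_le_trans th1.
have s0 : 0 <= s by rewrite divr_ge0// ltW.
have sr : s <= rho by rewrite ler_pdivrMr// -[leLHS]mulr1 ler_wpM2l// ltW.
rewrite (RI_split s0 sr cg) addrC lerD//.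
  rewrite -sector_polar (RI_split s0 sr ch).
  rewrite (_ : RI s rho g = RI s rho h); last first.
    apply: RI_eq => x /andP[sx _]; have x0 := le_trans s0 sx.
    by rewrite (h_le x0).2// -ler_pdivrMr.
  by rewrite lerDr; apply: RI_ge0 => x _; apply: RI_ge0.
rewrite -[rho / _]subr0 -RI_cst//; apply: RI_le.
- by apply: ctsS cg.
- exact: cts_cst.
- by move=> x /andP[x0 xs]; apply: gM; rewrite x0 (le_trans xs).
Qed.

End Angle.

(** Limit of the two sector estimates as the angle [atan K] tends to [pi / 2]: one inequality loses
    a thin vertical strip, the other a thin angular sector. *)
Lemma quadrant_polar : RI 0 rho g = RI 0 (pi / 2) G.
Proof.
have pp : 0 < pi / 2 :> R by rewrite divr_gt0// pi_gt0.
have [M hM] := cts_bounded (ltW rho0) cg.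
have [M' hM'] := cts_bounded (ltW pp) (cG (ltW pp)).
have gM x : 0 <= x <= rho -> g x <= M by move=> /hM; apply: le_trans; exact: ler_norm.
have GM t : 0 <= t <= pi / 2 -> G t <= M' by move=> /hM'; apply: le_trans; exact: ler_norm.
have M0 : 0 <= M by apply: le_trans (g0 0) (gM _ _); rewrite lexx ltW.
have M0' : 0 <= M' by apply: le_trans (G0 0) (GM _ _); rewrite lexx ltW.
have split_G th : 0 <= th -> th < pi / 2 ->
    RI 0 (pi / 2) G = RI 0 th G + RI th (pi / 2) G.
  by move=> t0 t1; apply: RI_split; [exact: t0|exact: ltW|apply: cG; exact: ltW].
have atan_ok (K : R) : 1 <= K -> 0 <= atan K /\ atan K < pi / 2.
  move=> K1; split; last exact: atan_ltpi2.
  by rewrite -atan0 le_atan// (le_trans _ K1).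
apply/eqP; rewrite eq_le; apply/andP; split; apply/ler_addgt0Pr => e e0.
(* With this slope the strip contributes at most [M * rho / K <= e], and [K >= 1] as [sector_upper]
   asks. *)
- pose K := 1 + M * rho / e.
  have K1 : 1 <= K by rewrite lerDl divr_ge0 ?mulr_ge0// ltW.
  have [a0 a1] := atan_ok K K1.
  have tK : tan (atan K) = K by rewrite atanK.
  have := sector_upper a0 a1 (M := M); rewrite tK => /(_ K1 gM) /le_trans; apply.
  rewrite lerD//.
    rewrite (split_G _ a0 a1) lerDl; apply: RI_ge0 => t _; exact: G0.
  rewrite mulrA ler_pdivrMr ?(lt_le_trans ltr01 K1)// /K mulrDr mulr1.
  by rewrite [e * _]mulrC divfK ?gt_eqF// lerDr ltW.
- have [K K1 hK] : exists2 K : R, 1 <= K & pi / 2 - atan K < e / (M' + 1).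
    have eM : 0 < e / (M' + 1) by rewrite divr_gt0// ltr_wpDl.
    have /cvgrPdist_lt/(_ _ eM)[A [_ hA]] := @cvgy_atan R.
    exists (Num.max 1 (A + 1)); first by rewrite le_max lexx.
    apply: le_lt_trans (ler_norm _) (hA _ _).
    by rewrite lt_max ltrDl ltr01 orbT.
  have [a0 a1] := atan_ok K K1.
  rewrite (split_G _ a0 a1) lerD//; first exact: sector_lower.
  have : RI (atan K) (pi / 2) G <= M' * (pi / 2 - atan K).
    rewrite -(RI_cst _ (ltW a1)); apply: RI_le; [|exact: cts_cst|].
      exact: (ctsS a0 (ltW a1) (lexx _) (cG (ltW pp))).
    by move=> t /andP[t0 t1]; apply: GM; rewrite t1 (le_trans a0).
  move=> /le_trans; apply.
  move: hK; rewrite ltr_pdivlMr ?ltr_wpDl// => hK.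
  have h : 0 <= pi / 2 - atan K by rewrite subr_ge0 ltW.
  nra.
Qed.

End Quadrant.

End Polar.

(** * Polar coordinates in the plane about an arbitrary centre *)

Section PlanePolar.
Context {R : realType}.
Notation mu := (@lebesgue_measure R).
Implicit Types (F : R * R -> R) (f : R -> R) (a b c x y r t rho : R).

Lemma RI_shift a b c f : a <= b -> (forall x, contR f x) ->
  RI (c + a) (c + b) f = RI a b (fun t => f (c + t)).
Proof.
move=> ab cf; have cab : c + a <= c + b by rewrite lerD2l.
have sub := @RI_subst _ a b (fun t => c + t) (fun=> 1) f ab.
etransitivity; first apply: sub.
- by move=> x _; apply: is_derive_eq; ring.
- exact: cts_cst.
- by move=> x /andP[h1 h2]; rewrite !lerD2l h1.
- by apply: contR_cts => // x _; exact: cf.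
- by apply: RI_eq => x _; rewrite mulr1.
Qed.

Lemma RI_reflect a b c f : a <= b -> (forall x, contR f x) ->
  RI (c - b) (c - a) f = RI a b (fun t => f (c - t)).
Proof.
move=> ab cf; have cab : c - b <= c - a by rewrite lerD2l lerN2.
have sub := @RI_substN _ a b (fun t => c - t) (fun=> -1) f ab.
have cft : cts a b (fun t => f (c - t)).
  apply: contR_cts => // x _; have cs : contR (fun t => c - t) x by conttac.
  exact: (continuous_comp cs (cf _)).
etransitivity; first apply: sub.
- by move=> x _; apply: is_derive_eq; ring.
- exact: cts_cst.
- by move=> x /andP[h1 h2]; rewrite !lerD2l !lerN2 h1 h2.
- by apply: contR_cts => // x _; exact: cf.
- rewrite -[LHS]mulN1r -RIZ; last exact: (ctsM cft (@cts_cst _ a b (-1))).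
  by apply: RI_eq => x _; ring.
Qed.

Lemma cts_contR a b f x : a < x < b -> cts a b f -> contR f x.
Proof.
move=> /andP[ax xb] cf; have e : clamp a b x = x by rewrite clamp_id// !ltW.
have := cf x; rewrite /continuous_at /= e; apply: cvg_trans; apply: near_eq_cvg.
near=> y; rewrite /= clamp_id//; apply/andP; split; apply: ltW.
- by near: y; exact: lt_nbhsr.
- by near: y; exact: lt_nbhsl.
Unshelve. all: by end_near. Qed.

Lemma integral_supp a b f : (forall y, ~~ (a <= y <= b) -> f y = 0) -> cts a b f ->
  (\int[mu]_y (f y)%:E = (RI a b f)%:E)%E.
Proof.
move=> f0 cf; rewrite -RI_fin// [RHS]integral_mkcond; apply: eq_integral => y _.
rewrite patchE; case: ifPn => //; rewrite notin_setE /= in_itv /= => /negP h.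
by rewrite f0.
Qed.

Lemma contR_pair1 F x y : continuous F -> contR (fun y => F (x, y)) y.
Proof. by move=> cF; apply: contR_comp2; [exact: cF|exact: contR_cst|exact: contR_id]. Qed.

Lemma cts2_continuous F a b c d : a <= b -> c <= d -> continuous F -> cts2 a b c d F.
Proof. by move=> ab cd cF; apply: contR_cts2 => // x y _ _; exact: cF. Qed.

Lemma plane_iterated F a1 a2 rho : 0 < rho -> continuous F -> (forall p, 0 <= F p) ->
  (forall x y, rho ^+ 2 <= (x - a1) ^+ 2 + (y - a2) ^+ 2 -> F (x, y) = 0) ->
  (\int[(mu \x mu)%E]_p (F p)%:E = (RI (a1 - rho) (a1 + rho)
     (fun x => RI (a2 - rho) (a2 + rho) (fun y => F (x, y))))%:E)%E.
Proof.
move=> r0 cF F0 Fz.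
have ab c : c - rho <= c + rho by lra.
have out u : ~~ (- rho <= u <= rho) -> rho ^+ 2 <= u ^+ 2.
  rewrite -ler_norml -ltNge => h; rewrite -[leRHS]real_normK ?num_real//.
  by rewrite lerXn2r ?nnegrE ?(ltW r0) ?(ltW h).
have mF : measurable_fun setT (fun p : R * R => (F p)%:E).
  by apply/measurable_EFinP; exact: continuous2_measurable.
have E0 (p : R * R) : (0 <= (F p)%:E)%E by rewrite lee_fin.
have ft := fubini_tonelli1 (m1 := mu) (m2 := mu) (fun p : R * R => (F p)%:E) mF E0.
etransitivity; first exact: ft.
rewrite -integral_supp.
- apply: eq_integral => x _; rewrite /fubini_F -integral_supp//.
    move=> y hy; apply: Fz; rewrite (le_trans (out (y - a2) _))// ?lerDr ?sqr_ge0//.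
    by apply: contra hy => /andP[h1 h2]; apply/andP; split; lra.
  by apply: contR_cts => // y _; exact: contR_pair1.
- move=> x hx; rewrite -[RHS](mul0r (a2 + rho - (a2 - rho))) -RI_cst//.
  apply: RI_eq => y _; apply: Fz; rewrite (le_trans (out (x - a1) _))// ?lerDl ?sqr_ge0//.
  by apply: contra hx => /andP[h1 h2]; apply/andP; split; lra.
- exact: (RI_param_cts (ab _) (ab _) (cts2_continuous (ab _) (ab _) cF)).
Qed.

Lemma RI_even_odd f rho : 0 <= rho -> (forall x, contR f x) ->
  RI (- rho) rho f = RI 0 rho f + RI 0 rho (fun x => f (- x)).
Proof.
move=> r0 cf; have r1 : - rho <= 0 by rewrite oppr_le0.
rewrite (RI_split r1 r0); last by apply: contR_cts => [|x _]; [exact: le_trans r1 r0|exact: cf].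
rewrite addrC; congr (_ + _); have := RI_reflect 0 r0 cf; rewrite subr0 sub0r => ->.
by apply: RI_eq => x _; rewrite sub0r.
Qed.

Lemma plane_polar F a1 a2 rho : 0 < rho -> continuous F -> (forall p, 0 <= F p) ->
  (forall x y, rho ^+ 2 <= (x - a1) ^+ 2 + (y - a2) ^+ 2 -> F (x, y) = 0) ->
  (\int[(mu \x mu)%E]_p (F p)%:E = (RI 0 (2 * pi) (fun t => RI 0 rho
     (fun r => r * F (a1 + r * cos t, a2 + r * sin t))))%:E)%E.
Proof.
move=> r0 cF F0 Fz; rewrite (plane_iterated r0 cF F0 Fz); congr EFin.
have nr : - rho <= rho by lra.
have rhoge := ltW r0.
(* [H s1 s2] folds the quadrant with signs [s1], [s2] about the centre onto the first quadrant; the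
   four quadrants match the four quarters of the angular interval. *)
pose H (s1 s2 : R) (p : R * R) := F (a1 + s1 * p.1, a2 + s2 * p.2).
have cH s1 s2 : continuous (H s1 s2).
  move=> p; apply: (@contR_comp2 _ _ _ (fun p : R * R => a1 + s1 * p.1) (fun p : R * R => a2 + s2 * p.2)) => //.
    by conttac.
  by conttac.
pose K s1 s2 x := RI 0 rho (fun y => H s1 s2 (x, y)).
have cK s1 s2 : cts 0 rho (K s1 s2).
  exact: (RI_param_cts rhoge rhoge (cts2_continuous rhoge rhoge (cH s1 s2))).
have cF1 x y : contR (fun y => F (x, y)) y by exact: contR_pair1.
have cRI x : contR (fun x => RI (a2 - rho) (a2 + rho) (fun y => F (x, y))) x.
  have ab : x - 1 <= x + 1 by lra.
  have cd : a2 - rho <= a2 + rho by lra.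
  apply: (@cts_contR (x - 1) (x + 1)); first by apply/andP; split; lra.
  exact: (RI_param_cts ab cd (cts2_continuous ab cd cF)).
have e1 x : RI (a2 - rho) (a2 + rho) (fun y => F (x, y)) =
    RI 0 rho (fun y => F (x, a2 + 1 * y)) + RI 0 rho (fun y => F (x, a2 + (-1) * y)).
  rewrite (RI_shift a2 nr (cF1 x)) RI_even_odd//.
    by congr (_ + _); apply: RI_eq => y _; rewrite ?mul1r ?mulN1r.
  move=> y; apply: contR_comp2 => //; conttac.
transitivity (RI 0 rho (K 1 1) + RI 0 rho (K 1 (-1)) + (RI 0 rho (K (-1) 1) + RI 0 rho (K (-1) (-1)))).
  rewrite (RI_shift a1 nr cRI) RI_even_odd//; last first.
    move=> x; have cs : contR (fun t => a1 + t) x by conttac.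
    exact: (continuous_comp cs (cRI _)).
  by congr (_ + _); rewrite -RID; [apply: RI_eq => x _; rewrite e1; congr (_ + _);
     apply: RI_eq => y _; rewrite /H /= ?mul1r ?mulN1r|exact: cK|exact: cK|
     apply: RI_eq => x _; rewrite e1; congr (_ + _);
     apply: RI_eq => y _; rewrite /H /= ?mul1r ?mulN1r|exact: cK|exact: cK].
pose G t := RI 0 rho (fun r => r * F (a1 + r * cos t, a2 + r * sin t)).
have Hz (s1 s2 : R) : s1 ^+ 2 = 1 -> s2 ^+ 2 = 1 -> forall x y,
   rho ^+ 2 <= x ^+ 2 + y ^+ 2 -> H s1 s2 (x, y) = 0.
  move=> h1 h2 x y h; apply: Fz => /=; have -> : a1 + s1 * x - a1 = s1 * x by ring.
  have -> : a2 + s2 * y - a2 = s2 * y by ring.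
  by rewrite !exprMn h1 h2 !mul1r.
have cG t : contR G t.
  have ab : t - 1 <= t + 1 by lra.
  apply: (@cts_contR (t - 1) (t + 1)); first by apply/andP; split; lra.
  apply: (@RI_param_cts _ (t - 1) (t + 1) 0 rho (fun q : R * R =>
     q.2 * F (a1 + q.2 * cos q.1, a2 + q.2 * sin q.1)) ab rhoge).
  apply: contR_cts2 => // x y _ _.
  have f1 : contR (fun s : R * R => s.1) (x, y) by exact: contR_fst.
  have f2 : contR (fun s : R * R => s.2) (x, y) by exact: contR_snd.
  apply: contR_M; first exact: f2.
  apply: contR_comp2; first exact: cF.
    apply: contR_D; first exact: contR_cst.
    by apply: contR_M; [exact: f2|apply: contR_cos; exact: f1].
  apply: contR_D; first exact: contR_cst.
  by apply: contR_M; [exact: f2|apply: contR_sin; exact: f1].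
have e2 (s1 s2 : R) : s1 ^+ 2 = 1 -> s2 ^+ 2 = 1 -> 
   RI 0 rho (K s1 s2) = RI 0 (pi / 2) (fun t => RI 0 rho (fun r => r * H s1 s2 (r * cos t, r * sin t))).
  by move=> h1 h2; exact: (quadrant_polar r0 (cH s1 s2) (fun p => F0 _) (Hz s1 s2 h1 h2)).
have one : (1 : R) ^+ 2 = 1 by rewrite expr1n.
have mone : (-1 : R) ^+ 2 = 1 by rewrite sqrrN expr1n.
have p0 : 0 < pi :> R := pi_gt0 R.
have h0 : 0 <= pi / 2 :> R by lra.
have cc (u v : R) : u <= v -> cts u v G by move=> uv; apply: contR_cts.
have i1 : pi <= 2 * pi :> R by lra.
have i2 : pi / 2 <= pi :> R by lra.
have i3 : pi <= pi + pi / 2 :> R by lra.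
have i4 : pi + pi / 2 <= 2 * pi :> R by lra.
rewrite (RI_split (ltW p0) i1 (cc _ _ (le_trans (ltW p0) i1))).
rewrite (RI_split h0 i2 (cc _ _ (ltW p0))) (RI_split i3 i4 (cc _ _ i1)).
have q2 : RI (pi / 2) pi G = RI 0 (pi / 2) (fun t => G (pi - t)).
  by have := RI_reflect pi h0 cG; rewrite subr0 (_ : pi - pi / 2 = pi / 2)//; field.
have q3 : RI pi (pi + pi / 2) G = RI 0 (pi / 2) (fun t => G (pi + t)).
  by have := RI_shift pi h0 cG; rewrite addr0.
have q4 : RI (pi + pi / 2) (2 * pi) G = RI 0 (pi / 2) (fun t => G (2 * pi - t)).
  by have := RI_reflect (2 * pi) h0 cG; rewrite subr0 (_ : 2 * pi - pi / 2 = pi + pi / 2)//; field.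
rewrite q2 q3 q4 (e2 _ _ one one) (e2 _ _ one mone) (e2 _ _ mone one) (e2 _ _ mone mone).
clear q2 q3 q4 e2 cRI cG cc e1 cK Hz.
have eG (u : R -> R) (s1 s2 : R) : (forall t, cos (u t) = s1 * cos t) ->
    (forall t, sin (u t) = s2 * sin t) ->
    RI 0 (pi / 2) (fun t => RI 0 rho (fun r => r * H s1 s2 (r * cos t, r * sin t))) =
    RI 0 (pi / 2) (fun t => G (u t)).
  move=> h1 h2; apply: RI_eq => t _; apply: RI_eq => r _.
  by rewrite h1 h2 /H /= !(mulrCA _ r).
rewrite (eG id 1 1); [|by move=> t; rewrite mul1r..].
have c2 : cos (2 * pi) = 1 :> R by rewrite mulr_natl cos2pi.
have s2 : sin (2 * pi) = 0 :> R by rewrite mulr_natl sin2pi.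
rewrite (eG (fun t => 2 * pi - t) 1 (-1)); last first.
- by move=> t; rewrite sinB c2 s2; ring.
- by move=> t; rewrite cosB c2 s2; ring.
rewrite (eG (fun t => pi - t) (-1) 1); last first.
- by move=> t; rewrite sinB cospi sinpi; ring.
- by move=> t; rewrite cosB cospi sinpi; ring.
rewrite (eG (fun t => pi + t) (-1) (-1)); last first.
- by move=> t; rewrite sinD cospi sinpi; ring.
- by move=> t; rewrite cosD cospi sinpi; ring.
have ac (A B C D : R) : A + B + (C + D) = A + C + (D + B) by ring.
exact: ac.
Qed.

End PlanePolar.

(** * The upper bound *)

Section PowR.
Context {R : realType}.
Implicit Types (x M q r t : R) (f : (R[i])^o -> (R[i])^o).

Lemma contR_powR (T : topologicalType) (u : T -> R) (s : T) q : 0 < q ->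
  (forall s, 0 <= u s) -> contR u s -> contR (fun s => u s `^ q) s.
Proof.
move=> q0 u0 cu; have [us|us] := eqVneq (u s) 0.
  apply/cvgrPdist_lt => e e0; rewrite us powR0 ?gt_eqF//.
  have e1 : 0 < e `^ q^-1 by rewrite powR_gt0.
  have := cu; move=> /cvgrPdist_lt/(_ _ e1); apply: filterS => y.
  rewrite us !sub0r !normrN !ger0_norm ?powR_ge0// => h.
  have -> : e = (e `^ q^-1) `^ q by rewrite -powRrM mulVf ?gt_eqF// powRr1// ltW.
  by rewrite gt0_ltr_powR// nnegrE// powR_ge0.
have up : 0 < u s by rewrite lt0r us u0.
have cl : contR (fun s => expR (q * ln (u s))) s.
  have c1 : contR (fun s => ln (u s)) s by apply: (continuous_comp cu); exact: continuous_ln.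
  have c2 : contR (fun s => q * ln (u s)) s by apply: contR_M => //; exact: contR_cst.
  by apply: (continuous_comp c2); exact: continuous_expR.
have e1 : u s `^ q = expR (q * ln (u s)) by rewrite /powR gt_eqF.
rewrite /contR /prop_for /continuous_at /= e1; apply: cvg_trans cl; apply: near_eq_cvg.
move: cu => /cvgrPdist_lt/(_ _ up); apply: filterS => y; rewrite ltr_norml => /andP[_ h].
have uy : 0 < u y by move: h; rewrite ltrBlDr ltrDl.
by rewrite /powR gt_eqF.
Qed.

(** Splitting at the level [M]: below it [x ^+ 2 <= M ^+ 2], above it [x ^+ 2] is [x] to the power
    [q] times [x] to the negative power [2 - q], which decreases. *)
Lemma sqr_le_powR x M q : 2 < q -> 0 < M -> 0 <= x ->
  x ^+ 2 <= M ^+ 2 + M `^ (2 - q) * x `^ q.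
Proof.
move=> q2 M0 x0; have [xM|Mx] := leP x M.
  by rewrite -[leLHS]addr0 lerD ?mulr_ge0 ?powR_ge0// lerXn2r ?nnegrE// ltW.
have xp : 0 < x by exact: lt_trans Mx.
rewrite -[leLHS]add0r lerD ?sqr_ge0//.
have -> : M `^ (2 - q) = (M `^ (q - 2))^-1 by rewrite -powRN opprB.
rewrite mulrC ler_pdivlMr ?powR_gt0//.
have -> : x `^ q = x ^+ 2 * x `^ (q - 2).
  rewrite -powR_mulrn// -powRD; last by apply/implyP => _; rewrite gt_eqF.
  by congr (_ `^ _); lra.
by rewrite ler_wpM2l ?sqr_ge0// ge0_ler_powR ?nnegrE ?(ltW M0)//; lra.
Qed.

End PowR.

(** * Circular means of the product of [f] and the kernel *)

Section Embedding.
Context {R : realType}.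
Notation C := ((R[i])^o).
Implicit Types (f : C -> C) (b : R[i]) (q r t l : R).

Lemma holo_contR_circ f r t : holo f -> 0 <= r -> r < 1 ->
  contR (fun t => modc (f (circ r t))) t.
Proof.
move=> hf r0 r1; apply: contR_modc.
have z1 : modc (circ r t) < 1 by rewrite modc_circ.
exact: (contC_holo hf z1 (@contC_circ R r t)).
Qed.

Lemma lam_of_gt0 (p : \bar R) : (2%:E < p)%E -> 0 < lam_of p.
Proof.
case: p => [q||]//=; rewrite lte_fin => q2.
by rewrite subr_gt0 ltr_pdivrMr ?mul1r//; lra.
Qed.

Lemma poisson_le b r : modc b < 1 -> 0 < r -> r < 1 ->
  RI 0 (2 * pi) (fun t => modc (ckernel b (circ r t)) ^+ 2) <= 2 * pi / (1 - modc b * r).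
Proof.
move=> b1 r0 r1; have := poisson_kernel b1 r0 r1; set I := RI _ _ _ => h.
have br1 : modc b * r < 1.
  by rewrite (le_lt_trans _ r1)// -[leRHS]mul1r ler_wpM2r ?ltW.
have br0 : 0 <= modc b * r by rewrite mulr_ge0 ?modc_ge0// ltW.
have I0 : 0 <= I by apply: RI_ge0 => t _; exact: sqr_ge0.
rewrite ler_pdivlMr ?subr_gt0// -h.
move: (modc b * r) br1 br0 => x x1 x0.
have : 0 <= I * (x * (1 - x)) by rewrite !mulr_ge0// subr_ge0 ltW.
clear; lra.
Qed.

Lemma circle_bound (p : \bar R) f b l r : (2%:E < p)%E -> holo f -> (Hp_norm p f <= 1)%E ->
  0 < l -> l <= 1 -> modc b = 1 - l -> 0 < r -> r < 1 ->
  RI 0 (2 * pi) (fun t => modc (f (circ r t)) ^+ 2 * modc (ckernel b (circ r t)) ^+ 2)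
   <= 2 * pi * (2 * l `^ (lam_of p - 1)) / (1 - modc b * r).
Proof.
move=> p2 hf hp l0 l1 bl r0 r1; have p0 := @pi2_ge0 R.
have b1 : modc b < 1 by rewrite bl; lra.
have hk := kernel_holo b1.
have r0' := ltW r0.
have br1 : modc b * r < 1.
  by rewrite (le_lt_trans _ r1)// -[leRHS]mul1r ler_wpM2r// ltW.
have dr : l <= 1 - modc b * r.
  by have := ler_wpM2l (modc_ge0 b) (ltW r1); rewrite mulr1 bl; lra.
have d0 : 0 < 1 - modc b * r by rewrite subr_gt0.
have cf t : contR (fun t => modc (f (circ r t)) ^+ 2) t.
  by apply: contR_X; exact: holo_contR_circ.
have ck t : contR (fun t => modc (ckernel b (circ r t)) ^+ 2) t.
  by apply: contR_X; exact: holo_contR_circ.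
have ctk : cts 0 (2 * pi) (fun t => modc (ckernel b (circ r t)) ^+ 2) by exact: contR_cts.
have ctf : cts 0 (2 * pi) (fun t => modc (f (circ r t)) ^+ 2) by exact: contR_cts.
have ctfk := ctsM ctf ctk.
have pk := poisson_le b1 r0 r1.
have z1 t : modc (circ r t) < 1 by rewrite modc_circ.
have kb t : modc (ckernel b (circ r t)) ^+ 2 <= (1 - modc b * r)^-1 ^+ 2.
  rewrite lerXn2r ?nnegrE ?modc_ge0 ?invr_ge0 ?(ltW d0)//.
  by have := modc_kernel_ge b1 (z1 t); rewrite modc_circ.
case: p p2 hp => [q| |//] p2 hp.
- rewrite lte_fin in p2.
  have q0 : 0 < q by lra.
  have cq t : contR (fun t => modc (f (circ r t)) `^ q) t.
    by apply: contR_powR => // [s|]; [exact: modc_ge0|exact: holo_contR_circ].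
  have ctq : cts 0 (2 * pi) (fun t => modc (f (circ r t)) `^ q) by exact: contR_cts.
  have hq : RI 0 (2 * pi) (fun t => modc (f (circ r t)) `^ q) <= 2 * pi.
    have p0' := @pi2_gt0 R.
    have I0 : 0 <= RI 0 (2 * pi) (fun t => modc (f (circ r t)) `^ q).
      by apply: RI_ge0 => t _; exact: powR_ge0.
    have hc : (circ_mean q f r `^ q^-1 <= 1)%E.
      apply: le_trans hp; apply: ereal_sup_ubound; exists r => //.
      by rewrite /= in_itv /= r0.
    move: hc; rewrite /circ_mean RI_fin// -EFinM poweR_EFin lee_fin => hc.
    have x0 : 0 <= (2 * pi)^-1 * RI 0 (2 * pi) (fun t => modc (f (circ r t)) `^ q).
      by rewrite mulr_ge0// invr_ge0.
    rewrite -[leRHS]mulr1 -ler_pdivrMl// leNgt; apply/negP => h1.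
    move: hc; apply/negP; rewrite -ltNge.
    have e1 : (1 : R) `^ q^-1 = 1 by rewrite powR1.
    rewrite -[ltLHS]e1.
    by rewrite gt0_ltr_powR ?invr_gt0// ?nnegrE.
  (* At this level, with [L = l ^ (lam - 1)], one has [M ^ 2 = L] and [M ^ (2 - q) = l * L], so the
     two parts of the splitting balance. *)
  pose M := l `^ (- q^-1); have M0 : 0 < M by rewrite powR_gt0.
  have M2 : M ^+ 2 = l `^ (lam_of q%:E - 1).
    rewrite -powR_mulrn ?(ltW M0)// -powRrM /lam_of /=; congr (_ `^ _).
    by field; rewrite gt_eqF.
  have Mq : M `^ (2 - q) = l * l `^ (lam_of q%:E - 1).
    rewrite -powRrM -{2}(powRr1 (ltW l0)) -powRD; last by apply/implyP => _; rewrite gt_eqF.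
    by rewrite /lam_of /=; congr (_ `^ _); field; rewrite gt_eqF.
  set L := l `^ (lam_of q%:E - 1) in M2 Mq *.
  have L0 : 0 <= L by exact: powR_ge0.
  have c1 : cts 0 (2 * pi) (fun t => L * modc (ckernel b (circ r t)) ^+ 2).
    exact: (ctsM (@cts_cst R 0 (2 * pi) L) ctk).
  have c2 : cts 0 (2 * pi) (fun t => (l * L * (1 - modc b * r)^-1 ^+ 2) * modc (f (circ r t)) `^ q).
    exact: (ctsM (@cts_cst R 0 (2 * pi) _) ctq).
  apply: (@le_trans _ _ (RI 0 (2 * pi) (fun t => L * modc (ckernel b (circ r t)) ^+ 2 +
    (l * L * (1 - modc b * r)^-1 ^+ 2) * modc (f (circ r t)) `^ q))).
    apply: RI_le => [//||t _]; first exact: ctsD.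
    have := sqr_le_powR p2 M0 (modc_ge0 (f (circ r t))); rewrite M2 Mq => hx.
    apply: le_trans (ler_wpM2r (sqr_ge0 _) hx) _.
    rewrite mulrDl lerD2l mulrAC ler_wpM2r ?powR_ge0//.
    by rewrite ler_wpM2l// mulr_ge0// ltW.
  rewrite (RID c1 c2) (RIZ _ ctk) (RIZ _ ctq).
  set D := 1 - modc b * r in dr d0 pk kb *.
  have -> : 2 * pi * (2 * L) / D = L * (2 * pi / D) + L * (2 * pi / D).
    by ring.
  apply: lerD; first by rewrite ler_wpM2l.
  (* The large part of [f] uses the bound [D^-1 ^+ 2] of [|k|^2]; since [l <= D], the extra [l]
     absorbs one power. *)
  have lD : l / D <= 1 by rewrite ler_pdivrMr// mul1r.
  have -> : L * (2 * pi / D) = (1 * L / D) * (2 * pi) by ring.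
  have -> : l * L * D^-1 ^+ 2 = (l / D) * L / D by ring.
  apply: ler_pM => //.
  + by rewrite !mulr_ge0// ?invr_ge0 ltW.
  + by apply: RI_ge0 => t _; exact: powR_ge0.
  + by rewrite ler_wpM2r ?invr_ge0 ?(ltW d0)// ler_wpM2r.
- rewrite /lam_of /= subrr powRr0 mulr1.
  have f1 z : modc z < 1 -> modc (f z) <= 1.
    move=> z1'; rewrite -lee_fin; apply: le_trans hp; apply: ereal_sup_ubound.
    by exists z.
  apply: (@le_trans _ _ (RI 0 (2 * pi) (fun t => modc (ckernel b (circ r t)) ^+ 2))).
    apply: RI_le => // t _; rewrite -[leRHS]mul1r ler_wpM2r ?sqr_ge0//.
    by rewrite exprn_ile1 ?modc_ge0// f1.
  rewrite (le_trans pk)// ler_wpM2r ?invr_ge0 ?(ltW d0)//; lra.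
Qed.

End Embedding.

(** * Cut-off integrands and their polar form *)

Section Bump.
Context {R : realType}.
Local Notation mu := (@lebesgue_measure R).
Implicit Types (phi u F : R * R -> R) (a s : R).

Lemma contR_max (T : topologicalType) (u v : T -> R) (x : T) :
  contR u x -> contR v x -> contR (fun y => Num.max (u y) (v y)) x.
Proof. by move=> cu cv; apply: (continuous_max cu cv). Qed.

Lemma contR_near (T : topologicalType) (u v : T -> R) (x : T) :
  (\forall y \near x, u y = v y) -> contR u x -> contR v x.
Proof.
move=> uv cu; have e : u x = v x by exact: nbhs_singleton uv.
rewrite /contR /prop_for /continuous_at -e; apply: cvg_trans cu.
exact: near_eq_cvg.
Qed.

(** Where [u < 0] the product is locally 0, so [phi] matters only on [0 <= u]. A function analytic
    on the unit disc and cut off inside it becomes continuous on the whole plane. *)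
Lemma bump_continuous phi u : continuous u -> (forall p, 0 <= u p -> contR phi p) ->
  continuous (fun p => phi p * Num.max 0 (u p)).
Proof.
move=> cu cphi p; have [u0|un] := leP 0 (u p).
  have c1 : contR (fun p => Num.max 0 (u p)) p by apply: contR_max; [exact: contR_cst|exact: cu].
  exact: (contR_M (cphi p u0) c1).
apply: (@contR_near _ (fun=> 0)); last exact: contR_cst.
have : \forall y \near p, u y < 0.
  have nu : 0 < - u p by rewrite oppr_gt0.
  have /cvgrPdist_lt/(_ _ nu) := cu p; apply: filterS => y; rewrite ltr_norml => /andP[h _].
  move: h; lra.
by apply: filterS => y yn; rewrite max_l ?mulr0// ltW.
Qed.

(** The integral of a nonnegative function is the supremum over the simple functions below it, and
    those below [f] on [D] lie below [g]. It is applied to Carleson boxes directly in their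
    parametrised form. *)
Lemma integral_le_mono (d : measure_display) (T : measurableType d)
    (nu : {measure set T -> \bar R}) (D : set T) (f g : T -> \bar R) :
  (forall x, D x -> (0 <= f x)%E) -> (forall x, (0 <= g x)%E) -> (forall x, D x -> (f x <= g x)%E) ->
  (\int[nu]_(x in D) f x <= \int[nu]_x g x)%E.
Proof.
move=> f0 g0 fg; rewrite integral_mkcond.
have fD0 x : (0 <= (f \_ D) x)%E.
  by rewrite patchE; case: ifPn => //; rewrite inE => /f0.
rewrite !ge0_integralTE//; apply: le_ereal_sup => _ [h hf <-]; exists h => // x.
apply: le_trans (hf x) _; rewrite patchE; case: ifPn => //; rewrite inE => /fg.
by [].
Qed.

(** The cut-off becomes the factor [r * (s ^+ 2 - r ^+ 2)], the weight of [littlewood_paley]: this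
    links area integrals with estimates on circles. *)
Lemma bump_polar phi a1 a2 s : 0 < s -> (forall p, 0 <= phi p) ->
  (forall p, (p.1 - a1) ^+ 2 + (p.2 - a2) ^+ 2 <= s ^+ 2 -> contR phi p) ->
  (\int[(mu \x mu)%E]_p
     (phi p * Num.max 0 (s ^+ 2 - ((p.1 - a1) ^+ 2 + (p.2 - a2) ^+ 2)))%:E =
   (RI 0 s (fun r => RI 0 (2 * pi) (fun t =>
      r * (s ^+ 2 - r ^+ 2) * phi (a1 + r * cos t, a2 + r * sin t))))%:E)%E.
Proof.
move=> s0 phi0 cphi; set u := fun p : R * R => s ^+ 2 - ((p.1 - a1) ^+ 2 + (p.2 - a2) ^+ 2).
have cu : continuous u by move=> p; apply: contRE; rewrite /u; conttac.
have cF : continuous (fun p => phi p * Num.max 0 (u p)).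
  by apply: bump_continuous => // p; rewrite subr_ge0; exact: cphi.
have F0 p : 0 <= phi p * Num.max 0 (u p) by rewrite mulr_ge0// le_max lexx.
have Fz x y : s ^+ 2 <= (x - a1) ^+ 2 + (y - a2) ^+ 2 -> phi (x, y) * Num.max 0 (u (x, y)) = 0.
  by move=> h; rewrite max_l ?mulr0// subr_le0.
rewrite (plane_polar s0 cF F0 Fz); congr EFin.
have p0 := @pi2_ge0 R.
pose G (q : R * R) := q.2 * (phi (a1 + q.2 * cos q.1, a2 + q.2 * sin q.1) *
   Num.max 0 (u (a1 + q.2 * cos q.1, a2 + q.2 * sin q.1))).
have cG : continuous G.
  move=> q; apply: contRE; apply: contR_M; first exact: contR_snd.
  apply: (contR_comp2 cF).
  - by conttac; apply: contR_cos; exact: contR_fst.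
  - by conttac; apply: contR_sin; exact: contR_fst.
have sw := RI_swap p0 (ltW s0) (cts2_continuous p0 (ltW s0) cG).
etransitivity; first exact: sw.
apply: RI_eq => r /andP[hr0 hr1]; apply: RI_eq => t _; rewrite /G /u /=.
have -> : (a1 + r * cos t - a1) ^+ 2 + (a2 + r * sin t - a2) ^+ 2 = r ^+ 2.
  have := cos2Dsin2 t; move: (cos t) (sin t) => c d h.
  by rewrite -[RHS]mulr1 -h; ring.
rewrite max_r; first by ring.
by rewrite subr_ge0 !expr2; exact: (ler_pM hr0 hr0 hr1 hr1).
Qed.

Lemma modc_expi_sub1 (t : R) : modc (1 - expi t) <= 2 * `|t|.
Proof.
have key (x : R) : 0 <= x -> modc (1 - expi x) <= 2 * x.
  move=> x0.
  have h1 : `|sin x| <= 1 * (x - 0).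
    have cc : cts 0 x (@cos R) by apply: cts_pt => // y _; exact: continuous_cos.
    have -> : sin x = RI 0 x (@cos R).
      have ftc := @RI_FTC R 0 x (@sin R) (@cos R) x0 cc (fun y _ => is_derive_sin y).
      by rewrite ftc sin0 subr0.
    by apply: RI_normr => // y _; exact: cos_max.
  have h2 : `|1 - cos x| <= 1 * (x - 0).
    have cc : cts 0 x (@sin R) by apply: cts_pt => // y _; exact: continuous_sin.
    have -> : 1 - cos x = RI 0 x (@sin R).
      have ftc := @RI_FTC R 0 x (fun x => - cos x) (@sin R) x0 cc.
      have d y : 0 <= y <= x -> is_derive y (1 : R) (fun x => - cos x) (sin y).
        by move=> _; apply: is_derive_eq; rewrite opprK.
      by rewrite (ftc d) cos0; ring.
    by apply: RI_normr => // y _; exact: sin_max.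
  have e : 1 - expi x = (1 - cos x) +i* (- sin x) by apply: complex_ext; rewrite /= ?sub0r.
  apply: le_trans (modc_le _) _; rewrite e /= normrN; move: h1 h2; clear; lra.
have [t0|t0] := leP 0 t; first by rewrite ger0_norm//; exact: key.
rewrite ltr0_norm//; have := key (- t); rewrite oppr_ge0 => /(_ (ltW t0)).
rewrite -(modc_conj (1 - expi t)); congr (modc _ <= _).
by apply: complex_ext; rewrite /expi /= ?cosN ?sinN //; ring.
Qed.

End Bump.

Opaque contC contR cts cts2 ccts RI CI.
Section Weighted.
Context {R : realType}.
Notation C := ((R[i])^o).
Implicit Types (f g : C -> C) (b : R[i]) (r t l rho : R).

(** The primitive [r / (1 - x * r)] is used, which unlike [1 / (x * (1 - x * r))] makes sense at
    [x = 0], that is for [l = 1]. *)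
Lemma RI_kernel_primitive (x rho : R) : 0 <= x -> x < 1 -> 0 < rho -> rho < 1 ->
  RI 0 rho (fun r => (1 - x * r)^-1 ^+ 2) = rho / (1 - x * rho).
Proof.
move=> x0 x1 r0 r1.
have nz r : 0 <= r <= rho -> 1 - x * r != 0.
  move=> /andP[h0 h1]; rewrite subr_eq0 eq_sym lt_eqF//.
  by rewrite (le_lt_trans _ (le_lt_trans h1 r1))// -[leRHS]mul1r ler_wpM2r// ltW.
have ftc := @RI_FTC R 0 rho (fun r => r * (1 - x * r)^-1) (fun r => (1 - x * r)^-1 ^+ 2) (ltW r0).
etransitivity; first apply: ftc.
- apply: contR_cts => [|r hr]; first exact: ltW.
  by apply: contR_X; apply: contR_V; [exact: nz|conttac].
- move=> r hr; have nzr := nz r hr.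
  have d1 : is_derive r (1 : R) (fun r => 1 - x * r) (- x).
    by apply: is_derive_eq; rewrite /GRing.scale /=; ring.
  have d2 : is_derive r (1 : R) (fun r => (1 - x * r)^-1) _ := @is_deriveV R (fun r => 1 - x * r) r _ 1 nzr d1.
  have d3 := is_deriveM (is_derive_id r (1:R)) d2.
  move: d3; congr (is_derive _ _ _ _); rewrite /GRing.scale /=; field.
  by rewrite nzr.
by rewrite mul0r subr0.
Qed.

(** On each circle [|f' k|^2 <= 2 |G'|^2 + 2 |f k'|^2] with [G = f k]. Littlewood-Paley bounds the
    first part by [Q / l]. In the second, [|k'| <= |k| / D] with [D = 1 - |b| r] costs two powers of
    [D] and the circular mean a third; the weight returns one, and the integral of [D ^- 2] over [r]
    is at most [1 / l]. *)
Lemma weighted (p : \bar R) f b l rho : (2%:E < p)%E -> holo f -> (Hp_norm p f <= 1)%E ->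
  0 < l -> l <= 1 -> modc b = 1 - l -> 0 < rho -> rho < 1 ->
  RI 0 rho (fun r => RI 0 (2 * pi) (fun t => r * (rho ^+ 2 - r ^+ 2) *
     (modc (cderiv f (circ r t)) ^+ 2 * modc (ckernel b (circ r t)) ^+ 2)))
   <= 10 * pi * (2 * l `^ (lam_of p - 1)) / l.
Proof.
move=> p2 hf hp l0 l1 bl r0 r1; have p0 := @pi2_ge0 R.
have b1 : modc b < 1 by rewrite bl; lra.
have b0 := modc_ge0 b.
have cb := circle_bound p2 hf hp l0 l1 bl.
have [k [hk dk kge ek]] : exists k, [/\ holo k,
    forall z, modc z < 1 -> cdiff k z (b * k z ^+ 2),
    forall z, modc z < 1 -> modc (k z) <= (1 - modc b * modc z)^-1 & ckernel b = k].
  exists (ckernel b); split => //; first exact: kernel_holo.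
    by move=> z z1; exact: cdiff_kernel.
  by move=> z z1; exact: modc_kernel_ge.
rewrite ek in cb *; have hG := holoM hf hk.
have LP := littlewood_paley hG r0 r1.
set Q := 2 * pi * (2 * _) in cb.
have Q0 : 0 <= Q by rewrite /Q mulr_ge0 ?mulr_ge0 ?pi_ge0 ?powR_ge0.
pose G z := f z * k z.
have [f' [hf' df ef']] : exists f', [/\ holo f', forall z, modc z < 1 -> cdiff f z (f' z)
    & cderiv f = f'].
  by exists (cderiv f); split => //; [exact: holo_deriv|move=> z; exact: holo_cdiff].
have [G' [hG' eG' dG]] : exists G', [/\ holo G', cderiv G = G' & forall z, modc z < 1 ->
     G' z = f z * (b * k z ^+ 2) + k z * f' z].
  exists (cderiv G); split => //; first exact: holo_deriv.
  by move=> z z1; exact: cderiv_cdiff (cdiffM (df z z1) (dk z z1)).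
rewrite -/G eG' in LP; rewrite ef' {ek ef' eG'}.
have m1 r t : 0 <= r <= rho -> modc (circ r t) < 1.
  by move=> /andP[h1 h2]; rewrite modc_circ// (le_lt_trans h2).
have cz r t : contC (fun q : R * R => circ q.1 q.2) (r, t) by rewrite /circ; conttac.
have cH (H : C -> C) r t : holo H -> 0 <= r <= rho ->
    contC (fun q : R * R => H (circ q.1 q.2)) (r, t).
  by move=> hH hr; apply: contC_holo => //; exact: (m1 r t hr).
have to2 (F : R -> R -> R) : (forall r t, 0 <= r <= rho -> contR (fun q : R * R => F q.1 q.2) (r, t)) ->
    cts2 0 rho 0 (2 * pi) (fun q => F q.1 q.2).
  by move=> h; apply: cts2_pt => [||r t hr _]; [exact: ltW|exact: p0|exact: h].
have to1 (F : R -> R -> R) : (forall r t, 0 <= r <= rho -> contR (fun q : R * R => F q.1 q.2) (r, t)) ->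
    forall r, 0 <= r <= rho -> cts 0 (2 * pi) (F r).
  by move=> /to2 h r hr; exact: (cts2_sec2 h hr).
pose M r t := r * (rho ^+ 2 - r ^+ 2) *
     (modc (f' (circ r t)) ^+ 2 * modc (k (circ r t)) ^+ 2).
pose N r t := r * (rho ^+ 2 - r ^+ 2) * modc (G' (circ r t)) ^+ 2.
pose A r t := modc (f (circ r t)) ^+ 2 * modc (k (circ r t)) ^+ 2.
have cM r t : 0 <= r <= rho -> contR (fun q : R * R => M q.1 q.2) (r, t).
  move=> hr; have h1 := cH _ r t hf' hr; have h2 := cH _ r t hk hr.
  by rewrite /M; conttac; [exact: h1|exact: h2].
have cN r t : 0 <= r <= rho -> contR (fun q : R * R => N q.1 q.2) (r, t).
  by move=> hr; have h1 := cH _ r t hG' hr; rewrite /N; conttac; exact: h1.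
have cA r t : 0 <= r <= rho -> contR (fun q : R * R => A q.1 q.2) (r, t).
  move=> hr; have h1 := cH _ r t hf hr; have h2 := cH _ r t hk hr.
  by rewrite /A; conttac; [exact: h1|exact: h2].
have cRN := RI_param_cts (ltW r0) p0 (to2 _ cN).
have br r : 0 <= r <= rho -> 0 < 1 - modc b * r.
  move=> /andP[h0 h1]; rewrite subr_gt0.
  by rewrite (le_lt_trans _ (le_lt_trans h1 r1))// -[leRHS]mul1r ler_wpM2r// ltW.
have cB : cts 0 rho (fun r => (1 - modc b * r)^-1 ^+ 2).
  apply: contR_cts => [|r hr]; first exact: ltW.
  by apply: contR_X; apply: contR_V; [rewrite gt_eqF// br|conttac].
have step r : 0 <= r <= rho ->
    RI 0 (2 * pi) (M r) <= 2 * RI 0 (2 * pi) (N r) + 4 * Q * (1 - modc b * r)^-1 ^+ 2.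
  move=> hr; have d0 := br r hr; have /andP[hr0 hr1] := hr.
  have [rz|rn] := eqVneq r 0.
    have e1 : RI 0 (2 * pi) (M r) = 0.
      rewrite (RI_eq (g := fun=> 0)); first by rewrite RI_cst// mul0r.
      by move=> t _; rewrite /M rz !mul0r.
    have e2 : RI 0 (2 * pi) (N r) = 0.
      rewrite (RI_eq (g := fun=> 0)); first by rewrite RI_cst// mul0r.
      by move=> t _; rewrite /N rz !mul0r.
    by rewrite e1 e2 mulr0 add0r; apply: mulr_ge0; [apply: mulr_ge0|exact: sqr_ge0].
  have rp : 0 < r by rewrite lt0r rn.
  set D := 1 - modc b * r in d0 *.
  have AQ : RI 0 (2 * pi) (A r) <= Q / D by exact: cb rp (le_lt_trans hr1 r1).
  have c1 : cts 0 (2 * pi) (fun t => 2 * N r t).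
    exact: (ctsM (@cts_cst R 0 (2 * pi) 2) (to1 _ cN r hr)).
  have c2 : cts 0 (2 * pi) (fun t => 4 * D^-1 * A r t).
    exact: (ctsM (@cts_cst R 0 (2 * pi) (4 * D^-1)) (to1 _ cA r hr)).
  apply: (@le_trans _ _ (RI 0 (2 * pi) (fun t => 2 * N r t + 4 * D^-1 * A r t))); last first.
    rewrite (RID c1 c2) (RIZ _ (to1 _ cN r hr)) (RIZ _ (to1 _ cA r hr)) lerD2l.
    have -> : 4 * Q * D^-1 ^+ 2 = 4 * D^-1 * (Q / D) by ring.
    by rewrite ler_wpM2l// mulr_ge0// invr_ge0 ltW.
  apply: RI_le; [exact: (to1 _ cM r hr)|exact: ctsD|move=> t _].
  rewrite /M /N /A.
  have z1 := m1 r t hr; rewrite (dG _ z1).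
  have kD := kge _ z1; rewrite modc_circ// -/D in kD.
  have k0 := modc_ge0 (k (circ r t)).
  move: (f' _) (f _) kD k0 => d f0; move: (k _) => k1 kD k0.
  pose w := r * (rho ^+ 2 - r ^+ 2).
  have w0 : 0 <= w.
    by rewrite mulr_ge0// subr_ge0 lerXn2r ?nnegrE// ltW.
  (* The weight is at most [1 - r ^+ 2 <= 2 * (1 - r)], and [1 - r <= D]. *)
  have wD : w <= 2 * D.
    have rr1 : r <= 1 by exact: ltW (le_lt_trans hr1 r1).
    have br1 : modc b * r <= 1 * r by rewrite ler_wpM2r// ltW.
    have h2 : rho ^+ 2 <= 1 by rewrite exprn_ile1// ltW.
    have h4 : r * (rho ^+ 2 - r ^+ 2) <= 1 * (rho ^+ 2 - r ^+ 2).
      by rewrite ler_wpM2r// subr_ge0 lerXn2r ?nnegrE// ltW.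
    have h5 : 0 <= (1 - r) ^+ 2 by exact: sqr_ge0.
    rewrite /w /D; move: h4 h2 h5 br1; clear; lra.
  rewrite -/w.
  set a := f0 * _ + _; set c := f0 * (b * k1 ^+ 2).
  have m2 : modc d ^+ 2 * modc k1 ^+ 2 <= 2 * modc a ^+ 2 + 2 * (modc c) ^+ 2.
    have e : d * k1 = a - c by rewrite /a /c; ring.
    rewrite -exprMn -modcM e.
    have := modcB a c; move: (modc_ge0 (a - c)) => x0 hx.
    apply: (@le_trans _ _ ((modc a + modc c) ^+ 2)).
      by rewrite lerXn2r ?nnegrE// addr_ge0// modc_ge0.
    have := sqr_ge0 (modc a - modc c); clear; lra.
  have m3 : modc c ^+ 2 <= (modc f0 ^+ 2 * modc k1 ^+ 2) * D^-1 ^+ 2.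
    rewrite -!exprMn lerXn2r ?nnegrE ?modc_ge0 ?mulr_ge0 ?modc_ge0 ?invr_ge0 ?(ltW d0)//.
    rewrite /c !modcM -mulrA ler_wpM2l ?modc_ge0//.
    rewrite -[leRHS]mul1r ler_pM ?mulr_ge0 ?modc_ge0 ?(ltW b1)// ler_wpM2l//.
  have m4 := ler_wpM2l w0 m2.
  have m5 := ler_wpM2l w0 m3.
  have m6 : w * ((modc f0 ^+ 2 * modc k1 ^+ 2) * D^-1 ^+ 2) <=
     2 * D * ((modc f0 ^+ 2 * modc k1 ^+ 2) * D^-1 ^+ 2).
    by rewrite ler_wpM2r//; apply: mulr_ge0; [apply: mulr_ge0|]; exact: sqr_ge0.
  have e6 : 2 * D * ((modc f0 ^+ 2 * modc k1 ^+ 2) * D^-1 ^+ 2) =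
     2 * D^-1 * (modc f0 ^+ 2 * modc k1 ^+ 2).
    by field; rewrite gt_eqF.
  rewrite e6 in m6; move: m4 m5 m6; clear.
  move: (D^-1) (modc f0 ^+ 2 * _) (_ * D^-1 ^+ 2) (modc d ^+ 2 * _) (modc a ^+ 2) (modc c ^+ 2).
  move=> x1 x2 x3 x4 x5 x6; lra.
have s1 : cts 0 rho (fun r => 2 * RI 0 (2 * pi) (N r)).
  exact: (ctsM (@cts_cst R 0 rho 2) cRN).
have s2 : cts 0 rho (fun r => 4 * Q * (1 - modc b * r)^-1 ^+ 2).
  exact: (ctsM (@cts_cst R 0 rho (4 * Q)) cB).
have T1 := RI_le (RI_param_cts (ltW r0) p0 (to2 _ cM)) (ctsD s1 s2) step.
apply: le_trans T1 _; rewrite (RID s1 s2) (RIZ _ cRN) (RIZ _ cB) RI_kernel_primitive//.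
have rr0 : 0 <= rho <= rho by rewrite lexx ltW.
have dl : l <= 1 - modc b * rho.
  by have := ler_wpM2l b0 (ltW r1); rewrite mulr1 bl; lra.
have d0 := br rho rr0.
have LP2 : 2 * RI 0 rho (fun r => RI 0 (2 * pi) (N r)) <= Q / l.
  apply: le_trans LP _.
  apply: (@le_trans _ _ (1 * (Q / (1 - modc b * rho)))).
    apply: ler_pM.
    - exact: sqr_ge0.
    - by apply: RI_ge0 => t _; exact: sqr_ge0.
    - by rewrite exprn_ile1// ltW.
    - apply: le_trans (cb rho r0 r1); rewrite le_eqVlt; apply/orP; left; apply/eqP.
      by apply: RI_eq => t _; rewrite modcM exprMn.
  by rewrite mul1r ler_wpM2l// lef_pV2 ?posrE.
(* Since [Q] is [2 * pi] times the second factor, 10 is [2 * (1 + 4)]: 1 from Littlewood-Paley and 4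
   from the term with [k']. *)
have e1 : 10 * pi * (2 * l `^ (lam_of p - 1)) / l = Q / l + 4 * Q * l^-1.
  by rewrite /Q; ring.
rewrite e1 lerD//; apply: ler_wpM2l; first exact: (mulr_ge0 (ler0n _ 4) Q0).
have : rho / (1 - modc b * rho) <= 1 * l^-1.
  by rewrite ler_pM ?invr_ge0 ?(ltW r0) ?(ltW d0) ?(ltW r1)// lef_pV2 ?posrE.
by rewrite mul1r.
Qed.

End Weighted.

(** * From polar estimates to area integrals over the disc *)

Section UpperBound.
Context {R : realType}.
Notation C := ((R[i])^o).
Local Notation mu := (@lebesgue_measure R).
Implicit Types (f g : C -> C) (b : R[i]) (a c r t l rho : R).

Lemma toC_circ r t : toC (r * cos t, r * sin t) = circ r t.
Proof. by apply: complex_ext; rewrite /toC /circ ?ReM ?ImM /expi /=; ring. Qed.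

Lemma sqr_modc_toC (p : R * R) : modc (toC p) ^+ 2 = p.1 ^+ 2 + p.2 ^+ 2.
Proof. by rewrite sqr_modc. Qed.

Lemma contC_toC (p : R * R) : contC (@toC R) p.
Proof. by apply: continuous_complex; [exact: fst_continuous|exact: snd_continuous]. Qed.

(** [weighted] holds on discs of radius below 1; radii increasing to 1 and monotone convergence
    extend it to the unit disc. [D] enters only through the pointwise bound on [F]. *)
Lemma weighted_area (p : \bar R) f b c l (D : set (R * R)) (F : R * R -> R) :
  (2%:E < p)%E -> holo f -> (Hp_norm p f <= 1)%E ->
  0 < l -> l <= 1 -> modc b = 1 - l -> 0 <= c ->
  (forall q, D q -> 0 <= F q /\ modc (toC q) < 1 /\ F q <=
     c * (modc (cderiv f (toC q)) ^+ 2 * modc (ckernel b (toC q)) ^+ 2 * (1 - modc (toC q) ^+ 2))) ->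
  (\int[(mu \x mu)%E]_(q in D) (F q)%:E <=
     (c * (10 * pi * (2 * l `^ (lam_of p - 1)) / l))%:E)%E.
Proof.
move=> p2 hf hp l0 l1 bl c0 FD.
have b1 : modc b < 1 by rewrite bl; lra.
have W rho := weighted (rho := rho) p2 hf hp l0 l1 bl.
set B := _ / l in W *.
have [f' [hf' ef']] : exists f', holo f' /\ cderiv f = f'.
  by exists (cderiv f); split => //; exact: holo_deriv.
have [k [hk ek]] : exists k, holo k /\ ckernel b = k.
  by exists (ckernel b); split => //; exact: kernel_holo.
rewrite ef' ek in FD W; clear ef' ek b1 bl.
pose phi (q : R * R) : R := modc (f' (toC q)) ^+ 2 * modc (k (toC q)) ^+ 2.
have phi0 q : 0 <= phi q by rewrite mulr_ge0// sqr_ge0.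
have cphi q : modc (toC q) < 1 -> contR phi q.
  move=> q1; have h1 := contC_holo hf' q1 (@contC_toC q).
  by have h2 := contC_holo hk q1 (@contC_toC q); rewrite /phi; conttac; [exact: h1|exact: h2].
(* Halving [harmonic n], which is 1 at [n = 0], keeps every radius positive. *)
pose s n : R := 1 - harmonic n / 2.
have hb n : 0 < (harmonic n : R) <= 1.
  by apply/andP; split; [rewrite /harmonic invr_gt0 ltr0Sn|rewrite /harmonic invf_le1 ?ler1n ?ltr0Sn].
have s0 n : 0 < s n by rewrite /s; have /andP[] := hb n; clear; lra.
have s1 n : s n < 1 by rewrite /s; have /andP[] := hb n; clear; lra.
have q1 n (q : R * R) : 0 <= s n ^+ 2 - ((q.1 - 0) ^+ 2 + (q.2 - 0) ^+ 2) -> modc (toC q) < 1.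
  rewrite !subr0 -sqr_modc_toC subr_ge0 => h.
  rewrite -(@ltr_pXn2r _ 2) ?nnegrE ?modc_ge0// expr1n (le_lt_trans h)//.
  by rewrite exprn_ilt1 ?ltW.
pose u n (q : R * R) : R := s n ^+ 2 - ((q.1 - 0) ^+ 2 + (q.2 - 0) ^+ 2).
pose G n q := phi q * Num.max 0 (u n q).
have cu n : continuous (u n) by move=> q; apply: contRE; rewrite /u; conttac.
have cG n : continuous (G n).
  by apply: (bump_continuous (cu n)) => q /q1; exact: cphi.
have G0 n q : 0 <= G n q by rewrite mulr_ge0// le_max lexx.
have EG0 n q : (0 <= (G n q)%:E)%E by rewrite lee_fin.
have mG n : measurable_fun setT (fun q => (G n q)%:E).
  by apply/measurable_EFinP; exact: continuous2_measurable.

have iG n : (\int[(mu \x mu)%E]_q (c%:E * (G n q)%:E) <= (c * B)%:E)%E.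
  rewrite (@ge0_integralZl_EFin _ _ _ (mu \x mu)%E setT measurableT (fun q => (G n q)%:E) (fun q _ => EG0 n q) (mG n) c c0).
  rewrite EFinM lee_wpmul2l ?lee_fin//.
  have bp := bump_polar (a1 := 0) (a2 := 0) (s0 n) phi0.
  rewrite /G /u bp; last first.
    by move=> q; rewrite -subr_ge0 => /q1; exact: cphi.
  rewrite lee_fin; apply: le_trans (W (s n) (s0 n) (s1 n)).
  rewrite le_eqVlt; apply/orP; left; apply/eqP; apply: RI_eq => r _; apply: RI_eq => t _.
  by rewrite /phi !add0r toC_circ.
have ndG q : {homo (fun n => (c%:E * (G n q)%:E)%E) : n m / (n <= m)%N >-> (n <= m)%E}.
  move=> n m nm; rewrite -!EFinM lee_fin ler_wpM2l// /G ler_wpM2l//.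
  have sm : s n <= s m.
    rewrite /s lerD2l lerN2 ler_wpM2r// /harmonic /= lef_pV2 ?posrE ?ltr0n// ler_nat.
    exact: nm.
  have h : u n q <= u m q.
    by rewrite /u lerD2r !expr2; exact: (ler_pM (ltW (s0 n)) (ltW (s0 n)) sm sm).
  by rewrite ge_max le_max lexx /= le_max h orbT.
have mcG n : measurable_fun setT (fun q => (c%:E * (G n q)%:E)%E).
  by apply: measurable_funeM; exact: mG.
have cG0 n q : (0 <= c%:E * (G n q)%:E)%E by rewrite mule_ge0// lee_fin.
have MC := monotone_convergence (mu \x mu)%E measurableT mcG (fun n q _ => cG0 n q) (fun q _ => ndG q).
have LE : (limn (fun n => \int[(mu \x mu)%E]_(q in setT) (c%:E * (G n q)%:E)) <= (c * B)%:E)%E.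
  apply: lime_le; last by apply: nearW => n; exact: iG.
  apply: ereal_nondecreasing_is_cvgn => n m nm.
  have h := ge0_le_integral (mu \x mu)%E measurableT (fun q _ => cG0 n q) (mcG n) (mcG m).
  by apply: h => q _; exact: (ndG q n m nm).
rewrite -MC in LE; apply: (le_trans _ LE) => {LE MC}.
have cvG q : modc (toC q) < 1 ->
    (fun n => (c%:E * (G n q)%:E)%E) @ \oo --> (c * (phi q * (1 - modc (toC q) ^+ 2)))%:E.
  move=> qq.
  have cs : s n @[n --> \oo] --> (1 : R).
    have -> : (1 : R) = 1 - 0 * 2^-1 by rewrite mul0r subr0.
    by apply: cvgB; [exact: cvg_cst|apply: cvgMl; exact: cvg_harmonic].
  have -> : 1 - modc (toC q) ^+ 2 = Num.max 0 (1 ^+ 2 - ((q.1 - 0) ^+ 2 + (q.2 - 0) ^+ 2)).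
    rewrite !subr0 -sqr_modc_toC expr1n max_r// subr_ge0 exprn_ile1 ?modc_ge0//.
    exact: ltW.
  pose H (x : R) := c * (phi q * Num.max 0 (x ^+ 2 - ((q.1 - 0) ^+ 2 + (q.2 - 0) ^+ 2))).
  have cH : contR H 1.
    apply: contR_M; first exact: contR_cst.
    apply: contR_M; first exact: contR_cst.
    by apply: contR_max; [exact: contR_cst|conttac].
  have -> : (fun n => (c%:E * (G n q)%:E)%E) = (fun n => (H (s n))%:E) by apply/funext.
  rewrite -/(H 1); apply: cvg_EFin; first exact: nearW.
  exact: (cvg_comp _ _ cs cH).
apply: integral_le_mono.
- by move=> q /FD[h _]; rewrite lee_fin.
- move=> q; apply: lime_ge; first by apply: ereal_nondecreasing_is_cvgn; exact: ndG.
  by apply: nearW => n; exact: cG0.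
- move=> q /FD[_ [h1 h2]]; rewrite (cvg_lim _ (cvG q h1))//.
Qed.

End UpperBound.

(** * Carleson boxes *)

Section BoxBound.
Context {R : realType}.
Notation C := ((R[i])^o).
Local Notation mu := (@lebesgue_measure R).
Implicit Types (f g : C -> C) (b : R[i]) (a c r s t l : R).

Lemma expiD s t : expi (s + t) = expi s * expi t.
Proof. by apply: complex_ext; rewrite ?ReM ?ImM /expi /= ?cosD ?sinD; ring. Qed.

(** With [a + pi * l] the centre of the arc, [1 - b z] splits into a radial part, at most [2 * l],
    and an angular part, at most twice the half-length [pi * l] of the arc. *)
Lemma box_kernel a l (q : R * R) : 0 < l <= 1 -> cbox a l q ->
  let b := (1 - l)%:C * expi (- (a + pi * l)) in
  modc (toC q) < 1 /\ 1 <= ((2 + 2 * pi) * l) ^+ 2 * modc (ckernel b (toC q)) ^+ 2.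
Proof.
move=> /andP[l0 l1] [r [t [/andP[r0 r1] [/andP[t0 t1] ->]]]] b; rewrite toC_circ.
have r0' : 0 <= r by lra.
have z1 : modc (circ r t) < 1 by rewrite modc_circ.
split=> //.
have b1 : modc b < 1.
  by rewrite modcM modc_expi mulr1 modc_real ger0_norm; lra.
have nz := modc_gt0 (kernel_neq0 b1 z1).
have xl : 1 - 2 * l <= (1 - l) * r.
  have h : 0 <= (1 - l) * (r - (1 - l)) by rewrite mulr_ge0; lra.
  have := sqr_ge0 l; move: h; clear; lra.
have x0 : 0 <= (1 - l) * r by rewrite mulr_ge0//; lra.
have x1 : (1 - l) * r <= 1.
  have h : 0 <= l * r by rewrite mulr_ge0// ltW.
  by move: h r1; clear; lra.
have e : 1 - b * circ r t = (1 - (1 - l) * r)%:C + ((1 - l) * r)%:C * (1 - expi (t - (a + pi * l))).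
  by rewrite expiD /b /circ !rmorphB !rmorphM /= !rmorphB /=; ring.
have p0 := @pi_gt0 R.
have pl : 0 <= pi * l by rewrite mulr_ge0// ltW.
have tl : `|t - (a + pi * l)| <= pi * l by rewrite ler_norml; apply/andP; split; lra.
have hD : modc (1 - b * circ r t) <= (2 + 2 * pi) * l.
  rewrite e; apply: le_trans (modcD _ _) _; rewrite modcM !modc_real.
  rewrite ger0_norm; last by rewrite subr_ge0.
  rewrite ger0_norm//.
  have h1 := modc_expi_sub1 (t - (a + pi * l)).
  have h2 : (1 - l) * r * modc (1 - expi (t - (a + pi * l))) <= 1 * (2 * (pi * l)).
    by apply: ler_pM => //; [exact: modc_ge0|move: h1 tl; clear; lra].
  by move: h2 xl; clear; lra.
rewrite /ckernel modcV exprVn ler_pdivlMr ?exprn_gt0// mul1r !expr2.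
exact: (ler_pM (modc_ge0 _) (modc_ge0 _) hD hD).
Qed.

(** On the box, inserting [((2 + 2 * pi) * l) ^+ 2 * |k|^2 >= 1] reduces to [weighted_area]; then
    [l ^ 2 * l ^ (lam - 1) / l = l ^ lam], the growth that the Carleson norm allows. *)
Lemma box_area (p : \bar R) f g a l (S : R) : (2%:E < p)%E -> holo f -> holo g ->
  (Hp_norm p f <= 1)%E -> 0 < l <= 1 -> (forall z, modc z < 1 -> modc (g z) <= S) ->
  (area_int (cbox a l)
     (fun xy => modc (cderiv (Ig g f) (toC xy)) ^+ 2 * (1 - modc (toC xy) ^+ 2))%R <=
   (20 * S ^+ 2 * (2 + 2 * pi) ^+ 2 * l `^ (lam_of p))%:E)%E.
Proof.
move=> p2 hf hg hp l01 gS; have /andP[l0 l1] := l01.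
have p0 := @pi_gt0 R.
pose b := (1 - l)%:C * expi (- (a + pi * l)).
have bl : modc b = 1 - l by rewrite modcM modc_expi mulr1 modc_real ger0_norm; lra.
have S0 : 0 <= S by apply: le_trans (gS 0 _); rewrite ?modc_ge0 ?modc0.
(* [S ^+ 2] bounds [|g|^2], the middle factor comes from [box_kernel], and the division by [pi] is
   the normalisation of the area measure. *)
pose c := S ^+ 2 * ((2 + 2 * pi) * l) ^+ 2 / pi.
have c0 : 0 <= c by rewrite /c mulr_ge0 ?invr_ge0 ?(ltW p0)// mulr_ge0 ?sqr_ge0.
have -> : 20 * S ^+ 2 * (2 + 2 * pi) ^+ 2 * l `^ (lam_of p) =
    c * (10 * pi * (2 * l `^ (lam_of p - 1)) / l).
  have -> : l `^ (lam_of p) = l * l `^ (lam_of p - 1).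
    rewrite -{2}(powRr1 (ltW l0)) -powRD; last by apply/implyP => _; rewrite gt_eqF.
    by congr (_ `^ _); ring.
  rewrite /c; move: (l `^ _) l0 => L; clear -p0; move: (pi : R) p0 => P P0 l0.
  by field; rewrite !gt_eqF.
apply: (weighted_area (f := f) (b := b)) => // q hq.
have [q1 hk] := box_kernel l01 hq; rewrite -/b in hk.
have w0 : 0 <= 1 - modc (toC q) ^+ 2 by rewrite subr_ge0 exprn_ile1 ?modc_ge0 ?ltW.
rewrite Ig_deriv//.
move: (cderiv f _) (ckernel b _) (1 - _ ^+ 2) hk w0 => d k w hk w0.
have g2 : modc (g (toC q)) ^+ 2 <= S ^+ 2.
  by rewrite !expr2; apply: ler_pM; rewrite ?modc_ge0// gS.
split; first by rewrite mulr_ge0 ?invr_ge0 ?(ltW p0)// mulr_ge0 ?sqr_ge0.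
split=> //.
rewrite /c [leLHS]mulrC [leRHS]mulrAC mulrC -[leRHS]mulrAC.
have -> : S ^+ 2 * ((2 + 2 * pi) * l) ^+ 2 / pi * (modc d ^+ 2 * modc k ^+ 2 * w) =
  (modc d ^+ 2 * w / pi) * (S ^+ 2 * (((2 + 2 * pi) * l) ^+ 2 * modc k ^+ 2)) by ring.
have -> : modc (d * g (toC q)) ^+ 2 * w / pi = (modc d ^+ 2 * w / pi) * (modc (g (toC q)) ^+ 2).
  by rewrite modcM exprMn; ring.
apply: ler_wpM2l; first by rewrite mulr_ge0 ?invr_ge0 ?(ltW p0)// mulr_ge0 ?sqr_ge0.
by rewrite -[leLHS]mulr1; apply: ler_pM => //; exact: sqr_ge0.
Qed.

Lemma area_int_ge0 a l F : 0 < l <= 1 -> (forall z, modc z < 1 -> 0 <= F z) ->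
  (0 <= area_int (cbox a l) (fun xy => F (toC xy)))%E.
Proof.
move=> l01 F0; apply: integral_ge0 => q hq; have [q1 _] := box_kernel l01 hq.
by rewrite lee_fin mulr_ge0 ?F0// invr_ge0 pi_ge0.
Qed.

(** The power [l ^ (- lam)] cancels the growth in [box_area]; the 5 comes from rounding 20 up to 25
    before taking square roots. *)
Lemma carleson_bound (p : \bar R) f g (S : R) : (2%:E < p)%E -> holo f -> holo g ->
  (Hp_norm p f <= 1)%E -> (forall z, modc z < 1 -> modc (g z) <= S) ->
  (carleson_part (lam_of p) (Ig g f) <= (5 * (2 + 2 * pi) * S)%:E)%E.
Proof.
move=> p2 hf hg hp gS; apply: ge_ereal_sup => _ [a [l [l01 ->]]].
have /andP[l0 l1] := l01; have p0 := @pi_gt0 R.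
have S0 : 0 <= S by apply: le_trans (gS 0 _); rewrite ?modc_ge0 ?modc0.
have D0 : 0 <= 5 * (2 + 2 * pi) * S by rewrite !mulr_ge0// addr_ge0// mulr_ge0// ltW.
have A := box_area a p2 hf hg hp l01 gS.
have A0 : (0 <= area_int (cbox a l)
     (fun xy => modc (cderiv (Ig g f) (toC xy)) ^+ 2 * (1 - modc (toC xy) ^+ 2))%R)%E.
  apply: (@area_int_ge0 a l (fun z => modc (cderiv (Ig g f) z) ^+ 2 * (1 - modc z ^+ 2))) => //.
  by move=> z z1; rewrite mulr_ge0 ?sqr_ge0// subr_ge0 exprn_ile1 ?modc_ge0 ?ltW.
move: (area_int _ _) A A0 => A hA A0.
have h1 : ((l `^ (- lam_of p))%:E * A <= ((5 * (2 + 2 * pi) * S) ^+ 2)%:E)%E.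
  apply: (@le_trans _ _ ((l `^ (- lam_of p))%:E *
      (20 * S ^+ 2 * (2 + 2 * pi) ^+ 2 * l `^ (lam_of p))%:E)%E).
    by apply: lee_wpmul2l => //; rewrite lee_fin powR_ge0.
  rewrite -EFinM lee_fin powRN mulrCA mulVf ?mulr1; last by rewrite gt_eqF// powR_gt0.
  have : 0 <= S ^+ 2 * (2 + 2 * pi) ^+ 2 by rewrite mulr_ge0 ?sqr_ge0.
  have -> : (5 * (2 + 2 * pi) * S) ^+ 2 = 25 * (S ^+ 2 * (2 + 2 * pi) ^+ 2) by ring.
  by rewrite -mulrA; move: (S ^+ 2 * _) => x; clear; lra.
have -> : (5 * (2 + 2 * pi) * S)%:E = (((5 * (2 + 2 * pi) * S) ^+ 2)%:E `^ 2^-1)%E.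
  by rewrite poweR_EFin powR12_sqrt ?sqr_ge0// sqrtr_sqr ger0_norm.
have i2 : 0 <= 2^-1 :> R by rewrite invr_ge0.
apply: (gt0_ler_poweR i2); [| |exact: h1]; rewrite in_itv /= leey andbT.
- by rewrite mule_ge0// lee_fin powR_ge0.
- by rewrite lee_fin sqr_ge0.
Qed.

End BoxBound.

(** * The zero operator as competitor, and the upper estimate *)

Section EssentialNormUpper.
Context {R : realType}.
Notation C := ((R[i])^o).
Local Notation mu := (@lebesgue_measure R).
Implicit Types (f g : C -> C) (a c r s t l : R).

Lemma holo_cst (d : C) : holo (fun=> d).
Proof. by move=> z _; exists 0; exact: cdiff_cst. Qed.

Lemma carleson_part0 lam : carleson_part lam (fun=> 0 : C) = 0%E :> \bar R.
Proof.
have E0 a l : ((l `^ (- lam))%:E * area_int (cbox a l)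
   (fun xy => modc (cderiv (fun=> 0 : C) (toC xy)) ^+ 2 * (1 - modc (toC xy) ^+ 2))%R)%E = 0%E :> \bar R.
  rewrite /area_int integral0_eq ?mule0// => q _.
  by rewrite (cderiv_cdiff (cdiff_cst 0 _)) modc0 expr0n /= mul0r mul0r.
apply/eqP; rewrite eq_le; apply/andP; split.
  by apply: ge_ereal_sup => _ [a [l [_ ->]]]; rewrite E0 poweR0r ?invr_eq0 ?pnatr_eq0.
apply: ereal_sup_ubound; exists 0, 1; split; first by rewrite ltr01 lexx.
by rewrite E0 poweR0r ?invr_eq0 ?pnatr_eq0.
Qed.

Lemma L2lam_norm0 lam : L2lam_norm lam (fun=> 0 : C) = 0%E :> \bar R.
Proof. by rewrite /L2lam_norm carleson_part0 modc0 adde0. Qed.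

Lemma L2lam0 lam : L2lam lam (fun=> 0 : C) :> Prop.
Proof.
split; first split.
- by apply/holo_analytic; exact: holo_cst.
- apply: (@le_lt_trans _ _ 0%E) => //; apply: ge_ereal_sup => _ [r _ <-].
  rewrite /circ_mean integral0_eq ?mule0 ?poweR0r ?invr_eq0 ?pnatr_eq0//.
  by move=> t _; rewrite modc0 powR0 ?pnatr_eq0.
- apply: (@le_lt_trans _ _ 0%E) => //; apply: ge_ereal_sup => _ [a [l [_ /= ->]]].
  have b0 t : bval (fun=> 0 : C) t = 0 by rewrite /bval; exact: lim_cst.
  have c0 A : cint (bval (fun=> 0 : C)) A = 0 :> C.
    have Re0 (x : R) : complex.Re (bval (fun=> 0 : C) x) = 0 by rewrite b0.
    have Im0 (x : R) : complex.Im (bval (fun=> 0 : C) x) = 0 by rewrite b0.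
    rewrite /cint /Rintegral !integral0_eq// => t _; by rewrite ?Re0 ?Im0.
  rewrite integral0_eq ?mule0 ?poweR0r ?invr_eq0 ?pnatr_eq0//.
  by move=> t _; rewrite b0 c0 mulr0 subrr modc0 expr0n.
Qed.

Lemma compact_op0 p lam :
  compact_op (Hp p) (Hp_norm p) (L2lam lam) (L2lam_norm lam) (fun _ _ => 0 : C).
Proof.
split; first by move=> f h a _ _ z _; rewrite mulr0 addr0.
split; first by move=> f _; exact: L2lam0.
move=> u _; exists id, (fun=> 0); split=> //; split; first exact: L2lam0.
by rewrite subr0 L2lam_norm0; exact: cvg_cst.
Qed.

Lemma supnorm_ge g z : modc z < 1 -> ((modc (g z))%:E <= supnorm g)%E.
Proof. by move=> z1; apply: ereal_sup_ubound; exists z. Qed.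

(** With [K = 0] the essential norm is at most the operator norm; since [Ig g f] vanishes at 0, only
    the Carleson part of the target norm counts. An infinite [supnorm g] makes the right-hand side
    infinite. *)
Lemma ess_norm_upper (p : \bar R) g : (2%:E < p)%E -> holo g ->
  (ess_norm (Hp p) (Hp_norm p) (L2lam (lam_of p)) (L2lam_norm (lam_of p)) (Ig g)
     <= (5 * (2 + 2 * pi))%:E * supnorm g)%E.
Proof.
move=> p2 hg; have p0 := @pi_gt0 R; have D0 : 0 < 5 * (2 + 2 * pi) :> R by lra.
have := @supnorm_ge g; case: (supnorm g) => [S||] gS.
- apply: (@le_trans _ _ (op_norm (Hp p) (Hp_norm p) (L2lam_norm (lam_of p))
    (fun f z => Ig g f z - 0))).
    by apply: ereal_inf_lbound; exists (fun _ _ => 0) => //; exact: compact_op0.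
  apply: ge_ereal_sup => _ [f [[/holo_analytic hf _] hp] <-].
  have -> : (fun z => Ig g f z - 0) = Ig g f by apply/funext => z; rewrite subr0.
  rewrite /L2lam_norm {1}/Ig mul0r modc0 add0e -EFinM.
  by apply: carleson_bound => // z /gS; rewrite lee_fin.
- by rewrite gt0_muley ?lte_fin// leey.
- by have := gS 0; rewrite modc0 ltr01 => /(_ isT); rewrite leeNy_eq.
Qed.

End EssentialNormUpper.

(** * The lower bound *)

Section PointEvaluation.
Context {R : realType}.
Notation C := ((R[i])^o).
Local Notation mu := (@lebesgue_measure R).
Implicit Types (f g : C -> C) (z w : R[i]) (a c r s t l : R).

Lemma polar_form z : exists t, z = circ (modc z) t.
Proof.
have [->|z0] := eqVneq z 0; first by exists 0; rewrite modc0 /circ rmorph0 mul0r.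
have m0 := modc_gt0 z0; have m2 := sqr_modc z.
pose x := complex.Re z / modc z; pose y := complex.Im z / modc z.
have xy : x ^+ 2 + y ^+ 2 = 1.
  by rewrite /x /y !exprMn -mulrDl -m2 exprVn mulfV// sqrf_eq0 gt_eqF.
have x1 : -1 <= x <= 1.
  rewrite -ler_norml -(@ler_pXn2r _ 2) ?nnegrE// expr1n real_normK ?num_real//.
  by rewrite -xy lerDl sqr_ge0.
have sx : Num.sqrt (1 - x ^+ 2) = `|y| by rewrite -xy addrAC subrr add0r sqrtr_sqr.
have xc : complex.Re z = modc z * x by rewrite /x mulrC divfK// gt_eqF.
have yc : complex.Im z = modc z * y by rewrite /y mulrC divfK// gt_eqF.
have cx := acosK x1; have := sin_acos x1; rewrite sx => sy.
exists (if 0 <= y then acos x else - acos x).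
apply: complex_ext; rewrite /circ ?ReM ?ImM /expi /= !mul0r ?subr0 ?addr0.
  by rewrite xc; case: ifP; rewrite ?cosN cx.
rewrite yc; have [y0|y0] := leP 0 y; first by rewrite sy ger0_norm.
by rewrite sinN sy ltr0_norm// opprK.
Qed.

Lemma atan_le (x : R) : `|atan x| <= `|x|.
Proof.
have key (y : R) : 0 <= y -> `|atan y| <= y.
  move=> y0; have nz (u : R) : 1 + u ^+ 2 != 0 by rewrite gt_eqF// ltr_wpDr ?sqr_ge0.
  have cc : cts 0 y (fun u : R => (1 + u ^+ 2)^-1).
    by apply: contR_cts => // u _; apply: contR_V => //; conttac.
  have ftc := @RI_FTC R 0 y (@atan R) (fun u => (1 + u ^+ 2)^-1) y0 cc
    (fun u _ => is_derive1_atan u).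
  rewrite atan0 subr0 in ftc; rewrite -ftc.
  have -> : y = 1 * (y - 0) by rewrite subr0 mul1r.
  rewrite {1}subr0 mul1r; apply: RI_normr => // u _.
  rewrite ger0_norm ?invr_ge0 ?addr_ge0 ?sqr_ge0// invf_le1 ?lerDl ?sqr_ge0//.
  by rewrite ltr_wpDr ?sqr_ge0.
have [x0|x0] := leP 0 x; first by rewrite (ger0_norm x0); exact: key.
by rewrite (ltr0_norm x0) -normrN -atanN; apply: key; rewrite oppr_ge0 ltW.
Qed.

(** Within [e <= 1 / 2] of 1 the real part is at least [1 / 2], so the argument is [atan (Im / Re)],
    of size at most [2 * e]. *)
Lemma near_one_polar w (e : R) : e <= 2^-1 -> modc (w - 1) <= e ->
  exists2 t, `|t| <= 2 * e & w = circ (modc w) t.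
Proof.
move=> e2 we.
have re : `|complex.Re w - 1| <= e.
  by apply: le_trans we; have := modc_Re (w - 1); rewrite ReD ReN.
have im : `|complex.Im w| <= e.
  by apply: le_trans we; have := modc_Im (w - 1); rewrite ImD ImN /= oppr0 addr0.
have e0 : 0 <= e by exact: le_trans im.
have re2 : 2^-1 <= complex.Re w by move: re; rewrite ler_norml => /andP[h _]; lra.
have rp : 0 < complex.Re w by apply: lt_le_trans re2; rewrite invr_gt0.
pose t := atan (complex.Im w / complex.Re w).
have tb : `|t| <= 2 * e.
  apply: le_trans (atan_le _) _; rewrite normrM normfV (gtr0_norm rp).
  by rewrite ler_pdivrMr// (le_trans im)//; have := ler_wpM2l e0 re2; lra.
have ct : 0 < cos t by apply: cos_gt0_pihalf; rewrite atan_gtNpi2 atan_ltpi2.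
pose r := complex.Re w / cos t.
have r0 : 0 <= r by rewrite divr_ge0 ?(ltW rp) ?(ltW ct).
have wr : w = circ r t.
  apply: complex_ext; rewrite /circ ?ReM ?ImM /expi /= !mul0r ?subr0 ?addr0.
    by rewrite divfK// gt_eqF.
  have := atanK (complex.Im w / complex.Re w); rewrite -/t /tan => h.
  by rewrite /r mulrAC -mulrA h mulrC divfK// gt_eqF.
by exists t => //; rewrite {2}wr modc_circ.
Qed.

Lemma toC_inj (q : R * R) r t : toC q = circ r t -> q = (r * cos t, r * sin t).
Proof. by rewrite -toC_circ; case: q => x y [-> ->]. Qed.

(** With [d = 1 - |z|], the arc is centred at the argument of [z] and has length [2 * d]. Dividing
    by [z], of modulus at least [1 / 2], puts [q / z] within [d / 4] of 1, so the angle deviates by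
    at most [d / 2], less than the half-length [2 * pi * d]. *)
Lemma ball_box z : 2^-1 <= modc z -> modc z < 1 -> exists a, forall q : R * R,
  modc (toC q - z) <= (1 - modc z) / 8 -> cbox a (2 * (1 - modc z)) q.
Proof.
move=> z2 z1; have [th zth] := polar_form z.
set d := 1 - modc z; have d0 : 0 < d by rewrite subr_gt0.
have zp : 0 < modc z by apply: lt_le_trans z2; rewrite invr_gt0.
have zn : z != 0 by exact: modc_gt0_neq0.
exists (th - pi * (2 * d)) => q qz.
have we : modc (toC q / z - 1) <= d / 4.
  have -> : toC q / z - 1 = (toC q - z) / z by rewrite mulrBl divff.
  rewrite modcM modcV ler_pdivrMr//; apply: le_trans qz _.
  have := ler_wpM2l (ltW d0) z2; lra.
have d4 : d / 4 <= 2^-1 by rewrite /d; lra.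
have [t tb wt] := near_one_polar d4 we.
set w := toC q / z in wt we.
have qe : toC q = circ (modc z * modc w) (th + t).
  have -> : toC q = z * w by rewrite /w mulrC divfK.
  by rewrite {1}zth {1}wt /circ expiD rmorphM /=; ring.
have qm : modc (toC q) = modc z * modc w.
  by rewrite qe modc_circ// mulr_ge0 ?modc_ge0.
exists (modc z * modc w), (th + t); split; [|split].
- have h1 : modc z <= modc (toC q) + d / 8.
    have -> : modc z = modc (toC q - (toC q - z)) by congr modc; ring.
    by apply: le_trans (modcB _ _) _; rewrite lerD2l.
  have h2 : modc (toC q) <= modc z + d / 8.
    have {1}-> : toC q = z + (toC q - z) by ring.
    by apply: le_trans (modcD _ _) _; rewrite lerD2l.
  by rewrite -qm; move: h1 h2 d0; rewrite /d; clear; move=> *; apply/andP; split; lra.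
- have p2 : 2 <= pi :> R by exact: pi_ge2.
  have h : 2 * (d / 4) <= pi * (2 * d).
    by have := ler_wpM2r (ltW d0) p2; move: d0; clear; lra.
  have : `|t| <= pi * (2 * d) by exact: le_trans tb h.
  by rewrite ler_norml => /andP[]; clear; move=> *; apply/andP; split; lra.
- exact: toC_inj.
Qed.

End PointEvaluation.

(** * Pointwise bound of the derivative by the Carleson norm *)

Section PointDerivative.
Context {R : realType}.
Notation C := ((R[i])^o).
Local Notation mu := (@lebesgue_measure R).
Implicit Types (f g : C -> C) (z w : R[i]) (a c r s t l : R).

Lemma integral_ge_mono (d : measure_display) (T : measurableType d)
    (nu : {measure set T -> \bar R}) (D : set T) (f g : T -> \bar R) :
  (forall x, 0 <= f x)%E -> (forall x, D x -> 0 <= g x)%E -> (forall x, D x -> f x <= g x)%E ->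
  (forall x, ~ D x -> f x = 0%E) ->
  (\int[nu]_x f x <= \int[nu]_(x in D) g x)%E.
Proof.
move=> f0 g0 fg fD; rewrite [leRHS]integral_mkcond; apply: integral_le_mono => // x.
  by rewrite patchE; case: ifPn => //; rewrite inE => /g0.
by move=> _; rewrite patchE; case: ifPn; [rewrite inE => /fg|rewrite notin_setE => /fD ->].
Qed.

Lemma modc_sub_polar z (q : R * R) :
  (q.1 - complex.Re z) ^+ 2 + (q.2 - complex.Im z) ^+ 2 = modc (toC q - z) ^+ 2.
Proof. by rewrite sqr_modc ReD ImD ReN ImN. Qed.

(** Integration of [submean] over the circles about [z] with the weight [r * (s ^+ 2 - r ^+ 2)],
    whose integral over [[0, s]] is [s ^+ 4 / 4]. *)
Lemma submean_area f z s : holo f -> 0 < s -> modc z + s < 1 ->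
  ((pi * modc (f z) ^+ 2 * (s ^+ 4 / 4))%:E <= \int[(mu \x mu)%E]_q
     (modc (f (toC q)) ^+ 2 * Num.max 0 (s ^+ 2 - modc (toC q - z) ^+ 2))%:E)%E.
Proof.
move=> hf s0 zs; have p0 := @pi2_ge0 R.
pose phi (q : R * R) := modc (f (toC q)) ^+ 2.
have q1 (q : R * R) : modc (toC q - z) ^+ 2 <= s ^+ 2 -> modc (toC q) < 1.
  move=> h; have h2 : modc (toC q - z) <= s.
    by rewrite -(@ler_pXn2r _ 2) ?nnegrE ?modc_ge0// ltW.
  apply: le_lt_trans zs; have -> : toC q = z + (toC q - z) by ring.
  by apply: le_trans (modcD _ _) _; rewrite lerD2l.
have cphi (q : R * R) : (q.1 - complex.Re z) ^+ 2 + (q.2 - complex.Im z) ^+ 2 <= s ^+ 2 ->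
    contR phi q.
  rewrite modc_sub_polar => /q1 qq; have h1 := contC_holo hf qq (@contC_toC R q).
  by rewrite /phi; conttac; exact: h1.
have phi0 q : 0 <= phi q by exact: sqr_ge0.
have bp := bump_polar s0 phi0 cphi.
have -> : (\int[(mu \x mu)%E]_q
     (modc (f (toC q)) ^+ 2 * Num.max 0 (s ^+ 2 - modc (toC q - z) ^+ 2))%:E)%E =
   (\int[(mu \x mu)%E]_q (phi q * Num.max 0 (s ^+ 2 -
      ((q.1 - complex.Re z) ^+ 2 + (q.2 - complex.Im z) ^+ 2)))%:E)%E.
  by apply: eq_integral => q _; rewrite modc_sub_polar.
rewrite bp lee_fin.
have pt r t : toC (complex.Re z + r * cos t, complex.Im z + r * sin t) = z + circ r t.
  by rewrite -toC_circ; apply: complex_ext; rewrite /toC ?ReD ?ImD.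
set M := pi * modc (f z) ^+ 2.
have c2 : cts2 0 s 0 (2 * pi) (fun q => q.1 * (s ^+ 2 - q.1 ^+ 2) * modc (f (z + circ q.1 q.2)) ^+ 2).
  apply: cts2_pt => [||r t /andP[r0 r1] _]; [exact: ltW|exact: p0|apply: contRE].
  have cz : contC (fun q : R * R => z + circ q.1 q.2) (r, t) by rewrite /circ; conttac.
  have z1 : modc (z + circ r t) < 1.
    by apply: le_lt_trans zs; apply: le_trans (modcD _ _) _; rewrite lerD2l modc_circ.
  by have h := contC_holo hf z1 cz; conttac; exact: h.
have cp : cts 0 s (fun r => M * (r * (s ^+ 2 - r ^+ 2))).
  by apply: contR_cts => [|r _]; [exact: ltW|conttac].
have e : RI 0 s (fun r => M * (r * (s ^+ 2 - r ^+ 2))) = M * (s ^+ 4 / 4).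
  have ftc := @RI_FTC R 0 s (fun r => M * (s ^+ 2 * r ^+ 2 / 2 - r ^+ 4 / 4))
    (fun r => M * (r * (s ^+ 2 - r ^+ 2))) (ltW s0) cp.
  have d r : 0 <= r <= s -> is_derive r (1 : R) (fun r => M * (s ^+ 2 * r ^+ 2 / 2 - r ^+ 4 / 4))
      (M * (r * (s ^+ 2 - r ^+ 2))).
    by move=> _; apply: is_derive_eq; rewrite /GRing.scale /=; field.
  by rewrite (ftc d) !expr0n /=; field.
have -> : RI 0 s (fun r => RI 0 (2 * pi) (fun t => r * (s ^+ 2 - r ^+ 2) *
    phi (complex.Re z + r * cos t, complex.Im z + r * sin t))) =
    RI 0 s (fun r => RI 0 (2 * pi) (fun t => r * (s ^+ 2 - r ^+ 2) * modc (f (z + circ r t)) ^+ 2)).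
  by apply: RI_eq => r _; apply: RI_eq => t _; rewrite /phi pt.
rewrite -e; apply: RI_le; [exact: cp|exact: (RI_param_cts (ltW s0) p0 c2)|].
move=> r hr; have /andP[r0 r1] := hr.
have c1 : cts 0 (2 * pi) (fun t => modc (f (z + circ r t)) ^+ 2).
  apply: contR_cts => [|t _]; first exact: p0.
  have z1 : modc (z + circ r t) < 1.
    by apply: le_lt_trans zs; apply: le_trans (modcD _ _) _; rewrite lerD2l modc_circ.
  have cz : contC (fun t : R => z + circ r t) t by rewrite /circ; conttac.
  by apply: contR_X; apply: contR_modc; exact: (contC_holo hf z1 cz).
rewrite (RIZ _ c1).
have w0 : 0 <= r * (s ^+ 2 - r ^+ 2).
  by rewrite mulr_ge0// subr_ge0 !expr2; exact: (ler_pM r0 r0 r1 r1).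
rewrite mulrC; have [->|rn] := eqVneq r 0; first by rewrite !mul0r.
apply: ler_wpM2l => //; apply: submean => //; first by rewrite lt0r rn.
by apply: le_lt_trans zs; rewrite lerD2l.
Qed.

(* [7 / 2048] is [(1 - 1/8) / (4 * 8 ^ 2)]: the ball has radius [(1 - |z|) / 8]. *)
Lemma point_eval_area f z : holo f -> 2^-1 <= modc z -> modc z < 1 -> exists a,
  ((7 / 2048 * (modc (cderiv f z) ^+ 2 * (1 - modc z) ^+ 3))%:E <=
   area_int (cbox a (2 * (1 - modc z)))
     (fun xy => modc (cderiv f (toC xy)) ^+ 2 * (1 - modc (toC xy) ^+ 2))%R)%E.
Proof.
move=> /holo_deriv; move: (cderiv f) => h hh z2 z1.
have [a box] := ball_box z2 z1; exists a.
set d := 1 - modc z in box *; have d0 : 0 < d by rewrite subr_gt0.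
pose s := d / 8; have s0 : 0 < s by rewrite divr_gt0.
have zs : modc z + s < 1 by rewrite /s; move: d0; rewrite /d; clear; lra.
have sa := submean_area hh s0 zs.
have p0 := @pi_gt0 R.
have d12 : 0 < 2 * d <= 1.
  by move: d0 z2; rewrite /d; clear => *; apply/andP; split; lra.
pose w (q : R * R) := Num.max 0 (s ^+ 2 - modc (toC q - z) ^+ 2).
have w0 q : 0 <= w q by rewrite /w le_max lexx.
(* Converts the cut-off into the Carleson weight: on the ball the cut-off is at most [s ^+ 2], while
   [1 - |q|^2] is at least [7 / 8 * d]. *)
pose c := 7 / 8 * d / s ^+ 2 / pi.
have c0 : 0 <= c by rewrite /c !mulr_ge0 ?invr_ge0 ?sqr_ge0 ?(ltW d0) ?(ltW p0).
have e : 7 / 2048 * (modc (h z) ^+ 2 * d ^+ 3) = c * (pi * modc (h z) ^+ 2 * (s ^+ 4 / 4)).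
  rewrite /c /s; move: (modc (h z)) d0; clear -p0; move: (pi : R) p0 d => P P0 d x d0.
  by field; rewrite !gt_eqF.
rewrite e EFinM.
apply: le_trans (lee_wpmul2l _ sa) _; first by rewrite lee_fin.
have cF : continuous (fun q => modc (h (toC q)) ^+ 2 * w q).
  apply: (bump_continuous (phi := fun q => modc (h (toC q)) ^+ 2)
    (u := fun q => s ^+ 2 - modc (toC q - z) ^+ 2)) => q.
    apply: contRE; have cq := @contC_toC R q; conttac; exact: cq.
  rewrite subr_ge0 => hq; have h2 : modc (toC q - z) <= s.
    by rewrite -(@ler_pXn2r _ 2) ?nnegrE ?modc_ge0// ltW.
  have qq : modc (toC q) < 1.
    apply: le_lt_trans zs; have -> : toC q = z + (toC q - z) by ring.
    by apply: le_trans (modcD _ _) _; rewrite lerD2l.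
  by have h3 := contC_holo hh qq (@contC_toC R q); conttac; exact: h3.
have mF : measurable_fun setT (fun q => (modc (h (toC q)) ^+ 2 * w q)%:E).
  by apply/measurable_EFinP; exact: continuous2_measurable.
have F0 q : (0 <= (modc (h (toC q)) ^+ 2 * w q)%:E)%E.
  by rewrite lee_fin mulr_ge0 ?sqr_ge0.
rewrite -(@ge0_integralZl_EFin _ _ _ (mu \x mu)%E setT measurableT _ (fun q _ => F0 q) mF c c0).
have bx q : cbox a (2 * d) q -> modc (toC q) < 1.
  by move=> hq; have [] := box_kernel d12 hq.
apply: integral_ge_mono.
- by move=> q; rewrite mule_ge0// lee_fin.
- move=> q /bx q1; rewrite lee_fin mulr_ge0 ?invr_ge0 ?(ltW p0)// mulr_ge0 ?sqr_ge0//.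
  by rewrite subr_ge0 exprn_ile1 ?modc_ge0 ?ltW.
- move=> q /bx q1; rewrite -EFinM lee_fin.
  have [wn|wp] := leP (s ^+ 2 - modc (toC q - z) ^+ 2) 0.
    rewrite /w max_l// !mulr0 mulr_ge0 ?invr_ge0 ?(ltW p0)// mulr_ge0 ?sqr_ge0//.
    by rewrite subr_ge0 exprn_ile1 ?modc_ge0 ?ltW.
  have ws : w q <= s ^+ 2.
    by rewrite /w ge_max sqr_ge0 /= gerBl sqr_ge0.
  have qz : modc (toC q - z) <= s.
    by rewrite -(@ler_pXn2r _ 2) ?nnegrE ?modc_ge0 ?(ltW s0)//; move: wp; clear; lra.
  have qd : modc (toC q) <= modc z + s.
    have -> : toC q = z + (toC q - z) by ring.
    by apply: le_trans (modcD _ _) _; rewrite lerD2l.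
  (* [1 - |q|^2 >= 1 - |q| >= d - s], and [s = d / 8]. *)
  have v : 7 / 8 * d <= 1 - modc (toC q) ^+ 2.
    have m0 := modc_ge0 (toC q); have : 0 <= modc (toC q) * (1 - modc (toC q)).
      by rewrite mulr_ge0// subr_ge0 ltW.
    by move: qd; rewrite /s /d; clear; lra.
  have -> : c * (modc (h (toC q)) ^+ 2 * w q) =
    modc (h (toC q)) ^+ 2 * ((7 / 8 * d) * (w q / s ^+ 2)) / pi by rewrite /c; ring.
  apply: ler_wpM2r; first by rewrite invr_ge0 ltW.
  apply: ler_wpM2l; first exact: sqr_ge0.
  rewrite -[leRHS]mulr1; apply: ler_pM => //.
  + by rewrite mulr_ge0// ltW.
  + by rewrite mulr_ge0 ?invr_ge0 ?sqr_ge0.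
  + by rewrite ler_pdivrMr ?exprn_gt0// mul1r.
- move=> q hq; have [wn|wp] := leP (s ^+ 2 - modc (toC q - z) ^+ 2) 0.
    by rewrite /w max_l// mulr0 mule0.
  exfalso; apply: hq; apply: box.
  by rewrite -(@ler_pXn2r _ 2) ?nnegrE ?modc_ge0 ?(ltW s0)//; move: wp; rewrite /s; clear; lra.
Qed.

(** The box of [point_eval_area] has length [2 * d], at most 1 because [|z| >= 1 / 2]. Its area
    bound of order [d ^ 3] and the normalisation [(2 * d) ^ (- lam)] combine to [d ^ (3 - lam)], and
    a square root gives the exponent. *)
Lemma point_eval f z lam (N : R) : holo f -> lam <= 1 -> 2^-1 <= modc z -> modc z < 1 ->
  (carleson_part lam f <= N%:E)%E ->
  modc (cderiv f z) * (1 - modc z) `^ ((3 - lam) / 2) <= 32 * N.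
Proof.
move=> hf lam1 z2 z1 hN; have [a A] := point_eval_area hf z2 z1.
have i2 : 0 <= 2^-1 :> R by rewrite invr_ge0.
have d12 : 0 < 2 * (1 - modc z) <= 1.
  by move: z1 z2; clear => *; apply/andP; split; lra.
have sup : ((((2 * (1 - modc z)) `^ (- lam))%:E *
           area_int (cbox a (2 * (1 - modc z)))
             (fun xy => modc (cderiv f (toC xy)) ^+ 2 * (1 - modc (toC xy) ^+ 2))%R)
          `^ (2^-1) <= N%:E)%E.
  by apply: le_trans hN; apply: ereal_sup_ubound; exists a, (2 * (1 - modc z)).
move: (area_int _ _) A sup => B; have x0 := modc_ge0 (cderiv f z).
move: (modc (cderiv f z)) x0 => x x0 A sup {hN}.
set d := 1 - modc z in A d12 sup *; have d0 : 0 < d by rewrite subr_gt0.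
have l0 : 0 <= (2 * d) `^ (- lam) by exact: powR_ge0.
pose K := 7 / 2048 * (x ^+ 2 * d ^+ 3).
have K0 : 0 <= K.
  apply: mulr_ge0; first by clear; lra.
  exact: (mulr_ge0 (sqr_ge0 x) (exprn_ge0 3 (ltW d0))).
have h1 : ((((2 * d) `^ (- lam) * K) `^ 2^-1)%:E <= N%:E)%E.
  apply: le_trans sup; rewrite -poweR_EFin.
  have h2 : (((2 * d) `^ (- lam) * K)%:E <= ((2 * d) `^ (- lam))%:E * B)%E.
    by rewrite EFinM; apply: lee_wpmul2l; [rewrite lee_fin|exact: A].
  have h0 : (0 <= ((2 * d) `^ (- lam) * K)%:E)%E by rewrite lee_fin; exact: (mulr_ge0 l0 K0).
  apply: (gt0_ler_poweR i2); [| |exact: h2]; rewrite in_itv /= leey andbT; first exact: h0.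
  exact: le_trans h0 h2.
have KK := mulr_ge0 l0 K0.
rewrite lee_fin (powR12_sqrt KK) in h1.
have N0 : 0 <= N by apply: le_trans h1; exact: sqrtr_ge0.
have h2 : (2 * d) `^ (- lam) * K <= N ^+ 2.
  rewrite -(sqr_sqrtr KK) !expr2.
  by apply: ler_pM => //; exact: sqrtr_ge0.
have h3 : 2^-1 * d `^ (- lam) <= (2 * d) `^ (- lam).
  rewrite powRM ?(ltW d0)// ler_wpM2r ?powR_ge0//.
  by rewrite -(powR_inv1 (ler0n R 2)) ler_powR ?lerN2// ler1n.
(* The factor [4096 / 7] is 2, lost in replacing [(2 * d) ^ (- lam)] because [lam <= 1], times
   [2048 / 7]; it is below [32 ^ 2]. *)
have e : x ^+ 2 * d `^ (3 - lam) = 4096 / 7 * (2^-1 * d `^ (- lam) * K).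
  rewrite /K; have -> : d `^ (3 - lam) = d ^+ 3 * d `^ (- lam).
    by rewrite -powR_mulrn ?(ltW d0)// -powRD//; apply/implyP => _; rewrite gt_eqF.
  by field.
have h4 : x ^+ 2 * d `^ (3 - lam) <= (32 * N) ^+ 2.
  rewrite e; have := ler_wpM2r K0 h3; have := sqr_ge0 N; move: h2.
  move: (_ * K) (_ * K) => u v; clear; lra.
rewrite -(@ler_pXn2r _ 2) ?nnegrE ?mulr_ge0 ?powR_ge0//.
apply: le_trans h4; rewrite exprMn -[X in _ * X]powR_mulrn ?powR_ge0// -powRrM.
by rewrite divfK ?pnatr_eq0.
Qed.

End PointDerivative.

(** * Normalised kernels *)

Section TestFunctions.
Context {R : realType}.
Notation C := ((R[i])^o).
Implicit Types (f g u v : C -> C) (z w a : R[i]) (c r s t l q : R).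

Lemma Hp_norm_le1 q f : 2 < q -> holo f ->
  (forall r, 0 < r -> r < 1 -> RI 0 (2 * pi) (fun t => modc (f (circ r t)) `^ q) <= 2 * pi) ->
  (Hp_norm q%:E f <= 1)%E.
Proof.
move=> q2 hf fb; have q0 : 0 < q by apply: lt_trans q2.
have p0 := @pi2_gt0 R.
apply: ge_ereal_sup => _ [r + <-]; rewrite /= in_itv /= => /andP[r0 r1].
have cq : cts 0 (2 * pi) (fun t => modc (f (circ r t)) `^ q).
  apply: contR_cts => [|t _]; first exact: ltW.
  apply: contR_powR => // [s|]; first exact: modc_ge0.
  exact: (holo_contR_circ hf (ltW r0) r1).
rewrite /circ_mean (RI_fin cq) -EFinM poweR_EFin lee_fin.
have I0 : 0 <= RI 0 (2 * pi) (fun t => modc (f (circ r t)) `^ q).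
  by apply: RI_ge0 => t _; exact: powR_ge0.
have e1 : (1 : R) `^ q^-1 = 1 by rewrite powR1.
rewrite -[leRHS]e1.
apply: ge0_ler_powR; rewrite ?invr_ge0 ?(ltW q0) ?nnegrE//.
- by rewrite mulr_ge0 ?invr_ge0 ?(ltW p0).
- by rewrite ler_pdivrMl// mulr1; exact: fb.
Qed.

(* The functions of norm at most [1 / 4], in a form that does not depend on the
   triangle inequality of [Hp]. *)
Definition quarter_ball (p : \bar R) f : Prop :=
  match p with
  | EFin q => forall r, 0 < r -> r < 1 ->
      RI 0 (2 * pi) (fun t => modc (f (circ r t)) `^ q) <= 2 * pi * (4^-1 `^ q)
  | _ => forall z, modc z < 1 -> modc (f z) <= 4^-1
  end.

Lemma powR_addr_le (x y q : R) : 0 <= x -> 0 <= y -> 0 <= q ->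
  (x + y) `^ q <= 2 `^ q * (x `^ q + y `^ q).
Proof.
move=> x0 y0 q0; wlog xy : x y x0 y0 / x <= y.
  move=> h; have [/h|/ltW/h] := leP x y; first exact.
  by rewrite addrC [_ `^ q + _]addrC; exact.
apply: (@le_trans _ _ ((2 * y) `^ q)).
  by apply: ge0_ler_powR; rewrite ?nnegrE ?addr_ge0 ?mulr_ge0//; lra.
rewrite powRM// ler_wpM2l ?powR_ge0//.
by rewrite lerDr powR_ge0.
Qed.

(** By [powR_addr_le] the mean of the [q]-th power is at most [2 ^ q * 2 * 4 ^ (- q) = 2 * 2 ^ (- q)
    <= 1]; this fixes the quarter. The difference is written [(-1) * u + v], the shape in which
    linearity of operators is stated. *)
Lemma Hp_norm_diff (p : \bar R) u v : (2%:E < p)%E -> holo u -> holo v ->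
  quarter_ball p u -> quarter_ball p v -> (Hp_norm p (fun w => ((-1) * u w + v w)%R) <= 1)%E.
Proof.
case: p => [q||//]; last first.
  move=> _ _ _ hu hv; apply: ge_ereal_sup => _ [z z1 <-]; rewrite lee_fin.
  apply: le_trans (modcD _ _) _; rewrite mulN1r modcN.
  by have := hu z z1; have := hv z z1; lra.
rewrite lte_fin => q2 hu hv ku kv; have p0 := @pi2_gt0 R.
have q0 : 0 < q by apply: lt_trans q2.
have hd : holo (fun w => (-1) * u w + v w).
  move=> z z1; have [d du] := hu z z1; have [e dv] := hv z z1.
  by exists (-1 * d + e); exact: (cdiffD (cdiffZ (-1) du) dv).
apply: Hp_norm_le1 => // r r0 r1.
have cc f : holo f -> cts 0 (2 * pi) (fun t => modc (f (circ r t)) `^ q).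
  move=> hf; apply: contR_cts => [|t _]; first exact: ltW.
  apply: contR_powR => // [s|]; first exact: modc_ge0.
  exact: (holo_contR_circ hf (ltW r0) r1).
have cs := ctsD (cc _ hu) (cc _ hv).
apply: (@le_trans _ _ (RI 0 (2 * pi) (fun t => 2 `^ q *
   (modc (u (circ r t)) `^ q + modc (v (circ r t)) `^ q)))).
  apply: RI_le; [exact: (cc _ hd)|exact: (ctsM (@cts_cst R 0 (2 * pi) _) cs)|move=> t _].
  apply: le_trans (powR_addr_le (modc_ge0 _) (modc_ge0 _) (ltW q0)).
  apply: ge0_ler_powR; rewrite ?(ltW q0) ?nnegrE ?addr_ge0 ?modc_ge0//.
  by apply: le_trans (modcD _ _) _; rewrite mulN1r modcN.
rewrite (RIZ _ cs) (RID (cc _ hu) (cc _ hv)).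
apply: (@le_trans _ _ (2 `^ q * (2 * pi * 4^-1 `^ q + 2 * pi * 4^-1 `^ q))).
  by rewrite ler_wpM2l ?powR_ge0// lerD ?ku ?kv.
have -> : 2 `^ q * (2 * pi * 4^-1 `^ q + 2 * pi * 4^-1 `^ q) =
  2 * pi * (2 * (2 `^ q * 4^-1 `^ q)) by ring.
rewrite -powRM ?invr_ge0// -[leRHS]mulr1 ler_wpM2l ?(ltW p0)//.
have -> : 2 * 4^-1 = 2^-1 :> R by field.
have h : 2^-1 `^ q <= 2^-1 `^ 1 :> R.
  by apply: ger_powR; [rewrite invr_gt0 ltr0n invf_le1 ?ler1n ?ltr0n|lra].
by move: h; rewrite powRr1 ?invr_ge0//; lra.
Qed.

Lemma quarter_ball_norm (p : \bar R) u : (2%:E < p)%E -> holo u -> quarter_ball p u ->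
  (Hp_norm p u <= 1)%E.
Proof.
move=> p2 hu hq; have h0 : holo (fun=> 0 : C) by exact: holo_cst.
have q0 : quarter_ball p (fun=> 0 : C).
  case: p p2 {hq} => [q||//]; last by move=> _ z _; rewrite modc0 invr_ge0.
  rewrite lte_fin => q2 r r0 r1; rewrite (RI_eq (g := fun=> 0)).
    by rewrite RI_cst ?pi2_ge0// mul0r mulr_ge0 ?pi2_ge0 ?powR_ge0.
  by move=> t _; rewrite modc0 powR0// gt_eqF//; exact: lt_trans q2.
have := Hp_norm_diff p2 h0 hu q0 hq.
by have -> : (fun w => -1 * 0 + u w) = u by apply/funext => w; rewrite mulr0 add0r.
Qed.

(** The exponent is [1 - 1 / p] for [lam = lam_of p], the reciprocal of the growth of the Hardy norm
    of the kernel. *)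
Definition test_fun (lam : R) a : C -> C :=
  fun z => ((1 - modc a) `^ ((1 + lam) / 2) / 4)%:C * ckernel (conjc a) z.

Lemma cdiff_test lam a z : modc a < 1 -> modc z < 1 ->
  cdiff (test_fun lam a) z
    (((1 - modc a) `^ ((1 + lam) / 2) / 4)%:C * (conjc a * ckernel (conjc a) z ^+ 2)).
Proof.
by move=> a1 z1; apply: cdiffZ; apply: cdiff_kernel => //; rewrite modc_conj.
Qed.

Lemma test_holo lam a : modc a < 1 -> holo (test_fun lam a).
Proof. by move=> a1 z z1; eexists; exact: cdiff_test. Qed.

(** With [d = 1 - |a|] and finite exponent [q], [|k| <= 1 / d] gives
    [|k| ^ q <= d ^ (2 - q) * |k| ^ 2], and the Poisson integral supplies [2 * pi / d]; together
    they cancel [d ^ (q - 1)]. For [p = +oo] the pointwise bound is enough. *)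
Lemma test_quarter (p : \bar R) a : (2%:E < p)%E -> modc a < 1 ->
  quarter_ball p (test_fun (lam_of p) a).
Proof.
move=> p2 a1; have b1 : modc (conjc a) < 1 by rewrite modc_conj.
pose d := 1 - modc a; have d0 : 0 < d by rewrite subr_gt0.
have kd z : modc z < 1 -> modc (ckernel (conjc a) z) <= d^-1.
  move=> z1; apply: le_trans (modc_kernel_ge b1 z1) _; rewrite modc_conj.
  have h : modc a * modc z <= modc a * 1 by rewrite ler_wpM2l ?modc_ge0// ltW.
  by rewrite mulr1 in h; rewrite lef_pV2 ?posrE ?subr_gt0 ?(le_lt_trans h)// lerD2l lerN2.
have hk := kernel_holo b1.
case: p p2 => [q||//] p2; last first.
  move=> z z1; rewrite /test_fun modcM modc_real /lam_of.
  rewrite (_ : (1 + 1) / 2 = 1) ?divff// powRr1 ?(ltW d0)// -/d ger0_norm; last first.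
    by rewrite mulr_ge0 ?invr_ge0 ?(ltW d0).
  have := ler_wpM2l (ltW d0) (kd z z1); rewrite divff ?gt_eqF//.
  by move: (modc _) => x; clear; lra.
rewrite lte_fin in p2; have q0 : 0 < q by exact: lt_trans p2.
have p0 := @pi2_gt0 R.
move=> r r0 r1; have pk := poisson_le b1 r0 r1.
have ck : cts 0 (2 * pi) (fun t => modc (ckernel (conjc a) (circ r t)) ^+ 2).
  apply: contR_cts => [|t _]; first exact: ltW.
  by apply: contR_X; exact: (holo_contR_circ hk (ltW r0) r1).
have ct : cts 0 (2 * pi) (fun t => modc (test_fun (lam_of q%:E) a (circ r t)) `^ q).
  apply: contR_cts => [|t _]; first exact: ltW.
  apply: contR_powR => // [s|]; first exact: modc_ge0.
  exact: (holo_contR_circ (test_holo _ a1) (ltW r0) r1).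
have e0 : (1 + lam_of q%:E) / 2 * q = q - 1.
  by rewrite /lam_of; field; rewrite gt_eqF.
apply: (@le_trans _ _ (RI 0 (2 * pi) (fun t => (4^-1 `^ q * d) *
    modc (ckernel (conjc a) (circ r t)) ^+ 2))).
  apply: RI_le; [exact: ct|exact: (ctsM (@cts_cst R 0 (2 * pi) _) ck)|move=> t _].
  have z1 : modc (circ r t) < 1 by rewrite modc_circ// ltW.
  rewrite /test_fun modcM modc_real -/d ger0_norm; last first.
    by rewrite mulr_ge0 ?invr_ge0 ?powR_ge0.
  have k0 := modc_ge0 (ckernel (conjc a) (circ r t)); have kk := kd _ z1.
  move: (modc (ckernel _ _)) k0 kk => x x0 xd.
  rewrite !powRM ?mulr_ge0 ?powR_ge0 ?invr_ge0// -powRrM e0 [_ * 4^-1 `^ q]mulrC -!mulrA.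
  rewrite ler_wpM2l ?powR_ge0//.
  have [->|xn] := eqVneq x 0; first by rewrite powR0 ?gt_eqF// expr0n /= !mulr0.
  have xp : 0 < x by rewrite lt0r xn.
  have -> : x `^ q = x `^ (q - 2) * x ^+ 2.
    by rewrite -powR_mulrn// -powRD ?subrK//; apply/implyP.
  rewrite mulrA ler_wpM2r ?sqr_ge0//.
  have -> : d `^ (q - 1) = d * d `^ (q - 2).
    rewrite -{2}(powRr1 (ltW d0)) -powRD; last by apply/implyP => _; rewrite gt_eqF.
    by congr (_ `^ _); ring.
  rewrite -mulrA -[leRHS]mulr1 ler_wpM2l ?(ltW d0)// -powRM ?(ltW d0)//.
  have e2 : (1 : R) `^ (q - 2) = 1 by rewrite powR1.
  rewrite -[leRHS]e2; apply: ge0_ler_powR; rewrite ?nnegrE ?mulr_ge0 ?(ltW d0)//.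
    by rewrite subr_ge0 ltW.
  by have := ler_wpM2l (ltW d0) xd; rewrite divff ?gt_eqF.
rewrite (RIZ _ ck).
have -> : 2 * pi * 4^-1 `^ q = (4^-1 `^ q * d) * (2 * pi / d) by field; rewrite gt_eqF.
apply: ler_wpM2l; first by rewrite mulr_ge0 ?powR_ge0 ?(ltW d0).
apply: le_trans pk _; rewrite ler_wpM2l ?(ltW p0)// modc_conj.
have h : modc a * r <= modc a * 1 by rewrite ler_wpM2l ?modc_ge0// ltW.
by rewrite mulr1 in h; rewrite lef_pV2 ?posrE ?subr_gt0 ?(le_lt_trans h)// lerD2l lerN2.
Qed.

(** The two exponents add up to 2 and leave [(|a| / 4) * (d / (1 - |a|^2)) ^ 2] with [d = 1 - |a|].
    As [|a| >= 1 / 2] and [1 - |a|^2 <= 2 * d], this is at least [1 / 8 * 1 / 4]. *)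
Lemma test_deriv_diag lam a : 2^-1 <= modc a -> modc a < 1 ->
  32^-1 <= modc (cderiv (test_fun lam a) a) * (1 - modc a) `^ ((3 - lam) / 2).
Proof.
move=> a2 a1; rewrite (cderiv_cdiff (cdiff_test lam a1 a1)).
set d := 1 - modc a; have d0 : 0 < d by rewrite subr_gt0.
have ka : ckernel (conjc a) a = ((1 - modc a ^+ 2)^-1)%:C.
  by rewrite /ckernel mulrC mul_conj fmorphV rmorphB rmorph1.
rewrite ka -rmorphXn modcM modcM !modc_real modc_conj.
rewrite (ger0_norm (sqr_ge0 _)) ger0_norm; last by rewrite mulr_ge0 ?invr_ge0 ?powR_ge0.
set x := modc a in a2 a1 d d0 *.
have w0 : 0 < 1 - x ^+ 2 by rewrite subr_gt0 exprn_ilt1// modc_ge0.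
have wd : 1 - x ^+ 2 <= 2 * d by rewrite /d; have := sqr_ge0 (1 - x); clear; lra.
have pp : d `^ ((1 + lam) / 2) * d `^ ((3 - lam) / 2) = d ^+ 2.
  rewrite -powRD; last by apply/implyP => _; rewrite gt_eqF.
  by rewrite -powR_mulrn ?(ltW d0)//; congr (_ `^ _); field.
have -> : d `^ ((1 + lam) / 2) / 4 * (x * (1 - x ^+ 2)^-1 ^+ 2) * d `^ ((3 - lam) / 2) =
  (x / 4) * (d / (1 - x ^+ 2)) ^+ 2 by rewrite exprMn -pp; ring.
have -> : 32^-1 = (2^-1 / 4) * 2^-1 ^+ 2 :> R by field.
apply: ler_pM.
- by rewrite divr_ge0 ?invr_ge0.
- exact: sqr_ge0.
- by rewrite ler_wpM2r ?invr_ge0.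
- rewrite lerXn2r ?nnegrE ?invr_ge0 ?divr_ge0 ?(ltW d0) ?(ltW w0)//.
  by rewrite ler_pdivlMr// ler_pdivrMl.
Qed.

(** For fixed [z] the kernel stays bounded, so the normalising power sends the derivative to 0 as
    [|a|] tends to 1; this stands in for weak convergence. *)
Lemma test_deriv_off lam a z : modc a < 1 -> modc z < 1 ->
  modc (cderiv (test_fun lam a) z) <= (1 - modc a) `^ ((1 + lam) / 2) * (1 - modc z) ^- 2.
Proof.
move=> a1 z1; have b1 : modc (conjc a) < 1 by rewrite modc_conj.
rewrite (cderiv_cdiff (cdiff_test lam a1 z1)).
have k := modc_kernel_ge b1 z1; have k0 := modc_ge0 (ckernel (conjc a) z).
have d0 : 0 < 1 - modc z by rewrite subr_gt0.
have kz : modc (ckernel (conjc a) z) <= (1 - modc z)^-1.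
  apply: le_trans k _; rewrite modc_conj.
  have h : modc a * modc z <= 1 * modc z by rewrite ler_wpM2r ?modc_ge0// ltW.
  by rewrite mul1r in h; rewrite lef_pV2 ?posrE ?subr_gt0 ?(le_lt_trans h)// lerD2l lerN2.
rewrite modcM modcM modc_real modc_conj ger0_norm; last first.
  by rewrite mulr_ge0 ?invr_ge0 ?powR_ge0.
rewrite modcX -exprVn; move: (modc (ckernel _ _)) k0 kz => x x0 xz.
apply: ler_pM; rewrite ?mulr_ge0 ?invr_ge0 ?powR_ge0 ?modc_ge0 ?sqr_ge0//.
  by have := powR_ge0 (1 - modc a) ((1 + lam) / 2); lra.
rewrite -[leRHS]mul1r; apply: ler_pM; rewrite ?modc_ge0 ?sqr_ge0 ?(ltW a1)//.
by rewrite !expr2; apply: ler_pM.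
Qed.

End TestFunctions.

(** * The compactness argument *)

Section LowerBound.
Context {R : realType}.
Notation C := ((R[i])^o).
Implicit Types (f g h u v : C -> C) (z w a : R[i]).

Lemma cdiffB f g z d e : cdiff f z d -> cdiff g z e -> cdiff (fun w => f w - g w) z (d - e).
Proof.
move=> df dg; have := cdiffD df (cdiffZ (-1) dg); rewrite mulN1r.
by under eq_fun do rewrite mulN1r.
Qed.

Lemma holoB f g : holo f -> holo g -> holo (fun w => f w - g w).
Proof.
move=> hf hg z z1; have [d df] := hf z z1; have [e dg] := hg z z1.
by exists (d - e); exact: cdiffB.
Qed.

Lemma cderivB f g z : holo f -> holo g -> modc z < 1 ->
  cderiv (fun w => f w - g w) z = cderiv f z - cderiv g z.
Proof.
by move=> hf hg z1; apply: cderiv_cdiff; exact: (cdiffB (holo_cdiff hf z1) (holo_cdiff hg z1)).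
Qed.

(** Linearity of an operator is an identity on the disc only; a derivative depends on values near
    the point, so the identity passes to derivatives. *)
Lemma cderiv_eq_disc f g z : holo f -> (forall w, modc w < 1 -> f w = g w) -> modc z < 1 ->
  cderiv g z = cderiv f z.
Proof.
move=> hf fg z1; apply: cderiv_cdiff; have r0 : 0 < 1 - modc z by rewrite subr_gt0.
apply: (cdiff_near r0 _ (holo_cdiff hf z1)) => h hh; apply: fg.
by apply: le_lt_trans (modcD _ _) _; rewrite -ltrBrDl.
Qed.

Lemma L2lam_norm_ge0 lam f : (0 <= L2lam_norm lam f)%E.
Proof.
rewrite /L2lam_norm adde_ge0 ?lee_fin ?modc_ge0//.
set E := (((1 `^ (- lam))%:E * area_int (cbox 0 1)
   (fun xy => modc (cderiv f (toC xy)) ^+ 2 * (1 - modc (toC xy) ^+ 2))%R) `^ 2^-1)%E.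
apply: (@le_trans _ _ E); first exact: poweR_ge0.
by apply: ereal_sup_ubound; exists 0, 1; rewrite ltr01 lexx.
Qed.

Lemma carleson_le_norm lam f : (carleson_part lam f <= L2lam_norm lam f)%E.
Proof. by rewrite /L2lam_norm leeDr// lee_fin modc_ge0. Qed.

Lemma lam_of_le1 (p : \bar R) : (2%:E < p)%E -> lam_of p <= 1.
Proof.
case: p => [q||]//=; rewrite lte_fin => q2.
by rewrite gerBl divr_ge0//; lra.
Qed.

(** If [|g| <= m] held on some outer annulus, [maximum_modulus] would extend it to the whole
    disc. *)
Lemma large_near_boundary g (m : R) : holo g -> 0 <= m ->
  (exists2 z, modc z < 1 & m < modc (g z)) ->
  exists a : nat -> C, forall n, 1 - n.+2%:R^-1 < modc (a n) /\ modc (a n) < 1 /\ m < modc (g (a n)).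
Proof.
move=> hg m0 [z z1 gz].
have H n : exists a : C, 1 - n.+2%:R^-1 < modc a /\ modc a < 1 /\ m < modc (g a).
  apply: contrapT => hn; move: gz; apply/negP; rewrite -leNgt.
  have r1 : 1 - n.+2%:R^-1 < 1 :> R by rewrite gtrBl invr_gt0 ltr0n.
  apply: (maximum_modulus hg m0 r1 _ z1) => w w0 w1.
  by rewrite leNgt; apply/negP => gw; apply: hn; exists w.
by have [a ha] := choice H; exists a.
Qed.

Lemma homo_ge_id (phi : nat -> nat) : {homo phi : m n / (m < n)%N} -> forall n, (n <= phi n)%N.
Proof. by move=> hp; elim=> [//|n ih]; exact: leq_ltn_trans ih (hp _ _ (ltnSn n)). Qed.

Lemma lee_scale (c N : R) (x : \bar R) : 0 < c -> (x <= (c * N)%:E)%E ->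
  ((c^-1)%:E * x <= N%:E)%E.
Proof.
move=> c0 h; have i0 : (0 <= (c^-1)%:E :> \bar R)%E by rewrite lee_fin invr_ge0 ltW.
by apply: le_trans (lee_wpmul2l i0 h) _; rewrite -EFinM mulKf ?lt0r_neq0.
Qed.

(** At [z = a_j] the weighted derivative of the difference of test functions is at least
    [1 / 32 - 1 / 64 = 1 / 64], and point evaluation costs 32, whence [2048 = 64 * 32]. The index
    [j] is fixed first; [k] is chosen afterwards, depending on the distance from [z] to the
    circle. *)
Lemma ess_norm_lower (p : \bar R) g : (2%:E < p)%E -> holo g ->
  bounded_op (Hp p) (Hp_norm p) (L2lam (lam_of p)) (L2lam_norm (lam_of p)) (Ig g) ->
  ((2048^-1)%:E * supnorm g <=
     ess_norm (Hp p) (Hp_norm p) (L2lam (lam_of p)) (L2lam_norm (lam_of p)) (Ig g))%E.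
Proof.
move=> p2 hg [_ [TY _]]; have lam0 := lam_of_gt0 p2; have lam1 := lam_of_le1 p2.
set lam := lam_of p in TY lam0 lam1 *.
apply: le_ereal_inf_tmp => _ [K [linK [KY Kc]] <-].
have Yh f : L2lam lam f -> holo f by move=> [[/holo_analytic]].
have ball f : Hp p f -> (Hp_norm p f <= 1)%E ->
    (L2lam_norm lam (fun z => (Ig g f z - K f z)%R) <= op_norm (Hp p) (Hp_norm p) (L2lam_norm lam)
       (fun f z => (Ig g f z - K f z)%R))%E.
  by move=> hf hn; apply: ereal_sup_ubound; exists f.
have inHp f : holo f -> (Hp_norm p f <= 1)%E -> Hp p f.
  by move=> hf hn; split; [exact/holo_analytic|exact: le_lt_trans hn (ltry 1)].
have test_ball a : modc a < 1 -> (Hp_norm p (test_fun lam a) <= 1)%E.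
  by move=> a1; apply: quarter_ball_norm => //; [exact: test_holo|exact: test_quarter].
have test_Hp a : modc a < 1 -> Hp p (test_fun lam a).
  by move=> a1; apply: inHp; [exact: test_holo|exact: test_ball].
have z1 : modc (0 : C) < 1 by rewrite modc0.
(* A test function in the unit ball shows that the operator norm is nonnegative, which excludes
   [-oo] in the case analysis. *)
have N0 := le_trans (L2lam_norm_ge0 lam _) (ball _ (test_Hp 0 z1) (test_ball 0 z1)).
move: (op_norm _ _ _ _) ball N0 => [N||] ball N0; [|by rewrite leey|by []].
rewrite lee_fin in N0.
apply: lee_scale; first by rewrite ltr0n.
apply: ge_ereal_sup => _ [z0 zd <-]; rewrite lee_fin leNgt; apply/negP => gN.
(* The midpoint between [2048 * N] and [|g z0|] leaves a strict gap on both sides: one for finding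
   points with [|g| > m], one for the error [e]. *)
set G := modc (g z0) in gN; pose m := (2048 * N + G) / 2.
have m0 : 0 <= m by rewrite /m; move: N0 gN; clear; lra.
have mG : m < G by rewrite /m; move: gN; clear; lra.
have mN : 2048 * N < m by rewrite /m; move: gN; clear; lra.
have ex0 : exists2 z, modc z < 1 & m < modc (g z) by exists z0.
have [a ha] := large_near_boundary hg m0 ex0.
have a1 n : modc (a n) < 1 by have [_ []] := ha n.
have [phi [h [hphi [hY cv]]]] := Kc (fun n => test_fun lam (a n))
  (fun n => conj (test_Hp _ (a1 n)) (test_ball _ (a1 n))).
have phi_ge := homo_ge_id hphi.
(* The error enters the final inequality as [4096 * e], which is half the gap: two approximations by
   [h], a factor 32 each, then the factor 64. *)
pose e := (m - 2048 * N) / 8192.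
have e0 : 0 < e by rewrite /e; move: mN; clear; lra.
pose u n := test_fun lam (a (phi n)).
have [n0 hn0] : exists n0, forall n, (n0 <= n)%N ->
    (carleson_part lam (fun z => K (u n) z - h z)%R <= e%:E)%E.
  move/fine_cvgP : cv => [fin /cvgrPdist_lt/(_ e e0) cv].
  have [n0 _ hn0] := filterI fin cv; exists n0 => n nn0.
  have [/= f1 f2] := hn0 n nn0; apply: le_trans (carleson_le_norm _ _) _.
  rewrite -(fineK f1) lee_fin; move: f2; rewrite sub0r normrN => /ltW; apply: le_trans.
  exact: ler_norm.
pose b n := a (phi n).
have b1 n : modc (b n) < 1 by exact: a1.
have bn n : 1 - modc (b n) <= n.+2%:R^-1.
  have [h1 _] := ha (phi n).
  have h2 : (phi n).+2%:R^-1 <= n.+2%:R^-1 :> R.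
    by rewrite lef_pV2 ?posrE ?ltr0n// ler_nat !ltnS.
  by apply: le_trans h2; rewrite lerBlDl -lerBlDr; exact: ltW h1.
have b2 n : 2^-1 <= modc (b n).
  have h1 := bn n; have h2 : n.+2%:R^-1 <= 2^-1 :> R.
    by rewrite lef_pV2 ?posrE ?ltr0n// ler_nat.
  have := le_trans h1 h2; rewrite lerBlDl -lerBlDr; apply: le_trans.
  by clear; lra.
set z := b n0; pose d := 1 - modc z; have d0 : 0 < d by rewrite subr_gt0; exact: b1.
have d1 : d <= 1 by rewrite /d gerBl modc_ge0.
pose W := d `^ ((3 - lam) / 2).
have W0 : 0 <= W by exact: powR_ge0.
have W1 : W <= 1.
  have h1 : d `^ ((3 - lam) / 2) <= d `^ 0.
    apply: ger_powR; first by rewrite d0.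
    by move: lam1; clear; lra.
  by rewrite powRr0 in h1.
pose x := (1 + lam) / 2; have x0 : 0 < x by rewrite divr_gt0 ?addr_gt0.
(* Compensates the factor [(1 - |z|) ^- 2] of [test_deriv_off] and leaves [1 / 64], half of the
   diagonal lower bound. *)
pose eta := d ^+ 2 / 64; have eta0 : 0 < eta by rewrite divr_gt0 ?exprn_gt0.
have [k k0 kx] : exists2 k, (n0 <= k)%N & (1 - modc (b k)) `^ x <= eta.
  pose y := eta `^ x^-1; have y0 : 0 < y by rewrite powR_gt0.
  exists (maxn n0 (Num.bound y^-1)); first exact: leq_maxl.
  have -> : eta = y `^ x by rewrite -powRrM mulVf ?gt_eqF// powRr1// ltW.
  apply: ge0_ler_powR; rewrite ?(ltW x0) ?nnegrE ?subr_ge0 ?(ltW (b1 _)) ?(ltW y0)//.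
  apply: le_trans (bn _) _; rewrite -[leRHS]invrK lef_pV2 ?posrE ?ltr0n ?invr_gt0//.
  apply: ltW; apply: lt_le_trans (archi_boundP _) _; first by rewrite invr_ge0 ltW.
  by rewrite ler_nat (leq_trans (leq_maxr n0 _))// -addn2 leq_addr.
pose X w := (-1) * u k w + u n0 w.
have hu n : holo (u n) by exact: test_holo.
have zz : modc z < 1 by exact: b1.
have z2 : 2^-1 <= modc z by exact: b2.
have hX : holo X.
  move=> w w1; have [c dc] := hu k w w1; have [c' dc'] := hu n0 w w1.
  by exists (-1 * c + c'); exact: (cdiffD (cdiffZ (-1) dc) dc').
have XN : (Hp_norm p X <= 1)%E.
  by apply: Hp_norm_diff => //; apply: test_quarter => //; exact: a1.
have XHp := inHp _ hX XN.
have hT := Yh _ (TY _ XHp); have hK := Yh _ (KY _ XHp).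
have hKn n : holo (K (u n)) by apply: Yh; apply: KY; apply: test_Hp; exact: a1.
have hh := Yh _ hY.
have pe f r : holo f -> (carleson_part lam f <= r%:E)%E -> modc (cderiv f z) * W <= 32 * r.
  by move=> hf hr; exact: (point_eval hf lam1 z2 zz hr).
have P1 := pe _ N (holoB hT hK) (le_trans (carleson_le_norm _ _) (ball _ XHp XN)).
have P2 := pe _ e (holoB (hKn n0) hh) (hn0 _ (leqnn n0)).
have P3 := pe _ e (holoB (hKn k) hh) (hn0 _ k0).
rewrite (cderivB hT hK zz) (Ig_deriv hX hg zz) in P1.
rewrite (cderivB (hKn n0) hh zz) in P2.
rewrite (cderivB (hKn k) hh zz) in P3.
have KX : cderiv (K X) z = cderiv (K (u n0)) z - cderiv (K (u k)) z.
  rewrite -(cderivB (hKn n0) (hKn k) zz).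
  apply: cderiv_eq_disc => //; first exact: holoB.
  move=> w w1; rewrite /X (linK (u k) (u n0) (-1)); [by rewrite mulN1r addrC|exact: test_Hp|exact: test_Hp|exact: w1].
have XD : cderiv X z = cderiv (u n0) z - cderiv (u k) z.
  rewrite -(cderivB (hu n0) (hu k) zz).
  apply: cderiv_eq_disc => //; first exact: holoB.
  by move=> w w1; rewrite /X mulN1r addrC.
have D1 : 32^-1 <= modc (cderiv (u n0) z) * W by exact: test_deriv_diag.
have D2 : modc (cderiv (u k) z) * W <= 64^-1.
  have h1 := test_deriv_off lam (b1 k) zz.
  have h2 : modc (cderiv (u k) z) <= 64^-1.
    apply: le_trans h1 _; apply: le_trans (ler_wpM2r _ kx) _.
      by rewrite invr_ge0 exprn_ge0// subr_ge0 ltW.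
    by rewrite /eta -/d mulrAC divff ?mul1r// expf_neq0// gt_eqF.
  rewrite -[leRHS]mulr1; apply: ler_pM => //; exact: modc_ge0.
have [_ [_ gz]] := ha (phi n0); rewrite -/(b n0) -/z in gz.
have lin3 (A B D : R) : A <= B + D -> 32^-1 <= A * W -> D * W <= 64^-1 -> 64^-1 <= B * W.
  by move=> hA; have := ler_wpM2r W0 hA; clear; lra.
have lin4 (A B D E n i : R) : A <= B + (D + E) -> B * W <= 32 * n -> D * W <= 32 * i ->
    E * W <= 32 * i -> A * W <= 32 * n + 64 * i.
  by move=> hA; have := ler_wpM2r W0 hA; clear; lra.
have lin5 (A n i j : R) : 64^-1 * j <= A -> A <= 32 * n + 64 * i -> j <= 2048 * n + 4096 * i.
  by clear; lra.
have eN : 2048 * N + 4096 * e < m by rewrite /e; move: mN; clear; lra.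
have i64 : 0 <= 64^-1 :> R by clear; lra.
clearbody m e W; rewrite KX in P1.
clear KX; move: (cderiv (K (u n0)) z) (cderiv (K (u k)) z) (cderiv h z) P1 P2 P3 => c1 c2 c3.
move: (cderiv X z) (cderiv (u n0) z) (cderiv (u k) z) (g z) XD D1 D2 gz => y y1 y2 gz' -> D1 D2 gz.
move=> P1 P2 P3.
have h3 : modc y1 <= modc (y1 - y2) + modc y2.
  by have := modcD (y1 - y2) y2; rewrite subrK.
have D3 := lin3 _ _ _ h3 D1 D2.
(* The limit [h] is inserted: the derivative of [Ig g X] is that of [(Ig g - K) X] plus the
   difference of the derivatives of [K (u n0) - h] and [K (u k) - h]. *)
have h1 := modcD ((y1 - y2) * gz' - (c1 - c2)) ((c1 - c3) - (c2 - c3)).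
have e1 : (y1 - y2) * gz' - (c1 - c2) + ((c1 - c3) - (c2 - c3)) = (y1 - y2) * gz' by ring.
rewrite e1 in h1.
have P4 := lin4 _ _ _ _ _ _ (le_trans h1 (lerD (lexx _) (modcB (c1 - c3) (c2 - c3)))) P1 P2 P3.
have P5 := ler_pM i64 m0 D3 (ltW gz).
rewrite modcM mulrAC in P4.
by have := lin5 _ _ _ _ P5 P4; rewrite leNgt eN.
Qed.

End LowerBound.

Close Scope complex_scope.

Theorem theorem7 (R : realType) (p : \bar R) :
  (2%:E < p)%E ->
  exists C1 C2 : R, 0 < C1 /\ 0 < C2 /\
    forall g : (R[i])^o -> (R[i])^o,
      analytic_on_disc g ->
      bounded_op (Hp p) (Hp_norm p) (L2lam (lam_of p)) (L2lam_norm (lam_of p)) (Ig g) ->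
      (C1%:E * supnorm g <=
         ess_norm (Hp p) (Hp_norm p) (L2lam (lam_of p)) (L2lam_norm (lam_of p)) (Ig g))%E /\
      (ess_norm (Hp p) (Hp_norm p) (L2lam (lam_of p)) (L2lam_norm (lam_of p)) (Ig g)
         <= C2%:E * supnorm g)%E.
Proof.
move=> p2; exists 2048^-1, (5 * (2 + 2 * pi)); have p0 := @pi_gt0 R.
split; first by rewrite invr_gt0 ltr0n.
split; first by rewrite mulr_gt0 ?ltr0n// addr_gt0 ?ltr0n// mulr_gt0 ?ltr0n.
move=> g /holo_analytic hg bg.
by split; [exact: ess_norm_lower|exact: ess_norm_upper].
Qed.
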